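(* Let the value function $V(x)$ of the optimal control problem with dynamics $$\dot x = f(x)+g(x)u,\qquad f(x)=Ax+\sum_{p=2}^{\ell}F_p x^{\otimes p},\qquad g(x)=B+\sum_{p=1}^{\ell}G_p\,(x^{\otimes p}\otimes I_m),$$ and cost $$J(x_0,u)=\frac12\int_0^\infty\Big(x^\top Qx+u^\top Ru+\sum_{p=3}^{\lambda}q_p^\top x^{\otimes p}\Big)\,dt$$ solve, in a neighborhood of the origin, the Hamilton-Jacobi-Bellman PDE $$0=\frac{\partial V^\top(x)}{\partial x}f(x)-\frac12\frac{\partial V^\top(x)}{\partial x}g(x)R^{-1}g^\top(x)\frac{\partial V(x)}{\partial x}+\frac12x^\top Qx+\frac12\sum_{p=3}^{\lambda}q_p^\top x^{\otimes p},$$ and let $V$ be, to degree $d$, of the form $$V(x)\approx\frac12x^\top V_2x+\frac12\sum_{i=3}^{d}v_i^\top x^{\otimes i},\qquad v_i\in\mathbb{R}^{n^i},\ i=2,\dots,d,\quad v_2=\mathrm{vec}[V_2]$$ (that is, the right-hand side is the degree-$d$ Taylor polynomial of $V$ at $0$). Then the coefficients of this polynomial are given as follows. First, $v_2=\mathrm{vec}[V_2]$, where $V_2\in\mathbb{R}^{n\times n}$ is the symmetric positive semidefinite solution of the algebraic Riccati equation $$0=A^\top V_2+V_2A-V_2BR^{-1}B^\top V_2+Q.$$ Second, for $3\le k\le d$, let $\tilde v_k\in\mathbb{R}^{n^k}$ solve the linear system $$\begin{aligned}\mathcal{L}_k\big(A-BR^{-1}B^\top V_2\big)^\top\tilde v_k={}&-\sum_{\substack{i,p\ge2\\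 i+p=k+1}}\mathcal{L}_i(F_p)^\top v_i-q_k+\frac14\sum_{\substack{i,j>2\\ i+j=k+2}}ij\,\mathrm{vec}\big[V_i^\top BR^{-1}B^\top V_j\big]\\&+\frac14\sum_{o=1}^{2\ell}\ \sum_{\substack{p,q\ge0\\ p+q=o}}\ \sum_{\substack{i,j\ge2\\ i+j=k-o+2}}ij\,\mathrm{vec}\Big[\big(I_{n^p}\otimes\mathrm{vec}[I_m]^\top\big)\Big(\mathrm{vec}[G_q^\top V_j]^\top\otimes\big(G_p^\top V_i\otimes R^{-1}\big)\Big)\\&\qquad\qquad\times\big(I_{n^{j-1}}\otimes S_{n^{i-1}\times n^qm}\otimes I_m\big)\big(I_{n^{k-p}}\otimes\mathrm{vec}[I_m]\big)\Big].\end{aligned}$$ Then the coefficient vector $v_k=\mathrm{vec}[V_k]\in\mathbb{R}^{n^k}$, $3\le k\le d$, is obtained by symmetrization of $\tilde v_k$.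
   Context: Setting. $n,m,\ell\ge1$, $d\ge2$ are integers and $\lambda$ is an integer; $x(t)\in\mathbb{R}^n$ is the state and $u(t)\in\mathbb{R}^m$ the input. $A\in\mathbb{R}^{n\times n}$, $F_p\in\mathbb{R}^{n\times n^p}$ ($2\le p\le\ell$), $B\in\mathbb{R}^{n\times m}$, $G_p\in\mathbb{R}^{n\times mn^p}$ ($1\le p\le\ell$), $Q\in\mathbb{R}^{n\times n}$ symmetric with $Q\succeq0$, $R\in\mathbb{R}^{m\times m}$ symmetric with $R\succ0$, $q_p\in\mathbb{R}^{n^p}$ ($3\le p\le\lambda$). Conventions: $G_0:=B$; $F_p:=0$ and $G_p:=0$ for $p>\ell$; $q_k:=0$ for $k>\lambda$. The state penalty $x^\top Qx+\sum_{p=3}^{\lambda}q_p^\top x^{\otimes p}$ is of the form $x^\top\mathcal{Q}(x)x$ with $\mathcal{Q}(x)$ an analytic symmetric positive semidefinite matrix-valued function. The value function is $V(x_0):=\min_uJ(x_0,u)$, where $x$ solves $\dot x=f(x)+g(x)u$, $x(0)=x_0$. Standing assumption: the linear-quadratic regulator (LQR) problem for the linearized dynamics, i.e. minimizing $\frac12\int_0^\infty(x^\top Qx+u^\top Ru)\,dt$ subject to $\dot x=Ax+Bu$, has a stabilizing solution: for every initial state the minimum is attained by the feedback $u=-R^{-1}B^\top V_2x$, where $V_2$ is the symmetric positive semidefinite solution of the algebraic Riccati equation $0=A^\top V_2+V_2A-V_2BR^{-1}B^\top V_2+Q$, and all eigenvalues of $A-BR^{-1}B^\top V_2$ have negative real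 part. The value function $V$ is analytic in a neighborhood of the origin, and its lowest-degree term has degree 2. Notation. $\otimes$ is the Kronecker product of matrices, $x^{\otimes k}=x\otimes\cdots\otimes x\in\mathbb{R}^{n^k}$ ($k$ factors, $x^{\otimes0}=1$), $I_p$ is the $p\times p$ identity, and $\mathrm{vec}[\cdot]$ stacks the columns of a matrix into one column vector. For $M\in\mathbb{R}^{p\times q}$ the $k$-way Lyapunov matrix is $$\mathcal{L}_k(M):=\sum_{i=1}^kI_p\otimes\cdots\otimes I_p\otimes M\otimes I_p\otimes\cdots\otimes I_p\in\mathbb{R}^{p^k\times p^{k-1}q}\quad(k\text{ factors, }M\text{ in the }i\text{th position}).$$ The perfect shuffle matrix $S_{q\times p}$ is the $pq\times pq$ permutation matrix such that $\mathrm{vec}[M^\top]=S_{q\times p}\mathrm{vec}[M]$ for all $M\in\mathbb{R}^{p\times q}$. For $v_i\in\mathbb{R}^{n^i}$, $V_i\in\mathbb{R}^{n\times n^{i-1}}$ denotes the matrix with $\mathrm{vec}[V_i]=v_i$. A vector $v\in\mathbb{R}^{n^k}$ is symmetric if $v^\top(a_1\otimes\cdots\otimes a_k)=v^\top(a_{\pi(1)}\otimes\cdots\otimes a_{\pi(k)})$ for all $a_1,\dots,a_k\in\mathbb{R}^n$ and all permutations $\pi$ of $\{1,\dots,k\}$. The symmetrization of $\tilde v\in\mathbb{R}^{n^k}$ is the symmetric vector $v$ determined by $v^\top(a_1\otimes\cdots\otimes a_k)=\frac1{k!}\sum_\pi\tilde v^\top(a_{\pi(1)}\otimes\cdots\otimes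 a_{\pi(k)})$. Because a homogeneous polynomial $v_k^\top x^{\otimes k}$ does not determine $v_k$ uniquely, the assertion that the coefficients ''are given by'' certain vectors means that the degree-$d$ Taylor polynomial of $V$ equals $\frac12\sum_{i=2}^dv_i^\top x^{\otimes i}$ with those (symmetric) vectors. The linear systems are solved successively for $k=3,4,\dots,d$; the right-hand side for index $k$ involves only $v_2,\dots,v_{k-1}$. *)

(* Defs.v *)
(* real_closed.mxtens provides the Kronecker product A *t B and its powers A ^t k;
   real_closed.complex provides the complex numbers R[i] over R. *)
From HB Require Import structures.
From mathcomp Require Import all_boot all_order all_algebra all_fingroup.
From mathcomp Require Import all_classical all_reals all_analysis.
From mathcomp.real_closed Require Import complex mxtens.

Set Implicit Arguments.
Unset Strict Implicit.
Unset Printing Implicit Defensive.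

Import Order.TTheory GRing.Theory Num.Theory.
Import numFieldNormedType.Exports.
Local Open Scope classical_set_scope.
Local Open Scope ring_scope.

Section Kronecker.
Variable R : comNzRingType.

(* Transport of a matrix along equal dimensions, such as n ^ k.-1 * n and n ^ k
   for k > 0: every use below is between provably equal dimensions, for which
   [retype_castmx] applies (the default value 0 is never reached). *)
Definition retype m1 n1 m2 n2 (A : 'M[R]_(m1, n1)) : 'M[R]_(m2, n2) :=
  conform_mx 0 A.

Lemma retype_castmx m1 n1 m2 n2 (e : (m1 = m2) * (n1 = n2))
  (A : 'M[R]_(m1, n1)) : retype m2 n2 A = castmx e A.
Proof.
case: e => e1 e2; case: m2 / e1; case: n2 / e2.
by rewrite castmx_id /retype conform_mx_id.
Qed.

Definition kronpow n (x : 'cV[R]_n) (k : nat) : 'cV[R]_(n ^ k) :=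
  retype (n ^ k) 1 (x ^t k).

(* a_0 (x) a_1 (x) ... (x) a_(k-1) *)
Fixpoint kronprod n k : ('I_k -> 'cV[R]_n) -> 'cV[R]_(n ^ k) :=
  match k with
  | 0 => fun=> const_mx 1
  | k'.+1 => fun a =>
      retype (n ^ k'.+1) 1 (a ord0 *t kronprod (fun i => a (lift ord0 i)))
  end.

(* Column stacking: entry (i, j) of M : 'M_(p, q) sits at position j * p + i. *)
Definition vec p q (M : 'M[R]_(p, q)) : 'cV[R]_(q * p) :=
  \col_s M (mxtens_unindex s).2 (mxtens_unindex s).1.

Definition unvec p q (w : 'cV[R]_(q * p)) : 'M[R]_(p, q) :=
  \matrix_(i, j) w (mxtens_index (j, i)) 0.

Lemma vecK p q : cancel (@vec p q) (@unvec p q).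
Proof. by move=> M; apply/matrixP => i j; rewrite !mxE mxtens_indexK. Qed.

Lemma unvecK p q : cancel (@unvec p q) (@vec p q).
Proof.
move=> w; apply/matrixP => s j; rewrite ord1 !mxE.
by case: (mxtens_indexP s) => a b; rewrite mxtens_indexK.
Qed.

(* The n x n^(i-1) matrix V_i with vec[V_i] = v_i. *)
Definition unfold n i (v : 'cV[R]_(n ^ i)) : 'M[R]_(n, n ^ i.-1) :=
  unvec (retype (n ^ i.-1 * n) 1 v).

(* The perfect shuffle S_(q x p); the dimensions p * q and q * p are the same
   number. *)
Definition shuffle q p : 'M[R]_(p * q, q * p) :=
  \matrix_(r, s) (((mxtens_unindex r).1 == (mxtens_unindex s).2) &&
                  ((mxtens_unindex r).2 == (mxtens_unindex s).1))%:R.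

Lemma shuffleP p q (M : 'M[R]_(p, q)) : vec M^T = shuffle q p *m vec M.
Proof.
apply/matrixP => r j; rewrite ord1 !mxE; case: (mxtens_indexP r) => a b.
rewrite mxtens_indexK (bigD1 (mxtens_index (b, a))) //= big1 ?addr0.
  by rewrite !mxE !mxtens_indexK !eqxx mul1r.
move=> s; case: (mxtens_indexP s) => b' a' ne.
rewrite !mxE !mxtens_indexK /=; case: eqP => [ea|]; last by rewrite mul0r.
case: eqP => [eb|]; last by rewrite mul0r.
by rewrite ea eb eqxx in ne.
Qed.

Definition lyap k p q (M : 'M[R]_(p, q)) : 'M[R]_(p ^ k, p ^ k.-1 * q) :=
  \sum_(i < k) retype (p ^ k) (p ^ k.-1 * q)
    ((1%:M : 'M[R]_(p ^ i)) *t M *t (1%:M : 'M[R]_(p ^ (k.-1 - i)))).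

End Kronecker.

Section Symmetrization.
Variables (R : fieldType) (n k : nat).

Definition tensor_symmetric (v : 'cV[R]_(n ^ k)) : Prop :=
  forall (a : 'I_k -> 'cV[R]_n) (s : {perm 'I_k}),
    v^T *m kronprod a = v^T *m kronprod (a \o s).

Definition is_symmetrization (w v : 'cV[R]_(n ^ k)) : Prop :=
  tensor_symmetric v /\
  forall a : 'I_k -> 'cV[R]_n,
    v^T *m kronprod a =
      (k`!%:R)^-1 *: \sum_(s : {perm 'I_k}) w^T *m kronprod (a \o s).

End Symmetrization.

Section RealMatrices.
Variable R : realType.

Definition symmetric_mx n (M : 'M[R]_n) : Prop := M^T = M.

Definition qform n (M : 'M[R]_n) (x : 'cV[R]_n) : R := (x^T *m M *m x) 0 0.

Definition psd n (M : 'M[R]_n) : Prop := forall x : 'cV[R]_n, 0 <= qform M x.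

Definition posdef n (M : 'M[R]_n) : Prop :=
  forall x : 'cV[R]_n, x != 0 -> 0 < qform M x.

Definition hurwitz n (M : 'M[R]_n) : Prop :=
  forall z : R[i], eigenvalue (map_mx (real_complex R) M) z -> (complex.Re z < 0 :> R).

End RealMatrices.

Section Calculus.
Variables (R : realType) (n : nat).
Implicit Types (f : 'cV[R]_n -> R).

(* The coefficient c_k of degree k is a vector of R^(n^k); the series is required
   to converge absolutely monomial by monomial on the polydisc of radius r
   (`|x| is the max norm). *)
Definition analytic_at f (a : 'cV[R]_n) : Prop :=
  exists (c : forall k, 'cV[R]_(n ^ k)) (r : R),
    [/\ 0 < r,
        cvgn (series (fun k : nat => (\sum_j `|c k j 0|) * r ^+ k)) &
        forall x : 'cV[R]_n, `|x - a| < r ->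
          series (fun k : nat => ((c k)^T *m kronpow (x - a) k) 0 0) @ \oo
            --> f x].

Definition partial (i : 'I_n) f : 'cV[R]_n -> R :=
  fun x => 'D_(delta_mx i 0 : 'cV[R]_n) f x.

Definition grad f (x : 'cV[R]_n) : 'cV[R]_n := \col_i partial i f x.

(* Degree-d Taylor polynomial at 0:
   sum over k <= d and all (s_1, ..., s_k) of
   (1/k!) (partial_(s_1) ... partial_(s_k) f)(0) x_(s_1) ... x_(s_k). *)
Definition taylor (d : nat) f (x : 'cV[R]_n) : R :=
  \sum_(k < d.+1) (k`!%:R)^-1 *
    \sum_(s : k.-tuple 'I_n) foldr partial f s 0 * \prod_(i <- s) x i 0.

Definition half_poly (d : nat) (v : forall i, 'cV[R]_(n ^ i)) (x : 'cV[R]_n) : R :=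
  2^-1 * \sum_(2 <= i < d.+1) ((v i)^T *m kronpow x i) 0 0.

End Calculus.

Section OptimalControl.
Variables (R : realType) (n m : nat).
Variables (f : 'cV[R]_n -> 'cV[R]_n) (g : 'cV[R]_n -> 'M[R]_(n, m)).
Variable (L : 'cV[R]_n -> 'cV[R]_m -> R).
Local Notation mu := (@lebesgue_measure R).

(* x' = f(x) + g(x) u, x(0) = x0 on [0, +oo[ in the sense of Caratheodory, with a
   locally integrable control u. *)
Definition admissible (x0 : 'cV[R]_n) (x : R -> 'cV[R]_n) (u : R -> 'cV[R]_m) :
    Prop :=
  [/\ {within `[0, +oo[, continuous x},
      forall (T : R) (i : 'I_m), 0 <= T ->
        mu.-integrable `[0, T] (fun t => (u t i 0)%:E) &
      forall (t : R) (i : 'I_n), 0 <= t ->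
        x t i 0 = x0 i 0 +
          \int[mu]_(s in `[0, t]) ((f (x s) + g (x s) *m u s) i 0)].

Definition cost (x : R -> 'cV[R]_n) (u : R -> 'cV[R]_m) : \bar R :=
  (\int[mu]_(t in `[0%R, +oo[) (2^-1 * L (x t) (u t))%:E)%E.

Definition optimal (x0 : 'cV[R]_n) (x : R -> 'cV[R]_n) (u : R -> 'cV[R]_m) :
    Prop :=
  admissible x0 x u /\
  forall x' u', admissible x0 x' u' -> (cost x u <= cost x' u')%E.

Definition is_min_cost (x0 : 'cV[R]_n) (c : R) : Prop :=
  exists x u, optimal x0 x u /\ cost x u = c%:E.

End OptimalControl.

Section Problem.
Variables (R : realType) (n m l : nat) (lam : int).
Variables (A : 'M[R]_n) (F : forall p, 'M[R]_(n, n ^ p)).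
Variables (B : 'M[R]_(n, m)) (G : forall p, 'M[R]_(n, n ^ p * m)).
Variables (Q : 'M[R]_n) (Rw : 'M[R]_m) (q : forall p, 'cV[R]_(n ^ p)).

Definition fdyn (x : 'cV[R]_n) : 'cV[R]_n :=
  A *m x + \sum_(2 <= p < l.+1) F p *m kronpow x p.

Definition gdyn (x : 'cV[R]_n) : 'M[R]_(n, m) :=
  B + \sum_(1 <= p < l.+1)
        G p *m retype (n ^ p * m) m (kronpow x p *t (1%:M : 'M[R]_m)).

Definition state_penalty (x : 'cV[R]_n) : R :=
  qform Q x + \sum_(3 <= p < `|lam|%N.+1 | p%:Z <= lam)
                ((q p)^T *m kronpow x p) 0 0.

Definition running (x : 'cV[R]_n) (u : 'cV[R]_m) : R :=
  state_penalty x + qform Rw u.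

Definition hjb_at (V : 'cV[R]_n -> R) (x : 'cV[R]_n) : Prop :=
  0 = ((grad V x)^T *m fdyn x) 0 0
      - 2^-1 * ((grad V x)^T *m gdyn x *m invmx Rw *m (gdyn x)^T *m grad V x) 0 0
      + 2^-1 * state_penalty x.

Definition penalty_psd_form : Prop :=
  exists QQ : 'cV[R]_n -> 'M[R]_n,
    [/\ forall i j a, analytic_at (fun x => QQ x i j) a,
        forall x, symmetric_mx (QQ x) /\ psd (QQ x) &
        forall x, state_penalty x = qform (QQ x) x].

Definition riccati_psd (V2 : 'M[R]_n) : Prop :=
  [/\ symmetric_mx V2, psd V2 &
      0 = A^T *m V2 + V2 *m A - V2 *m B *m invmx Rw *m B^T *m V2 + Q].

Definition closed_loop (V2 : 'M[R]_n) : 'M[R]_n :=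
  A - B *m invmx Rw *m B^T *m V2.

Definition lqr_stabilizing (V2 : 'M[R]_n) : Prop :=
  [/\ riccati_psd V2,
      hurwitz (closed_loop V2) &
      forall x0 : 'cV[R]_n, exists x : R -> 'cV[R]_n,
        optimal (fun x => A *m x) (fun=> B) (fun x u => qform Q x + qform Rw u)
          x0 x (fun t => - (invmx Rw *m B^T *m V2 *m x t))].

(* Conventions: F_p = 0 and G_p = 0 for p > l, G_0 = B, q_p = 0 for p > lam. *)
Definition Fext p : 'M[R]_(n, n ^ p) := if (p <= l)%N then F p else 0.

Definition Gext p : 'M[R]_(n, n ^ p * m) :=
  if p == 0%N then retype n (n ^ p * m) B
  else if (p <= l)%N then G p else 0.

Definition qext p : 'cV[R]_(n ^ p) := if p%:Z <= lam then q p else 0.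

Section RightHandSide.
Variables (v : forall i, 'cV[R]_(n ^ i)) (k : nat).
Let V i : 'M[R]_(n, n ^ i.-1) := unfold (v i).

(* The matrix inside the last vec[ ], of size n^p x n^(k-p) when
   i + j + (p + r) = k + 2. *)
Definition Gblock (p r i j : nat) : 'M[R]_(n ^ p, n ^ (k - p)) :=
  let left : 'M[R]_(n ^ p, n ^ p * m * m) :=
    retype _ _ ((1%:M : 'M[R]_(n ^ p)) *t (vec (1%:M : 'M[R]_m))^T) in
  let mid : 'M[R]_(n ^ p * m * m,
                   n ^ j.-1 * (n ^ r * m * n ^ i.-1) * m) :=
    retype _ _ ((vec ((Gext r)^T *m V j))^T *t
                (((Gext p)^T *m V i) *t invmx Rw)) in
  let perm : 'M[R]_(n ^ j.-1 * (n ^ r * m * n ^ i.-1) * m,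
                    n ^ j.-1 * (n ^ i.-1 * (n ^ r * m)) * m) :=
    (1%:M : 'M[R]_(n ^ j.-1)) *t shuffle R (n ^ i.-1) (n ^ r * m)
                              *t (1%:M : 'M[R]_m) in
  let right : 'M[R]_(n ^ j.-1 * (n ^ i.-1 * (n ^ r * m)) * m, n ^ (k - p)) :=
    retype _ _ ((1%:M : 'M[R]_(n ^ (k - p))) *t vec (1%:M : 'M[R]_m)) in
  left *m mid *m perm *m right.

Definition coef_rhs : 'cV[R]_(n ^ k) :=
  - (\sum_(2 <= i < k.+1) \sum_(2 <= p < k.+1 | (i + p == k.+1)%N)
       retype (n ^ k) 1 ((lyap i (Fext p))^T *m v i))
  - qext k
  + 4^-1 *: (\sum_(3 <= i < k.+1) \sum_(3 <= j < k.+1 | (i + j == k.+2)%N)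
       (i * j)%N%:R *:
         retype (n ^ k) 1 (vec ((V i)^T *m B *m invmx Rw *m B^T *m V j)))
  + 4^-1 *: (\sum_(1 <= o < (2 * l).+1)
       \sum_(0 <= p < o.+1) \sum_(0 <= r < o.+1 | (p + r == o)%N)
       \sum_(2 <= i < k.+1) \sum_(2 <= j < k.+1 | (i + j + o == k.+2)%N)
         (i * j)%N%:R *: retype (n ^ k) 1 (vec (Gblock p r i j))).

End RightHandSide.

Definition coef_system (V2 : 'M[R]_n) (v : forall i, 'cV[R]_(n ^ i)) (k : nat)
    (vt : 'cV[R]_(n ^ k)) : Prop :=
  retype (n ^ k) 1 ((lyap k (closed_loop V2))^T *m vt) = coef_rhs v k.

Definition coefs_given_by (d : nat) (V2 : 'M[R]_n)
    (v : forall i, 'cV[R]_(n ^ i)) : Prop :=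
  [/\ riccati_psd V2,
      v 2%N = vec V2 :> 'cV[R]_(n ^ 2) &
      forall k, (3 <= k <= d)%N ->
        exists vt : 'cV[R]_(n ^ k),
          coef_system V2 v vt /\ is_symmetrization vt (v k)].

End Problem.

(* Main.v *)
Require Import Defs.
From HB Require Import structures.
From mathcomp Require Import all_boot all_order all_algebra all_fingroup.
From mathcomp Require Import all_classical all_reals all_analysis.
From mathcomp.real_closed Require Import complex mxtens.
From mathcomp Require Import zify ring lra.

Set Implicit Arguments.
Unset Strict Implicit.
Unset Printing Implicit Defensive.

Import Order.TTheory GRing.Theory Num.Theory.
Import numFieldNormedType.Exports.
Local Open Scope classical_set_scope.
Local Open Scope ring_scope.

(** The value function is determined degree by degree from its equation.

    Restrict the Hamilton-Jacobi-Bellman equation to a ray s y. Since V is a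
    convergent power series, its gradient has an expansion in s to every order, and
    the coefficients of the equation vanish one by one (hjb_coef). In degree 2 this
    is the Riccati equation for the matrix P of the quadratic part of V
    (hessian0_riccati). In degree k >= 3 it says that the derivative of the part of
    degree k along the closed-loop field is a polynomial in the parts of lower degree
    (hjb_step), and coef_rhs is a tensor representing that polynomial (coef_rhs_form,
    Gblock_form).

    P is the matrix V2 of the regulator. It is positive semidefinite because costs
    are nonnegative, but positive semidefinite solutions of the Riccati equation need
    not be unique in general. Here they are, because the stabilizing feedback is also
    optimal (riccati_psd_unique): a second solution would provide an unstable mode
    that the cost does not see, the zero control would follow it for free, and the
    optimal feedback would then not stabilize it.

    The linear systems are handled through the closed-loop trajectories, whose
    existence is part of the regulator hypothesis and which tend to 0 because the
    closed loop is Hurwitz (hurwitz_decay, by Cayley-Hamilton). A tensor annihilated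
    by the transpose of the k-way Lyapunov matrix is constant along Kronecker
    products of trajectories, hence is zero (sqlyap_conserved). Applied to arbitrary
    products this gives the solvability of the systems, and so the existence of the
    coefficients, independently of V (coefs_exist). Applied to the power x^(k) of a
    single trajectory it shows that the homogeneous polynomial of degree k is
    determined by its derivative along the closed loop, which identifies the part of
    degree k of V with the solution of the system (taylor_given_by).

    The iterated partial derivatives that define the Taylor polynomial are identified
    with the power series by termwise differentiation (power_series_partial) and
    Euler's identity (taylor_coefficient). *)

(** * Scalar differential inequalities *)

Lemma is_derive_nincry (R : realType) (T : R) (f df : R -> R) :
  (forall t : R, T < t -> is_derive t (1 : R) f (df t)) ->
  (forall t : R, T < t -> df t <= 0) ->
  forall s t, T < s -> s <= t -> f t <= f s.
Proof.
move=> fD df_le0 s t Ts st.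
apply: (@ler0_derive1_nincry _ f s) => // [x|x|].
- rewrite in_itv/= andbT => sx.
  by have fx := fD x (lt_trans Ts sx).
- rewrite in_itv/= andbT => sx.
  have fx := fD x (lt_trans Ts sx).
  by rewrite derive1E derive_val; exact: df_le0 (lt_trans Ts sx).
- apply: continuous_in_subspaceT => x; rewrite inE/= in_itv/= andbT => sx.
  have fx := fD x (lt_le_trans Ts sx).
  exact/differentiable_continuous/derivable1_diffP.
Qed.

(** Once e is at most c eps / 2, the function (N - eps / 2) exp(c t) does not
    increase, so N - eps / 2 is at most a constant times exp(- c t). *)
Lemma forced_decay_scalar (R : realType) (c : R) (N dN e : R -> R) :
  0 < c ->
  (forall t : R, 0 <= N t) ->
  (forall t : R, 0 < t -> is_derive t (1 : R) N (dN t)) ->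
  (forall t : R, 0 < t -> dN t <= - c * N t + e t) ->
  e t @[t --> +oo] --> (0 : R) ->
  N t @[t --> +oo] --> (0 : R).
Proof.
move=> c_gt0 N_ge0 ND dN_le e0; apply/cvgrPdist_le => /= eps eps_gt0.
have eps2 : 0 < eps / 2 by rewrite divr_gt0.
have ceps2 : 0 < c * (eps / 2) by rewrite mulr_gt0.
move/cvgrPdist_le : e0 => /(_ _ ceps2) [T0 [_ eT]].
pose T := Num.max T0 0 + 1.
have T_gt0 : 0 < T by rewrite ltr_pwDr// le_max lexx orbT.
have TT0 : T0 < T by rewrite ltr_pwDr// le_max lexx.
pose W t := (N t - eps / 2) * expR (c * t).
pose dW t := (N t - eps / 2) * (expR (c * t) * c) + expR (c * t) * dN t.
have WD (t : R) : 0 < t -> is_derive t (1 : R) W (dW t).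
  move=> t0; have Nt := ND t t0; rewrite /W /dW.
  have E : is_derive t (1 : R) (fun t => expR (c * t)) (expR (c * t) * c).
    apply: (@is_derive1_comp _ expR (fun t => c * t)).
    have := @is_deriveZ _ _ _ id c t (1 : R) 1 (is_derive_id _ _).
    by rewrite /GRing.scale/= mulr1.
  have M : is_derive t (1 : R) (fun t => N t - eps / 2) (dN t).
    have := is_deriveB Nt (is_derive_cst (eps / 2) t (1 : R)).
    by rewrite subr0.
  exact: (is_deriveM M E).
have dW_le0 (t : R) : T < t -> dW t <= 0.
  move=> Tt; have t0 := lt_trans T_gt0 Tt.
  have := eT _ (lt_trans TT0 Tt); rewrite /= sub0r normrN => /ler_normlW et.
  rewrite /dW mulrCA -mulrDr; apply: mulr_ge0_le0; first exact: expR_ge0.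
  have := dN_le t t0; nra.
have Wle s : T + 1 <= s -> W s <= W (T + 1).
  move=> Ts; apply: (is_derive_nincry (T := T) (df := dW)) => //.
    by move=> t Tt; apply: WD; exact: lt_trans T_gt0 Tt.
  by rewrite ltrDl.
pose K := `|W (T + 1)| / (eps / 2).
near=> t.
rewrite sub0r normrN ger0_norm//.
have t_ge : T + 1 <= t by near: t; apply: nbhs_pinfty_ge; rewrite num_real.
have Kt : K <= c * t.
  by rewrite -ler_pdivrMl//; near: t; apply: nbhs_pinfty_ge; rewrite num_real.
have KE : K <= expR (c * t).
  apply: (le_trans Kt); apply: le_trans (expR_ge1Dx _); by rewrite lerDr.
have E0 := expR_gt0 (c * t).
have := Wle t t_ge; rewrite {1}/W => H.
have {}H : (N t - eps / 2) * expR (c * t) <= K * (eps / 2).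
  by rewrite /K divfK ?gt_eqF// (le_trans H)// ler_norm.
have : (N t - eps / 2) * expR (c * t) <= eps / 2 * expR (c * t).
  by rewrite (le_trans H)// mulrC ler_wpM2l// ltW.
rewrite ler_pM2r// lerBlDr => /le_trans; apply.
by rewrite -splitr.
Unshelve. all: end_near. Qed.

(** This is z' = (a + i b) z + (g + i h) for z = u + i v. For N = |z|^2, Young's
    inequality gives N' <= a N + (g^2 + h^2) / (- a), the scalar case. *)
Lemma forced_decay (R : realType) (a b : R) (u v g h : R -> R) :
  a < 0 ->
  (forall t : R, 0 < t -> is_derive t (1 : R) u (a * u t - b * v t + g t)) ->
  (forall t : R, 0 < t -> is_derive t (1 : R) v (b * u t + a * v t + h t)) ->
  g t @[t --> +oo] --> (0 : R) -> h t @[t --> +oo] --> (0 : R) ->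
  u t @[t --> +oo] --> (0 : R) /\ v t @[t --> +oo] --> (0 : R).
Proof.
move=> a_lt0 uD vD g0 h0.
pose N t := u t ^+ 2 + v t ^+ 2.
have N0 : N t @[t --> +oo] --> (0 : R).
  pose e t := (- a)^-1 * (g t ^+ 2 + h t ^+ 2).
  apply: (@forced_decay_scalar _ (- a) N
    (fun t => 2 * (u t * (a * u t - b * v t + g t)
                   + v t * (b * u t + a * v t + h t))) e).
  - by rewrite oppr_gt0.
  - by move=> t; rewrite addr_ge0 ?sqr_ge0.
  - move=> t t0; have ut := uD t t0; have vt := vD t t0; rewrite /N.
    apply: is_derive_eq; rewrite /GRing.scale/=; ring.
  - move=> t t0; rewrite opprK /N /e.
    have a'0 : 0 < - a by rewrite oppr_gt0.
    have : 0 <= (- a)^-1 * ((- a * u t - g t) ^+ 2 + (- a * v t - h t) ^+ 2).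
      by rewrite mulr_ge0 ?invr_ge0 ?addr_ge0 ?sqr_ge0// ltW.
    set x := (X in 0 <= X) => x0.
    rewrite -subr_ge0; apply: (le_trans x0); rewrite le_eqVlt; apply/orP; left.
    apply/eqP; rewrite /x; field; rewrite ?oppr_eq0 ?lt_eqF//.
  - rewrite -[X in _ --> X](mulr0 (- a)^-1); apply: cvgMl_tmp.
    rewrite -[X in _ --> X](addr0 (0 : R)).
    by apply: cvgD; rewrite -[X in _ --> X](mulr0 (0:R)); under eq_fun do rewrite expr2; exact: cvgM.
have sq0 (w : R -> R) : (forall t, w t ^+ 2 <= N t) ->
    w t @[t --> +oo] --> (0 : R).
  move=> wN; apply/cvgrPdist_le => /= eps eps0.
  move/cvgrPdist_le : N0 => /(_ (eps ^+ 2)); rewrite exprn_gt0// => /(_ isT).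
  apply: filterS => t; rewrite !sub0r !normrN => Nt.
  have ew : `|w t| ^+ 2 <= eps ^+ 2 -> `|w t| <= eps.
    by rewrite ler_pXn2r// nnegrE ltW.
  apply: ew; rewrite real_normK ?num_real//.
  by rewrite (le_trans (wN t))// (le_trans (ler_norm _)).
by split; apply: sq0 => t; rewrite ?lerDl ?lerDr sqr_ge0.
Qed.

(** * Decay of the solutions of a Hurwitz system *)

(** Differentiability is asked for t > 0 only: a trajectory given by an integral
    equation on [0, +oo[ has no more than a one-sided derivative at 0. *)
Definition lti_solution (R : realType) n (M : 'M[R]_n) (z : R -> 'cV[R]_n) :=
  (forall i, {within `[0, +oo[, continuous (fun t => z t i 0)}) /\
  (forall (t : R) i, 0 < t ->
     is_derive t (1 : R) (fun s => z s i 0) ((M *m z t) i 0)).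

Lemma is_derive_lin (R : realType) n (c : 'rV[R]_n) (z dz : R -> 'cV[R]_n) (t : R) :
  (forall i, is_derive t (1 : R) (fun s => z s i 0) (dz t i 0)) ->
  is_derive t (1 : R) (fun s => (c *m z s) 0 0) ((c *m dz t) 0 0).
Proof.
move=> zD; have -> : (fun s => (c *m z s) 0 0) =
    \sum_(i < n) (fun s => c 0 i * z s i 0).
  by apply/funext => s; rewrite mxE fct_sumE.
by rewrite mxE; apply: is_derive_sum.
Qed.

Section HurwitzDecay.
Variables (R : realType) (n : nat) (M : 'M[R]_n.+1).
Local Notation Mc := (map_mx (real_complex R) M).

Lemma Re_mulmx_real m p q (c : 'M[R[i]]_(m, p)) (N : 'M[R]_(p, q)) :
  map_mx (@complex.Re R) (c *m map_mx (real_complex R) N) =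
  map_mx (@complex.Re R) c *m N.
Proof.
apply/matrixP => i j; rewrite !mxE raddf_sum; apply: eq_bigr => k _.
by rewrite !mxE; case: (c i k) => a b /=; rewrite mulr0 subr0.
Qed.

Lemma Im_mulmx_real m p q (c : 'M[R[i]]_(m, p)) (N : 'M[R]_(p, q)) :
  map_mx (@complex.Im R) (c *m map_mx (real_complex R) N) =
  map_mx (@complex.Im R) c *m N.
Proof.
apply/matrixP => i j; rewrite !mxE raddf_sum; apply: eq_bigr => k _.
by rewrite !mxE; case: (c i k) => a b /=; rewrite mulr0 add0r.
Qed.

(** Induction on the factors: with c' = c (M - mu), the function y = c z solves
    y' = mu y + c' z, where c' z tends to 0 since the remaining factors annihilate
    c'. Complex functions are given by their real and imaginary parts. *)
Lemma hurwitz_annihilated_decay (z : R -> 'cV[R]_n.+1) (s : seq R[i])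
    (c : 'rV[R[i]]_n.+1) :
  lti_solution M z -> all (fun mu => complex.Re mu < 0) s ->
  c *m horner_mx Mc (\prod_(mu <- s) ('X - mu%:P)) = 0 ->
  (map_mx (@complex.Re R) c *m z t) 0 0 @[t --> +oo] --> (0 : R) /\
  (map_mx (@complex.Im R) c *m z t) 0 0 @[t --> +oo] --> (0 : R).
Proof.
move=> [zC zD]; elim: s c => [|mu s IHs] c /=.
  rewrite big_nil rmorph1 mulmx1 => _ ->.
  have E (f : {additive R[i] -> R}) : (map_mx f (0 : 'rV[R[i]]_n.+1) *m z t) 0 0
      @[t --> +oo] --> (0 : R).
    rewrite (_ : (fun _ => _) = cst 0); first exact: cvg_cst.
    by apply/funext => t; rewrite raddf0 mul0mx mxE.
  by split; exact: E.
move=> /andP[mu_lt0 s_lt0].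
rewrite big_cons rmorphM mulmxA rmorphB/= horner_mx_X horner_mx_C => /(IHs _ s_lt0).
set c' := c *m _ => -[Rec' Imc'].
have cM : c *m Mc = mu *: c + c'.
  by rewrite /c' mulmxBr mul_mx_scalar addrC subrK.
have D (f : 'rV[R]_n.+1) (t : R) : 0 < t ->
    is_derive t (1 : R) (fun s => (f *m z s) 0 0) ((f *m M *m z t) 0 0).
  move=> t0; rewrite -mulmxA.
  apply: (@is_derive_lin R n.+1 f z (fun t => M *m z t)) => i; exact: zD.
apply: (@forced_decay R (complex.Re mu) (complex.Im mu)
  (fun t => (map_mx (@complex.Re R) c *m z t) 0 0)
  (fun t => (map_mx (@complex.Im R) c *m z t) 0 0)
  (fun t => (map_mx (@complex.Re R) c' *m z t) 0 0)
  (fun t => (map_mx (@complex.Im R) c' *m z t) 0 0) mu_lt0 _ _ Rec' Imc').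
- move=> t t0; have := D (map_mx (@complex.Re R) c) t t0.
  rewrite -Re_mulmx_real cM.
  have -> : map_mx (@complex.Re R) (mu *: c + c') =
      complex.Re mu *: map_mx (@complex.Re R) c
      - complex.Im mu *: map_mx (@complex.Im R) c + map_mx (@complex.Re R) c'.
    apply/matrixP => i j; rewrite !mxE raddfD/=; congr (_ + _).
    by case: (mu) => p q; case: (c i j).
  by rewrite mulmxDl mulmxBl -!scalemxAl !mxE.
- move=> t t0; have := D (map_mx (@complex.Im R) c) t t0.
  rewrite -Im_mulmx_real cM.
  have -> : map_mx (@complex.Im R) (mu *: c + c') =
      complex.Im mu *: map_mx (@complex.Re R) c
      + complex.Re mu *: map_mx (@complex.Im R) c + map_mx (@complex.Im R) c'.
    apply/matrixP => i j; rewrite !mxE raddfD/=; congr (_ + _).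
    by case: (mu) => p q; case: (c i j) => x y /=; rewrite addrC.
  by rewrite mulmxDl mulmxDl -!scalemxAl !mxE.
Qed.

Lemma char_poly_split (K : 'M[R[i]]_n.+1) :
  exists s : seq R[i], horner_mx K (\prod_(mu <- s) ('X - mu%:P)) = 0 /\
    forall mu, mu \in s -> eigenvalue K mu.
Proof.
have [s sE] := closed_field_poly_normal (char_poly K).
have mon : lead_coef (char_poly K) = 1 by apply/monicP; exact: char_poly_monic.
rewrite mon scale1r in sE; exists s; rewrite -sE; split.
  exact: Cayley_Hamilton.
by move=> mu ms; rewrite eigenvalue_root_char sE root_prod_XsubC.
Qed.

(** By the Cayley-Hamilton theorem every row vector is annihilated by the product
    of the M - mu over the eigenvalues mu, so every coordinate decays. *)
Lemma hurwitz_decay_pos (z : R -> 'cV[R]_n.+1) :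
  hurwitz M -> lti_solution M z ->
  forall i, z t i 0 @[t --> +oo] --> (0 : R).
Proof.
move=> Mh zS i; have [s [s0 sE]] := char_poly_split Mc.
have s_lt0 : all (fun mu => complex.Re mu < 0) s.
  by apply/allP => mu /sE /Mh.
have := @hurwitz_annihilated_decay z s (delta_mx 0 i) zS s_lt0.
rewrite s0 mulmx0 => /(_ erefl)[+ _].
have -> : map_mx (@complex.Re R) (delta_mx 0 i) = delta_mx 0 i :> 'rV[R]_n.+1.
  by apply/matrixP => k j; rewrite !mxE; case: (_ && _).
by under eq_fun do rewrite -rowE mxE.
Qed.

End HurwitzDecay.

Lemma hurwitz_decay (R : realType) n (M : 'M[R]_n) (z : R -> 'cV[R]_n) :
  hurwitz M -> lti_solution M z ->
  forall i, z t i 0 @[t --> +oo] --> (0 : R).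
Proof.
case: n M z => [|n] M z Mh zS i; first by case: i.
exact: (@hurwitz_decay_pos R n M z Mh zS i).
Qed.

(** * Quadratic forms along trajectories *)

Section MatrixForms.
Variables (R : realType) (n : nat).
Implicit Types (P : 'M[R]_n) (x y : 'cV[R]_n).

Lemma qformE P x : qform P x = \sum_i x i 0 * (P *m x) i 0.
Proof. by rewrite /qform -mulmxA mxE; apply: eq_bigr => i _; rewrite mxE. Qed.

Lemma qformD P P' x : qform (P + P') x = qform P x + qform P' x.
Proof. by rewrite /qform mulmxDr mulmxDl mxE. Qed.

Lemma qformN P x : qform (- P) x = - qform P x.
Proof. by rewrite /qform mulmxN mulNmx mxE. Qed.

Lemma qform_oppx P x : qform P (- x) = qform P x.
Proof.
have -> : - x = (-1) *: x by rewrite scaleN1r.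
rewrite /qform -scalemxAr linearZ/= -!scalemxAl scalerA.
by rewrite mulrNN mulr1 scale1r.
Qed.

Lemma qform_mulmx m (N : 'M[R]_(n, m)) P (y : 'cV[R]_m) :
  qform P (N *m y) = qform (N^T *m P *m N) y.
Proof. by rewrite /qform trmx_mul !mulmxA. Qed.

Lemma posdef_unitmx P : posdef P -> P \in unitmx.
Proof.
move=> Ppos; rewrite -row_free_unit -kermx_eq0; apply/negPn/negP => kn0.
pose u := nz_row (kermx P).
have u0 : u *m P = 0 by apply/sub_kermxP; exact: nz_row_sub.
have un0 : u^T != 0.
  apply/eqP => /(congr1 trmx); rewrite trmxK trmx0 => /eqP.
  by rewrite nz_row_eq0; exact/negP.
by have := Ppos _ un0; rewrite /qform trmxK u0 mul0mx mxE ltxx.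
Qed.

Lemma sqr_norm_eq0 x : (x^T *m x) 0 0 <= 0 -> x = 0.
Proof.
rewrite mxE => s0; have s1 : \sum_j x j 0 ^+ 2 = 0.
  apply/eqP; rewrite eq_le; apply/andP; split; last first.
    by apply: sumr_ge0 => j _; exact: sqr_ge0.
  by apply: le_trans s0; apply: ler_sum => j _; rewrite mxE.
apply/matrixP => i j; rewrite ord1 mxE; apply/eqP; rewrite -sqrf_eq0.
have := psumr_eq0P (fun j _ => sqr_ge0 (x j 0)) s1; by move=> /(_ i isT) ->.
Qed.

(** If w = P x were nonzero, the form would be negative at x - s w for small s > 0. *)
Lemma psd_qform_eq0 P x : symmetric_mx P -> psd P -> qform P x <= 0 -> P *m x = 0.
Proof.
move=> Psym Ppsd qx; pose w := P *m x; apply: sqr_norm_eq0; rewrite -/w.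
set W := (w^T *m w) 0 0; pose c := qform P w.
have c0 : 0 <= c by exact: Ppsd.
have H s : qform P (x - s *: w) = qform P x - s * W *+ 2 + s ^+ 2 * c.
  rewrite /W /c /qform.
  have -> : (x - s *: w)^T = x^T - s *: w^T by rewrite linearB/= linearZ.
  have -> : (x^T - s *: w^T) *m P *m (x - s *: w) =
     x^T *m P *m x - s *: (w^T *m P *m x + x^T *m P *m w)
     + (s ^+ 2) *: (w^T *m P *m w).
    rewrite !(mulmxBl, mulmxBr) -!scalemxAl -!scalemxAr.
    move: (x^T *m P *m x) (x^T *m P *m w) (w^T *m P *m x) (w^T *m P *m w).
    by move=> p1 p2 p3 p4; apply/matrixP => i j; rewrite !mxE; ring.
  have -> : x^T *m P *m w = w^T *m w.
    by rewrite {2}/w trmx_mul Psym.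
  have -> : w^T *m P *m x = w^T *m w by rewrite -mulmxA.
  by rewrite !mxE; ring.
have c1 : 0 < c + 1 by rewrite ltr_wpDl.
have := Ppsd (x - (W / (c + 1)) *: w); rewrite H.
set s := W / (c + 1); have sE : s * (c + 1) = W by rewrite /s divfK ?gt_eqF.
have s2 : 0 <= s ^+ 2 by exact: sqr_ge0.
move=> H1; rewrite leNgt; apply/negP => W0.
have s0 : 0 < s by rewrite divr_gt0.
have : 0 <= - s * W *+ 2 + s ^+ 2 * c by lra.
have -> : - s * W *+ 2 + s ^+ 2 * c = - s ^+ 2 * (c + 2) by rewrite -sE; ring.
by rewrite leNgt mulNr oppr_lt0 mulr_gt0// ?exprn_gt0// ltr_wpDl.
Qed.

End MatrixForms.

Lemma is_derive_qform (R : realType) n (P : 'M[R]_n) (z dz : R -> 'cV[R]_n) (t : R) :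
  (forall i, is_derive t (1 : R) (fun s => z s i 0) (dz t i 0)) ->
  is_derive t (1 : R) (fun s => qform P (z s))
    (((dz t)^T *m P *m z t) 0 0 + ((z t)^T *m P *m dz t) 0 0).
Proof.
move=> zD; have rE i (y : 'cV[R]_n) : (row i P *m y) 0 0 = (P *m y) i 0.
  by rewrite -row_mul [LHS]mxE.
have -> : (fun s => qform P (z s)) =
    \sum_(i < n) (fun s => z s i 0 * (row i P *m z s) 0 0).
  apply/funext => s; rewrite qformE fct_sumE; apply: eq_bigr => i _.
  by rewrite rE.
have -> : ((dz t)^T *m P *m z t) 0 0 + ((z t)^T *m P *m dz t) 0 0 =
   \sum_(i < n) (z t i 0 *: (row i P *m dz t) 0 0 + (row i P *m z t) 0 0 *: dz t i 0).
  rewrite big_split/= addrC; congr (_ + _); rewrite -mulmxA mxE;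
    by apply: eq_bigr => i _; rewrite rE [X in X * _]mxE// mulrC.
apply: is_derive_sum => i.
exact: (is_deriveM (zD i) (is_derive_lin _ zD)).
Qed.

Lemma cvg_sumr (R : realType) (I : finType) (T : Type) (F : set_system T)
    (f : I -> T -> R) (l : I -> R) : Filter F ->
  (forall i, f i x @[x --> F] --> l i) ->
  \sum_i f i x @[x --> F] --> \sum_i l i.
Proof.
move=> FF fl; elim: (index_enum I) => [|i r IHr].
  by rewrite big_nil; under eq_fun do rewrite big_nil; exact: cvg_cst.
by rewrite big_cons; under eq_fun do rewrite big_cons; exact: cvgD.
Qed.

Lemma cvg_mulmx (R : realType) m n (P : 'M[R]_(m, n)) (z : R -> 'cV[R]_n)
    (l : 'cV[R]_n) : (forall j, z t j 0 @[t --> +oo] --> l j 0) ->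
  forall i, (P *m z t) i 0 @[t --> +oo] --> (P *m l) i 0.
Proof.
move=> zl i; under eq_fun do rewrite mxE; rewrite mxE.
by apply: cvg_sumr => j; exact: cvgMl_tmp.
Qed.

Section WithinContinuity.
Variables (R : realType) (n : nat) (D : set R).

Lemma within_sum (I : finType) (f : I -> R -> R) :
  (forall i, {within D, continuous (f i)}) ->
  {within D, continuous (fun t => \sum_i f i t)}.
Proof.
by move=> fC t; apply: cvg_sumr => i; exact: fC.
Qed.

Lemma within_mul (f g : R -> R) :
  {within D, continuous f} -> {within D, continuous g} ->
  {within D, continuous (fun t => f t * g t)}.
Proof. by move=> fC gC t; apply: continuousM; [exact: fC|exact: gC]. Qed.

Lemma within_mulmx m p (P : 'M[R]_(m, p)) (z : R -> 'cV[R]_p) i :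
  (forall i, {within D, continuous (fun t => z t i 0)}) ->
  {within D, continuous (fun t => (P *m z t) i 0)}.
Proof.
move=> zC; under eq_fun do rewrite mxE.
apply: within_sum => j; apply: within_mul => //.
by move=> t; exact: cvg_cst.
Qed.

Lemma within_qform (P : 'M[R]_n) (z : R -> 'cV[R]_n) :
  (forall i, {within D, continuous (fun t => z t i 0)}) ->
  {within D, continuous (fun t => qform P (z t))}.
Proof.
move=> zC; under eq_fun do rewrite qformE.
by apply: within_sum => i; apply: within_mul => //; exact: within_mulmx.
Qed.

Lemma within_coord (x : R -> 'cV[R]_n) i :
  {within D, continuous x} -> {within D, continuous (fun t => x t i 0)}.
Proof.
move=> xC t.
exact: (cvg_comp _ _ (xC t) (@coord_continuous R n 1 i 0 (x t))).
Qed.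

End WithinContinuity.

Lemma lti_is_derive_qform (R : realType) n (M P : 'M[R]_n) (z : R -> 'cV[R]_n)
    (t : R) :
  lti_solution M z -> 0 < t ->
  is_derive t (1 : R) (fun s => qform P (z s)) (qform (M^T *m P + P *m M) (z t)).
Proof.
move=> [_ zD] t0.
have -> : qform (M^T *m P + P *m M) (z t) =
    ((M *m z t)^T *m P *m z t) 0 0 + ((z t)^T *m P *m (M *m z t)) 0 0.
  by rewrite qformD /qform trmx_mul !mulmxA.
exact: (@is_derive_qform R n P z (fun t => M *m z t) t (fun i => zD t i t0)).
Qed.

(** * The cost of the linear-quadratic regulator *)

Section LinearQuadratic.
Variable R : realType.
Local Notation mu := (@lebesgue_measure R).

Lemma is_derive_primitive (y h : R -> R) (c : R) :
  {within `[0, +oo[, continuous h} ->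
  (forall t, 0 <= t -> y t = c + \int[mu]_(s in `[0, t]) h s) ->
  forall t : R, 0 < t -> is_derive t (1 : R) y (h t).
Proof.
move=> hC yE t t0.
have ht : {for t, continuous h}.
  by move/continuous_within_itvcyP : hC => [+ _]; apply; rewrite in_itv/= t0.
have tt1 : t < t + 1 by rewrite ltrDl.
have hint : mu.-integrable `[0, t + 1] (EFin \o h).
  apply: continuous_compact_integrable; first exact: segment_compact.
  apply: continuous_subspaceW hC; apply: subset_itvl; by rewrite bnd_simp.
have [ID IE] := continuous_FTC1_closed tt1 hint t0 ht.
apply: (near_eq_is_derive (f := fun x : R => c + \int[mu]_(s in `[0, x]) h s)
  (g := y) (a := t) (v := (1 : R))).
  near=> s; rewrite yE//; apply/ltW; near: s; exact: lt_nbhsr.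
rewrite -IE derive1E.
have := is_deriveD (is_derive_cst c t (1 : R)) (derivableP ID).
by rewrite add0r.
Unshelve. all: end_near. Qed.

(** Under a linear feedback the integrand is continuous, so a trajectory in the
    sense of Caratheodory is differentiable. *)
Lemma admissible_feedback n m (A : 'M[R]_n) (B : 'M[R]_(n, m)) (K : 'M[R]_(m, n))
    (x0 : 'cV[R]_n) (x : R -> 'cV[R]_n) :
  admissible (fun x => A *m x) (fun=> B) x0 x (fun t => - (K *m x t)) ->
  lti_solution (A - B *m K) x /\ x 0 = x0.
Proof.
move=> [xC _ xE].
have xiC i : {within `[0, +oo[, continuous (fun t => x t i 0)}.
  exact: within_coord.
have fE t : A *m x t + B *m - (K *m x t) = (A - B *m K) *m x t.
  by rewrite mulmxBl mulmxN mulmxA.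
split; first split => // t i t0.
  apply: (@is_derive_primitive (fun s => x s i 0)
    (fun s => ((A - B *m K) *m x s) i 0) (x0 i 0)) => //.
    exact: within_mulmx.
  by move=> s s0; rewrite xE//; under eq_Rintegral do rewrite fE.
apply/matrixP => i j; rewrite ord1 xE//.
by rewrite set_itv1 Rintegral_set1 addr0.
Qed.

Section Cost.
Variables (n m : nat) (A : 'M[R]_n) (B : 'M[R]_(n, m)) (Q : 'M[R]_n) (Rw : 'M[R]_m).
Hypotheses (Q_psd : psd Q) (Rw_sym : symmetric_mx Rw) (Rw_pos : posdef Rw).
Local Notation S := (B *m invmx Rw *m B^T).

Let Rw_unit : Rw \in unitmx := posdef_unitmx Rw_pos.

Lemma posdef_psd : psd Rw.
Proof.
move=> x; have [->|x0] := eqVneq x 0; last exact/ltW/Rw_pos.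
by rewrite /qform mulmx0 mxE.
Qed.

Lemma gain_sym : S^T = S.
Proof. by rewrite !trmx_mul trmxK trmx_inv Rw_sym mulmxA. Qed.

Lemma gain_psd : psd S.
Proof.
move=> x; pose y := invmx Rw *m B^T *m x.
suff -> : qform S x = qform Rw y by exact: posdef_psd.
rewrite /qform /y !trmx_mul trmxK trmx_inv Rw_sym !mulmxA.
by rewrite -[_ *m invmx Rw *m Rw]mulmxA mulVmx// mulmx1.
Qed.

(** Makes - x^T P x / 2 a primitive of the running cost along the closed loop. *)
Lemma riccati_lyapunov (P : 'M[R]_n) : riccati_psd A B Q Rw P ->
  (closed_loop A B Rw P)^T *m P + P *m closed_loop A B Rw P =
  - (Q + P *m S *m P).
Proof.
move=> [Psym _ Pric]; rewrite /closed_loop.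
have -> : (A - S *m P)^T = A^T - P *m S.
  by rewrite linearB/= trmx_mul gain_sym Psym.
have -> : Q = - (A^T *m P + P *m A - P *m S *m P).
  apply/eqP; rewrite -addr_eq0 addrC Pric !mulmxA; exact: eqxx.
rewrite mulmxBl mulmxBr !mulmxA.
move: (A^T *m P) (P *m A) (_ *m P) => p1 p2 p3.
by apply/matrixP => i j; rewrite !mxE; ring.
Qed.

(** The primitive - x^T V2 x / 2 of the running cost tends to 0, because the
    trajectory decays. *)
Lemma lqr_cost (V2 : 'M[R]_n) (x0 : 'cV[R]_n) (x : R -> 'cV[R]_n) :
  riccati_psd A B Q Rw V2 -> hurwitz (closed_loop A B Rw V2) ->
  lti_solution (closed_loop A B Rw V2) x -> x 0 = x0 ->
  cost (fun x u => qform Q x + qform Rw u) x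
    (fun t => - (invmx Rw *m B^T *m V2 *m x t)) = (2^-1 * qform V2 x0)%:E.
Proof.
move=> Vric Vh xS x_0; have [xC xD] := xS; have [Vsym Vpsd _] := Vric.
have uE t : qform Rw (- (invmx Rw *m B^T *m V2 *m x t)) = qform (V2 *m S *m V2) (x t).
  rewrite qform_oppx qform_mulmx !trmx_mul trmxK Vsym trmx_inv Rw_sym !mulmxA.
  by rewrite -[_ *m invmx Rw *m Rw]mulmxA mulVmx// mulmx1.
rewrite /cost; under eq_integral do rewrite uE -qformD.
pose F t := - 2^-1 * qform V2 (x t).
have FD (t : R) : 0 < t -> is_derive t (1 : R) F (2^-1 * qform (Q + V2 *m S *m V2) (x t)).
  move=> t0; have := lti_is_derive_qform V2 xS t0.
  rewrite (riccati_lyapunov Vric) qformN => /(is_deriveZ (- 2^-1)).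
  by rewrite /GRing.scale/= mulrN mulNr opprK.
have FC : {within `[0, +oo[, continuous F}.
  by apply: within_mul; [move=> t; exact: cvg_cst|exact: within_qform].
have -> : (2^-1 * qform V2 x0)%:E = (0%:E - (F 0)%:E)%E.
  by rewrite /F x_0 -EFinB mulNr opprK add0r.
apply: (@ge0_continuous_FTC2y R _ F 0 0).
- move=> t _; rewrite mulr_ge0 ?invr_ge0// qformD addr_ge0//.
  have -> : qform (V2 *m S *m V2) (x t) = qform S (V2 *m x t).
    by rewrite qform_mulmx Vsym.
  exact: gain_psd.
- by apply: within_mul; [move=> t; exact: cvg_cst|exact: within_qform].
- have zl j : x t j 0 @[t --> +oo] --> (0 : 'cV[R]_n) j 0.
    by rewrite mxE; exact: (hurwitz_decay Vh xS).
  have E0 : \sum_(i < n) (0 : 'cV[R]_n) i 0 * (V2 *m (0 : 'cV[R]_n)) i 0 = 0.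
    by rewrite big1// => i _; rewrite mxE mul0r.
  suff qc : qform V2 (x t) @[t --> +oo] --> (0 : R).
    by rewrite /F -[X in _ --> X](mulr0 (- 2^-1)); apply: cvgMl_tmp.
  rewrite -[X in _ --> X]E0; under eq_fun do rewrite qformE.
  apply: (@cvg_sumr R 'I_n R (pinfty_nbhs R)
    (fun i t => x t i 0 * (V2 *m x t) i 0)) => i.
  by apply: cvgM; [exact: zl|exact: (@cvg_mulmx R n n V2 x 0 zl i)].
- by move=> t t0; have := FD t t0.
- by move/continuous_within_itvcyP : FC => [].
- move=> t; rewrite in_itv/= andbT => t0; have Ft := FD t t0.
  by rewrite derive1E derive_val.
Qed.

End Cost.
End LinearQuadratic.

(** * Uniqueness of the positive semidefinite Riccati solution *)

Section RiccatiUniqueness.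
Variable R : realType.
Local Notation mu := (@lebesgue_measure R).

Section Mode.
Variables (n m : nat) (A : 'M[R]_n) (B : 'M[R]_(n, m)) (Q : 'M[R]_n) (Rw : 'M[R]_m).
Variables (al be : R) (a b : 'cV[R]_n).
Hypotheses (Aa : A *m a = al *: a - be *: b) (Ab : A *m b = be *: a + al *: b).
Hypotheses (Qa : Q *m a = 0) (Qb : Q *m b = 0).

Let ec (t : R) := expR (al * t) * cos (be * t).
Let es (t : R) := expR (al * t) * sin (be * t).
(** The real part of exp((al + i be) t) (a + i b). *)
Let x (t : R) : 'cV[R]_n := ec t *: a - es t *: b.

(* used through instance resolution by the two chain rules below *)
Let is_derive_scaled (k t : R) : is_derive t (1 : R) (fun t => k * t) k.
Proof.
have := @is_deriveZ _ _ _ id k t (1 : R) 1 (is_derive_id _ _).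
by rewrite /GRing.scale/= mulr1.
Qed.

Let ecD (t : R) : is_derive t (1 : R) ec (al * ec t - be * es t).
Proof.
have E : is_derive t (1 : R) (fun t => expR (al * t)) (expR (al * t) * al).
  exact: (@is_derive1_comp _ expR (fun t => al * t)).
have C : is_derive t (1 : R) (fun t => cos (be * t)) (- sin (be * t) * be).
  exact: (@is_derive1_comp _ cos (fun t => be * t)).
apply: (is_derive_eq (is_deriveM E C)).
by rewrite /ec /es /GRing.scale/=; ring.
Qed.

Let esD (t : R) : is_derive t (1 : R) es (be * ec t + al * es t).
Proof.
have E : is_derive t (1 : R) (fun t => expR (al * t)) (expR (al * t) * al).
  exact: (@is_derive1_comp _ expR (fun t => al * t)).
have C : is_derive t (1 : R) (fun t => sin (be * t)) (cos (be * t) * be).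
  exact: (@is_derive1_comp _ sin (fun t => be * t)).
apply: (is_derive_eq (is_deriveM E C)).
by rewrite /ec /es /GRing.scale/=; ring.
Qed.

Let xD i (t : R) : is_derive t (1 : R) (fun t => x t i 0) ((A *m x t) i 0).
Proof.
have -> : (fun t => x t i 0) = (fun t => a i 0 * ec t - b i 0 * es t).
  by apply/funext => s; rewrite !mxE mulrC [es s * _]mulrC.
apply: (is_derive_eq
  (is_deriveB (is_deriveZ (a i 0) (ecD t)) (is_deriveZ (b i 0) (esD t)))).
rewrite /x mulmxBr -!scalemxAr Aa Ab.
by rewrite !mxE /GRing.scale/=; ring.
Qed.

Let continuous_of_derive (f df : R -> R) :
  (forall t : R, is_derive t (1 : R) f (df t)) -> continuous f.
Proof.
by move=> fD t; have ft := fD t; exact/differentiable_continuous/derivable1_diffP.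
Qed.

Lemma unobservable_mode_admissible :
  admissible (fun x => A *m x) (fun=> B) a x (fun=> 0).
Proof.
split.
- apply: continuous_subspaceT => t; rewrite /x.
  apply: cvgB; apply: cvgZr_tmp.
    exact: (continuous_of_derive ecD).
  exact: (continuous_of_derive esD).
- move=> T i _ /=.
  have -> : (fun=> ((0 : 'cV[R]_m) i 0)%:E) = (cst 0%E : R -> \bar R).
    by apply/funext => t; rewrite mxE.
  exact: integrable0.
move=> t i; rewrite le_eqVlt => /predU1P[<-|t0].
  rewrite set_itv1 Rintegral_set1 addr0 /x /ec /es !mulr0 expR0 cos0 sin0.
  by rewrite mulr1 mulr0 scale1r scale0r subr0.
have AxC : continuous (fun t => (A *m x t) i 0).
  have -> : (fun t => (A *m x t) i 0) = (fun t => (row i A *m x t) 0 0).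
    by apply/funext => s; rewrite -row_mul [RHS]mxE.
  apply: continuous_of_derive => s.
  exact: (@is_derive_lin R n (row i A) x (fun s => A *m x s) s (xD^~ s)).
have xiC : continuous (fun t => x t i 0) by exact: continuous_of_derive (xD i).
under eq_Rintegral do rewrite mulmx0 addr0.
rewrite /Rintegral (@continuous_FTC2 R _ (fun t => x t i 0) 0 t)//.
- have -> : x 0 = a.
    rewrite /x /ec /es !mulr0 expR0 cos0 sin0.
    by rewrite mulr1 mulr0 scale1r scale0r subr0.
  by rewrite -EFinB/= addrC subrK.
- exact: continuous_subspaceT.
- split.
  + by move=> s _; have := xD i s.
  + exact/cvg_at_right_filter/xiC.
  + exact/cvg_at_left_filter/xiC.
- by move=> s _; have xs := xD i s; rewrite derive1E derive_val.
Qed.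

Lemma unobservable_mode_cost :
  cost (fun x u => qform Q x + qform Rw u) x (fun=> 0) = 0%E.
Proof.
rewrite /cost; apply: integral0_eq => t _.
have -> : qform Rw 0 = 0 by rewrite /qform mulmx0 mxE.
rewrite /qform /x -mulmxA mulmxBr -!scalemxAr Qa Qb.
by rewrite !scaler0 subr0 mulmx0 mxE addr0 mulr0.
Qed.

End Mode.


Lemma eigenvalue_trmx (F : fieldType) n (M : 'M[F]_n) : eigenvalue M^T =1 eigenvalue M.
Proof.
move=> mu; rewrite !eigenvalue_root_char /char_poly -det_tr.
congr (root (\det _) mu).
by rewrite /char_poly_mx linearB/= tr_scalar_mx map_trmx trmxK.
Qed.

(** From M D = D K follows p(M) D = D p(K) for every polynomial p. For p the
    characteristic polynomial of M, a nonzero row of D is annihilated by the product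
    of the K - mu over the eigenvalues mu of M, so one of these mu is an eigenvalue
    of K. The vector a + i b is an eigenvector for mu = al + i be. *)
Lemma unstable_mode_of_intertwining n (K M D : 'M[R]_n.+1) :
  D != 0 -> M *m D = D *m K -> (forall mu, eigenvalue (map_mx (real_complex R) M) mu ->
    0 < complex.Re mu) ->
  exists (al be : R) (a b : 'cV[R]_n.+1),
    [/\ 0 < al, (a != 0) || (b != 0), K *m a = al *: a - be *: b &
        K *m b = be *: a + al *: b].
Proof.
move=> D0 MD Mpos; pose cx := map_mx (real_complex R).
have [s [s0 sE]] := char_poly_split (cx _ _ M).
have MDc : cx _ _ M *m cx _ _ D = cx _ _ D *m cx _ _ K.
  by rewrite /cx -!map_mxM MD.
have HD p : horner_mx (cx _ _ M) p *m cx _ _ D = cx _ _ D *m horner_mx (cx _ _ K) p.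
  elim/poly_ind: p => [|p c IHp]; first by rewrite !rmorph0 mul0mx mulmx0.
  rewrite !rmorphD/= !rmorphM/= !horner_mx_X !horner_mx_C mulmxDl mulmxDr.
  rewrite scalar_mxC; congr (_ + _).
  by rewrite -[LHS]mulmxA MDc mulmxA IHp -mulmxA.
have /matrix0Pn[i [j Dij]] : cx _ _ D != 0 by rewrite map_mx_eq0.
have : row i (cx _ _ D) != 0.
  apply/eqP => /matrixP/(_ 0 j); rewrite !mxE => /eqP.
  by rewrite mxE in Dij; apply/negP.
have : row i (cx _ _ D) *m horner_mx (cx _ _ K) (\prod_(mu <- s) ('X - mu%:P)) = 0.
  by rewrite -row_mul -HD s0 mul0mx row0.
move: (row i _) => c {s0 HD MDc Dij}.
have : all (fun mu => 0 < complex.Re mu) s by apply/allP => mu /sE/Mpos.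
elim: s c {sE} => [|mu s IHs] c /=.
  by rewrite big_nil rmorph1 mulmx1 => _ ->; rewrite eqxx.
rewrite big_cons rmorphM mulmxA rmorphB/= horner_mx_X horner_mx_C.
move=> /andP[mu0 s0] cs c0.
have [cmu|] := eqVneq (c *m (cx _ _ K - mu%:M)) 0; last exact: IHs cs.
have : eigenvalue (cx _ _ K)^T mu.
  rewrite eigenvalue_trmx.
  apply/eigenvalueP; exists c => //; apply/eqP; rewrite -subr_eq0.
  by rewrite -mul_mx_scalar -mulmxBr cmu.
move=> /eigenvalueP[v vK v0].
pose a := (map_mx (@complex.Re R) v)^T; pose b := (map_mx (@complex.Im R) v)^T.
have KT : (cx _ _ K)^T = cx _ _ K^T by rewrite /cx map_trmx.
rewrite KT in vK.
exists (complex.Re mu), (complex.Im mu), a, b; split => //.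
- rewrite -negb_and; apply: contra v0 => /andP[/eqP a0 /eqP b0].
  apply/eqP/matrixP => i' j'; rewrite mxE.
  have /matrixP/(_ j' i') := a0; have /matrixP/(_ j' i') := b0; rewrite !mxE.
  by case: (v i' j') => p q /= -> ->.
- apply: trmx_inj; rewrite trmx_mul /a trmxK -Re_mulmx_real vK.
  apply/matrixP => i' j'; rewrite !mxE /=.
  by case: (mu) => p q; case: (v i' j').
- apply: trmx_inj; rewrite trmx_mul /b trmxK -Im_mulmx_real vK.
  apply/matrixP => i' j'; rewrite !mxE /=.
  by case: (mu) => p q; case: (v i' j') => ? ? /=; rewrite addrC.
Qed.

(** Let S = B Rw^-1 B^T, D = V2 - P and K = A - S P. Subtracting the two Riccati
    equations gives - (A - S V2)^T D = D K. If D is nonzero, then K has an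
    eigenvector z whose eigenvalue mu has a positive real part. The Lyapunov identity
    for P forces P z = 0 and Q z = 0, hence A z = mu z. The zero control follows this
    mode at no cost, so that optimality of the feedback of V2 gives V2 z = 0. Then mu
    is an eigenvalue of the Hurwitz matrix A - S V2, which is absurd.
    Optimality is essential: for A = B = Rw = 1 and Q = 0 both 0 and 2 are positive
    semidefinite solutions, and 2 is stabilizing. *)
Lemma riccati_psd_unique_pos n m (A : 'M[R]_n.+1) (B : 'M[R]_(n.+1, m))
    (Q : 'M[R]_n.+1) (Rw : 'M[R]_m) (V2 P : 'M[R]_n.+1) :
  symmetric_mx Q -> psd Q -> symmetric_mx Rw -> posdef Rw ->
  lqr_stabilizing A B Q Rw V2 -> riccati_psd A B Q Rw P -> P = V2.
Proof.
move=> Qsym Qpsd Rsym Rpos [Vric Vh Vopt] Pric.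
have [Vsym Vpsd VE] := Vric; have [Psym Ppsd PE] := Pric.
apply/esym/eqP; rewrite -subr_eq0; apply: contraT => D0.
pose S := B *m invmx Rw *m B^T; pose K := closed_loop A B Rw P.
pose M := - (closed_loop A B Rw V2)^T.
have ST : S^T = S by exact: gain_sym.
have MDK : M *m (V2 - P) = (V2 - P) *m K.
  have MT : (closed_loop A B Rw V2)^T = A^T - V2 *m S.
    by rewrite /closed_loop linearB/= trmx_mul -/S ST Vsym.
  rewrite /M MT /K /closed_loop -/S.
  have E : A^T *m V2 + V2 *m A - V2 *m S *m V2 = A^T *m P + P *m A - P *m S *m P.
    have := PE; rewrite VE /S !mulmxA => /addIr; exact.
  rewrite mulmxBl !mulNmx.
  have -> : (A^T - V2 *m S) *m (V2 - P) =
      A^T *m V2 - A^T *m P - V2 *m S *m V2 + V2 *m S *m P.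
    by rewrite mulmxBl !mulmxBr opprB addrA addrAC.
  have -> : P *m (A - S *m P) = P *m A - P *m S *m P.
    by rewrite mulmxBr mulmxA.
  have -> : V2 *m (A - S *m P) = V2 *m A - V2 *m S *m P.
    by rewrite mulmxBr mulmxA.
  move: E; move: (A^T *m V2) (V2 *m A) (V2 *m S *m V2) (A^T *m P) (P *m A)
    (P *m S *m P) (V2 *m S *m P) => p1 p2 p3 p4 p5 p6 p7 E.
  apply/matrixP => i j; move/matrixP/(_ i j) : E; rewrite !mxE => E.
  lra.
have Mpos mu : eigenvalue (map_mx (real_complex R) M) mu -> 0 < complex.Re mu.
  move=> /eigenvalueP[v vM v0]; rewrite -oppr_lt0.
  have -> : - complex.Re mu = complex.Re (- mu) by case: (mu).
  apply: Vh; rewrite -eigenvalue_trmx.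
  apply/eigenvalueP; exists v => //; rewrite scaleNr -vM /M map_mxN mulmxN opprK.
  by rewrite map_trmx.
have [al [be [a [b [al0 ab0 Ka Kb]]]]] := unstable_mode_of_intertwining D0 MDK Mpos.
have Kric := riccati_lyapunov Rsym Pric; rewrite -/K -/S in Kric.
have PSPpsd : psd (P *m S *m P).
  move=> y; have := gain_psd B Rsym Rpos (P *m y).
  by rewrite qform_mulmx Psym.
have key : al * (qform P a + qform P b) *+ 2 =
    - (qform (Q + P *m S *m P) a + qform (Q + P *m S *m P) b).
  rewrite opprD -!qformN -Kric.
  have E y : qform (K^T *m P + P *m K) y = ((K *m y)^T *m P *m y) 0 0
      + (y^T *m P *m (K *m y)) 0 0.
    by rewrite qformD /qform trmx_mul !mulmxA.
  rewrite !E Ka Kb.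
  have T1 (c d : R) (y z : 'cV[R]_n.+1) : (c *: y + d *: z)^T = c *: y^T + d *: z^T.
    by rewrite linearD/= !linearZ.
  rewrite -scaleNr !T1 !mulmxDl !mulmxDr -!scalemxAl -!scalemxAr /qform.
  have -> : b^T *m P *m a = (a^T *m P *m b)^T.
    by rewrite !trmx_mul trmxK Psym mulmxA.
  move: (a^T *m P *m a) (a^T *m P *m b) (b^T *m P *m b) => p1 p2 p3.
  by rewrite !mxE; ring.
have Qa0 := Qpsd a; have Qb0 := Qpsd b; have Pa0 := Ppsd a; have Pb0 := Ppsd b.
have Sa0 := PSPpsd a; have Sb0 := PSPpsd b.
rewrite !qformD in key.
have P0 : qform P a + qform P b <= 0.
  rewrite leNgt; apply/negP => H; have := mulr_gt0 al0 H; lra.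
have Pa : P *m a = 0 by apply: psd_qform_eq0 => //; lra.
have Pb : P *m b = 0 by apply: psd_qform_eq0 => //; lra.
have P0' : al * (qform P a + qform P b) = 0.
  by rewrite (_ : _ + _ = 0) ?mulr0//; lra.
rewrite P0' in key.
have Qa : Q *m a = 0 by apply: psd_qform_eq0 => //; lra.
have Qb : Q *m b = 0 by apply: psd_qform_eq0 => //; lra.
rewrite /K /closed_loop !mulmxBl -!mulmxA Pa Pb !mulmx0 !subr0 in Ka Kb.
have V0 (c d : 'cV[R]_n.+1) : A *m c = al *: c - be *: d ->
    A *m d = be *: c + al *: d -> Q *m c = 0 -> Q *m d = 0 -> V2 *m c = 0.
  move=> Ac Ad Qc Qd; apply: psd_qform_eq0 => //.
  have [x [xadm xmin]] := Vopt c.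
  have := xmin _ _ (unobservable_mode_admissible B Ac Ad).
  rewrite unobservable_mode_cost//.
  have := xadm; move=> /admissible_feedback[]; rewrite !mulmxA => xS x0.
  rewrite (lqr_cost Qpsd Rsym Rpos Vric Vh xS x0) lee_fin.
  by rewrite pmulr_rle0// invr_gt0.
have Va : V2 *m a = 0 by exact: (V0 a b).
have Vb : V2 *m b = 0.
  apply: (V0 b (- a)) => //.
  - by rewrite Kb scalerN opprK addrC.
  - by rewrite mulmxN Ka opprB scalerN.
  - by rewrite mulmxN Qa oppr0.
pose Acl := closed_loop A B Rw V2.
have Aca : Acl *m a = al *: a - be *: b.
  by rewrite /Acl /closed_loop mulmxBl -!mulmxA Va !mulmx0 subr0.
have Acb : Acl *m b = be *: a + al *: b.
  by rewrite /Acl /closed_loop mulmxBl -!mulmxA Vb !mulmx0 subr0.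
pose v : 'rV[R[i]]_n.+1 := \row_j (a j 0 +i* b j 0)%C.
pose mu := (al +i* be)%C.
have : complex.Re mu < 0.
  apply: Vh; rewrite -eigenvalue_trmx.
  apply/eigenvalueP; exists v; last first.
    apply: contraL ab0 => /eqP v0; rewrite negb_or !negbK; apply/andP; split.
      by apply/eqP/matrixP => j k; have /matrixP/(_ 0 j) := v0; rewrite !ord1 !mxE => -[].
    by apply/eqP/matrixP => j k; have /matrixP/(_ 0 j) := v0; rewrite !ord1 !mxE => -[].
  have vR : (map_mx (@complex.Re R) v)^T = a.
    by apply/matrixP => j k; rewrite !mxE ord1.
  have vI : (map_mx (@complex.Im R) v)^T = b.
    by apply/matrixP => j k; rewrite !mxE ord1.
  have ext (w w' : 'rV[R[i]]_n.+1) : map_mx (@complex.Re R) w = map_mx (@complex.Re R) w' ->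
      map_mx (@complex.Im R) w = map_mx (@complex.Im R) w' -> w = w'.
    move=> wR wI; apply/matrixP => j k; move/matrixP/(_ j k) : wR; move/matrixP/(_ j k) : wI.
    by rewrite !mxE; case: (w j k) => ? ?; case: (w' j k) => ? ? /= -> ->.
  apply: ext.
    rewrite map_trmx Re_mulmx_real; apply: trmx_inj.
    rewrite trmx_mul trmxK vR Aca.
    by apply/matrixP => j k; rewrite !mxE ord1.
  rewrite map_trmx Im_mulmx_real; apply: trmx_inj.
  rewrite trmx_mul trmxK vI Acb.
  by apply/matrixP => j k; rewrite !mxE ord1 addrC.
by move=> /=; rewrite ltNge ltW.
Qed.

End RiccatiUniqueness.
Lemma riccati_psd_unique (R : realType) n m (A : 'M[R]_n) (B : 'M[R]_(n, m))
    (Q : 'M[R]_n) (Rw : 'M[R]_m) (V2 P : 'M[R]_n) :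
  symmetric_mx Q -> psd Q -> symmetric_mx Rw -> posdef Rw ->
  lqr_stabilizing A B Q Rw V2 -> riccati_psd A B Q Rw P -> P = V2.
Proof.
case: n A B Q V2 P => [|n] A B Q V2 P; last exact: riccati_psd_unique_pos.
by move=> *; apply/matrixP => -[].
Qed.

(** * Kronecker products up to equality of dimensions *)

Section Retype.
Variable R : comNzRingType.

Lemma retype_id m n (A : 'M[R]_(m, n)) : retype m n A = A.
Proof. exact: conform_mx_id. Qed.

Lemma retype_retype m1 n1 m2 n2 m3 n3 (A : 'M[R]_(m1, n1)) :
  m1 = m2 -> n1 = n2 -> retype m3 n3 (retype m2 n2 A) = retype m3 n3 A.
Proof. by move=> e1 e2; case: m2 / e1; case: n2 / e2; rewrite retype_id. Qed.

Lemma retype_mulmx m1 k1 n1 m2 k2 n2 (A : 'M[R]_(m1, k1)) (B : 'M[R]_(k1, n1)) :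
  m1 = m2 -> k1 = k2 -> n1 = n2 ->
  retype m2 k2 A *m retype k2 n2 B = retype m2 n2 (A *m B).
Proof.
by move=> e1 e2 e3; case: m2 / e1; case: k2 / e2; case: n2 / e3; rewrite !retype_id.
Qed.

Lemma retype_tens m1 n1 p1 q1 m2 n2 p2 q2 (A : 'M[R]_(m1, n1)) (B : 'M[R]_(p1, q1)) :
  m1 = m2 -> n1 = n2 -> p1 = p2 -> q1 = q2 ->
  retype m2 n2 A *t retype p2 q2 B = retype (m2 * p2) (n2 * q2) (A *t B).
Proof.
move=> e1 e2 e3 e4; case: m2 / e1; case: n2 / e2; case: p2 / e3; case: q2 / e4.
by rewrite !retype_id.
Qed.

Lemma retype_tr m1 n1 m2 n2 (A : 'M[R]_(m1, n1)) :
  m1 = m2 -> n1 = n2 -> (retype m2 n2 A)^T = retype n2 m2 A^T.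
Proof. by move=> e1 e2; case: m2 / e1; case: n2 / e2; rewrite !retype_id. Qed.

Lemma retype0 m1 n1 m2 n2 : retype m2 n2 (0 : 'M[R]_(m1, n1)) = 0.
Proof.
by rewrite /retype /conform_mx; case: eqP => // e1; case: eqP => // e2;
  case: _ / e1; case: _ / e2; rewrite castmx_id.
Qed.

Lemma retypeD m1 n1 m2 n2 (A B : 'M[R]_(m1, n1)) :
  retype m2 n2 (A + B) = retype m2 n2 A + retype m2 n2 B.
Proof.
have [e1|n1'] := eqVneq m1 m2; last first.
  by rewrite /retype !nonconform_mx ?addr0 ?n1'// eq_sym n1'.
have [e2|n2'] := eqVneq n1 n2; last first.
  by rewrite /retype !nonconform_mx ?addr0 ?n2' ?orbT// eq_sym n2' orbT.
by case: m2 / e1; case: n2 / e2; rewrite !retype_id.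
Qed.

Lemma retypeZ m1 n1 m2 n2 (a : R) (A : 'M[R]_(m1, n1)) :
  m1 = m2 -> n1 = n2 -> retype m2 n2 (a *: A) = a *: retype m2 n2 A.
Proof. by move=> e1 e2; case: m2 / e1; case: n2 / e2; rewrite !retype_id. Qed.

Lemma retype_sum m1 n1 m2 n2 (I : Type) (r : seq I) (P : pred I)
    (A : I -> 'M[R]_(m1, n1)) :
  retype m2 n2 (\sum_(i <- r | P i) A i) = \sum_(i <- r | P i) retype m2 n2 (A i).
Proof.
by apply: (big_morph _ (@retypeD m1 n1 m2 n2) (@retype0 m1 n1 m2 n2)).
Qed.

Lemma retypeE m1 n1 m2 n2 (A : 'M[R]_(m1, n1)) (e1 : m1 = m2) (e2 : n1 = n2) i j :
  retype m2 n2 A i j = A (cast_ord (esym e1) i) (cast_ord (esym e2) j).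
Proof. by rewrite (retype_castmx (e1, e2)) castmxE. Qed.

Lemma tensmxA m n p q r s (A : 'M[R]_(m, n)) (B : 'M[R]_(p, q)) (C : 'M[R]_(r, s)) :
  A *t (B *t C) = retype (m * (p * r)) (n * (q * s)) (A *t B *t C).
Proof.
apply/matrixP => i j.
case: (mxtens_indexP i) => i1 i'; case: (mxtens_indexP i') => i2 i3.
case: (mxtens_indexP j) => j1 j'; case: (mxtens_indexP j') => j2 j3.
rewrite (retypeE _ (esym (mulnA m p r)) (esym (mulnA n q s))).
have -> : cast_ord (esym (esym (mulnA m p r))) (mxtens_index (i1, mxtens_index (i2, i3)))
    = mxtens_index (mxtens_index (i1, i2), i3).
  by apply: val_inj; rewrite /= mulnDl -mulnA addnA.
have -> : cast_ord (esym (esym (mulnA n q s))) (mxtens_index (j1, mxtens_index (j2, j3)))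
    = mxtens_index (mxtens_index (j1, j2), j3).
  by apply: val_inj; rewrite /= mulnDl -mulnA addnA.
by rewrite !tensmxE mulrA.
Qed.

Lemma tens1mx m n (A : 'M[R]_(m, n)) : (1%:M : 'M[R]_1) *t A = retype (1 * m) (1 * n) A.
Proof.
apply/matrixP => i j; case: (mxtens_indexP i) => i1 i2; case: (mxtens_indexP j) => j1 j2.
rewrite tensmxE (retypeE _ (esym (mul1n m)) (esym (mul1n n))) !ord1 !mxE mul1r.
by congr (A _ _); apply: val_inj.
Qed.

Lemma tensmx1 m n (A : 'M[R]_(m, n)) : A *t (1%:M : 'M[R]_1) = retype (m * 1) (n * 1) A.
Proof.
apply/matrixP => i j; case: (mxtens_indexP i) => i1 i2; case: (mxtens_indexP j) => j1 j2.
rewrite tensmxE (retypeE _ (esym (muln1 m)) (esym (muln1 n))) !ord1 !mxE mulr1.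
by congr (A _ _); apply: val_inj; rewrite /= muln1 addn0.
Qed.

Lemma tensmx11 m n : (1%:M : 'M[R]_m) *t (1%:M : 'M[R]_n) = 1%:M.
Proof.
apply/matrixP => i j; case: (mxtens_indexP i) => i1 i2; case: (mxtens_indexP j) => j1 j2.
rewrite tensmxE !mxE -natrM mulnb; congr (_%:R); congr (nat_of_bool _).
by rewrite (can_eq (@mxtens_indexK m n)) xpair_eqE.
Qed.

Lemma tensmxDr m n p q (A : 'M[R]_(m, n)) (B C : 'M[R]_(p, q)) :
  A *t (B + C) = A *t B + A *t C.
Proof. by apply/matrixP => i j; rewrite !mxE mulrDr. Qed.

Lemma tensmx_sumr m n p q (I : Type) (r : seq I) (P : pred I)
    (A : 'M[R]_(m, n)) (B : I -> 'M[R]_(p, q)) :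
  A *t (\sum_(i <- r | P i) B i) = \sum_(i <- r | P i) A *t B i.
Proof.
by apply: (big_morph (fun X => A *t X)); [exact: tensmxDr|exact: tensmx0].
Qed.

End Retype.

Section Same.
Variable R : comNzRingType.

(** Equality of matrices whose dimensions are only provably equal; it lets the
    associativity of the Kronecker product be used without naming casts. *)
Definition same m1 n1 m2 n2 (A : 'M[R]_(m1, n1)) (B : 'M[R]_(m2, n2)) : Prop :=
  [/\ m1 = m2, n1 = n2 & retype m2 n2 A = B].

Lemma same_refl m n (A : 'M[R]_(m, n)) : same A A.
Proof. by split; rewrite ?retype_id. Qed.

Lemma same_sym m1 n1 m2 n2 (A : 'M[R]_(m1, n1)) (B : 'M[R]_(m2, n2)) :
  same A B -> same B A.
Proof.
by case=> e1 e2; case: m2 / e1 B; case: n2 / e2 => B <-; rewrite retype_id; exact: same_refl.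
Qed.

Lemma same_trans m1 n1 m2 n2 m3 n3 (A : 'M[R]_(m1, n1)) (B : 'M[R]_(m2, n2))
    (C : 'M[R]_(m3, n3)) : same A B -> same B C -> same A C.
Proof.
by case=> e1 e2; case: m2 / e1 B; case: n2 / e2 => B <-; rewrite retype_id.
Qed.

Lemma same_tens m1 n1 p1 q1 m2 n2 p2 q2 (A : 'M[R]_(m1, n1)) (B : 'M[R]_(p1, q1))
    (A' : 'M[R]_(m2, n2)) (B' : 'M[R]_(p2, q2)) :
  same A A' -> same B B' -> same (A *t B) (A' *t B').
Proof.
case=> e1 e2; case: m2 / e1 A'; case: n2 / e2 => A' <-; rewrite retype_id.
case=> e1 e2; case: p2 / e1 B'; case: q2 / e2 => B' <-; rewrite retype_id.
exact: same_refl.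
Qed.

Lemma same_tensA m n p q r s (A : 'M[R]_(m, n)) (B : 'M[R]_(p, q)) (C : 'M[R]_(r, s)) :
  same (A *t (B *t C)) (A *t B *t C).
Proof. by apply: same_sym; split; rewrite ?mulnA// -tensmxA. Qed.

Lemma same_tens1l m n (A : 'M[R]_(m, n)) : same ((1%:M : 'M[R]_1) *t A) A.
Proof. by apply: same_sym; split; rewrite ?mul1n// -tens1mx. Qed.

Lemma same_scalar1 m n : m = n -> same (1%:M : 'M[R]_m) (1%:M : 'M[R]_n).
Proof. by move=> e; case: n / e; exact: same_refl. Qed.

Lemma same_retype m1 n1 m2 n2 m3 n3 (A : 'M[R]_(m1, n1)) (B : 'M[R]_(m2, n2)) :
  same A B -> retype m3 n3 A = retype m3 n3 B.
Proof.
by case=> e1 e2; case: m2 / e1 B; case: n2 / e2 => B <-; rewrite retype_id.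
Qed.

End Same.

Section DotProduct.
Variable R : comNzRingType.

Definition dotv n (v w : 'cV[R]_n) : R := (v^T *m w) 0 0.

Lemma dotvE n (v w : 'cV[R]_n) : dotv v w = \sum_i v i 0 * w i 0.
Proof. by rewrite /dotv mxE; apply: eq_bigr => i _; rewrite mxE. Qed.

Lemma dotvC n (v w : 'cV[R]_n) : dotv v w = dotv w v.
Proof. by rewrite !dotvE; apply: eq_bigr => i _; rewrite mulrC. Qed.

Lemma dotvDr n (v w w' : 'cV[R]_n) : dotv v (w + w') = dotv v w + dotv v w'.
Proof. by rewrite /dotv mulmxDr mxE. Qed.

Lemma dotvDl n (v v' w : 'cV[R]_n) : dotv (v + v') w = dotv v w + dotv v' w.
Proof. by rewrite dotvC dotvDr !(dotvC w). Qed.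

Lemma dotvZr n a (v w : 'cV[R]_n) : dotv v (a *: w) = a * dotv v w.
Proof. by rewrite /dotv -scalemxAr mxE. Qed.

Lemma dotvZl n a (v w : 'cV[R]_n) : dotv (a *: v) w = a * dotv v w.
Proof. by rewrite dotvC dotvZr dotvC. Qed.

Lemma dotv0l n (w : 'cV[R]_n) : dotv 0 w = 0.
Proof. by rewrite -(scale0r 0) dotvZl mul0r. Qed.

Lemma dotv0r n (w : 'cV[R]_n) : dotv w 0 = 0.
Proof. by rewrite dotvC dotv0l. Qed.

Lemma dotvNl n (v w : 'cV[R]_n) : dotv (- v) w = - dotv v w.
Proof. by rewrite -scaleN1r dotvZl mulN1r. Qed.

Lemma dotv_sumr n (I : Type) (r : seq I) (P : pred I) (v : 'cV[R]_n)
    (w : I -> 'cV[R]_n) :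
  dotv v (\sum_(i <- r | P i) w i) = \sum_(i <- r | P i) dotv v (w i).
Proof. exact: (big_morph _ (dotvDr v) (dotv0r v)). Qed.

Lemma dotv_suml n (I : Type) (r : seq I) (P : pred I) (v : 'cV[R]_n)
    (w : I -> 'cV[R]_n) :
  dotv (\sum_(i <- r | P i) w i) v = \sum_(i <- r | P i) dotv (w i) v.
Proof. by rewrite dotvC dotv_sumr; apply: eq_bigr => i _; rewrite dotvC. Qed.

Lemma dotv_mulmx m n (M : 'M[R]_(m, n)) v w : dotv v (M *m w) = dotv (M^T *m v) w.
Proof. by rewrite /dotv trmx_mul trmxK mulmxA. Qed.

Lemma dotv_retype m n (v : 'cV[R]_m) (w : 'cV[R]_n) : m = n ->
  dotv (retype n 1 v) w = dotv v (retype m 1 w).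
Proof. by move=> e; case: n / e w => w; rewrite !retype_id. Qed.

Lemma dotv_retype2 m n (v w : 'cV[R]_m) : m = n ->
  dotv (retype n 1 v) (retype n 1 w) = dotv v w.
Proof. by move=> e; case: n / e; rewrite !retype_id. Qed.

Lemma dotv_tens m n (v v' : 'cV[R]_m) (w w' : 'cV[R]_n) :
  dotv (v *t w : 'cV[R]_(m * n)) (v' *t w' : 'cV[R]_(m * n)) = dotv v v' * dotv w w'.
Proof.
rewrite !dotvE mxtens.mulr_sum; apply: eq_bigr => i _; rewrite !mxE !ord1.
by rewrite mulrACA.
Qed.

Lemma dotv_delta n (v : 'cV[R]_n) i : dotv v (delta_mx i 0) = v i 0.
Proof. by rewrite /dotv -colE !mxE. Qed.

(** As vec stacks columns, the index u of the column comes first. *)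
Lemma dotv_vec p q (M : 'M[R]_(p, q)) (u : 'cV[R]_q) (w : 'cV[R]_p) :
  dotv (vec M) (u *t w : 'cV[R]_(q * p)) = dotv w (M *m u).
Proof.
rewrite !dotvE.
transitivity (\sum_(i < p) \sum_(j < q) w i 0 * (M i j * u j 0)); last first.
  by apply: eq_bigr => i _; rewrite mxE mulr_sumr.
rewrite exchange_big pair_big_dep /=.
rewrite (reindex (@mxtens_index q p)) /=; last first.
  by exists (@mxtens_unindex q p) => k _; rewrite (mxtens_indexK, mxtens_unindexK).
apply: eq_bigr => -[j i] _ /=; rewrite !mxE !mxtens_indexK /= !ord1.
by rewrite mulrC [u _ _ * _]mulrC -mulrA [_ * M _ _]mulrC.
Qed.

End DotProduct.

(** * Kronecker products of vectors *)

(** The product of two columns, with its number of columns 1 * 1 read as 1. *)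
Definition coltens (R : comNzRingType) m n (x : 'cV[R]_m) (y : 'cV[R]_n) :
  'cV[R]_(m * n) := x *t y.

Local Notation "x *v y" := (coltens x y) (at level 40, left associativity).

Section ColumnKronecker.
Variable R : comNzRingType.

Lemma coltensE m n (x : 'cV[R]_m) (y : 'cV[R]_n) i j :
  (x *v y) (mxtens_index (i, j)) 0 = x i 0 * y j 0.
Proof. by rewrite mxE !mxtens_indexK !ord1. Qed.

Lemma tens_coltens m n p q (A : 'M[R]_(m, n)) (B : 'M[R]_(p, q)) x y :
  (A *t B) *m (x *v y) = (A *m x) *v (B *m y).
Proof. exact: (@tensmx_mul R m n p q 1 1 A B x y). Qed.

Lemma coltensA m n p (x : 'cV[R]_m) (y : 'cV[R]_n) (z : 'cV[R]_p) :
  x *v (y *v z) = retype (m * (n * p)) 1 (x *v y *v z).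
Proof. exact: (@tensmxA R m 1 n 1 p 1 x y z). Qed.

Lemma coltens_retypel m1 m2 n (x : 'cV[R]_m1) (y : 'cV[R]_n) :
  m1 = m2 -> retype m2 1 x *v y = retype (m2 * n) 1 (x *v y).
Proof. by move=> e; case: m2 / e; rewrite !retype_id. Qed.

Lemma coltens_retyper m n1 n2 (x : 'cV[R]_m) (y : 'cV[R]_n1) :
  n1 = n2 -> x *v retype n2 1 y = retype (m * n2) 1 (x *v y).
Proof. by move=> e; case: n2 / e; rewrite !retype_id. Qed.

Lemma coltens1l m (y : 'cV[R]_m) : const_mx 1 *v y = retype (1 * m) 1 y.
Proof.
have -> : const_mx 1 = 1%:M :> 'cV[R]_1.
  by apply/matrixP => i j; rewrite !mxE !ord1.
exact: (@tens1mx R m 1 y).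
Qed.

Lemma coltens1r m (y : 'cV[R]_m) : y *v const_mx 1 = retype (m * 1) 1 y.
Proof.
have -> : const_mx 1 = 1%:M :> 'cV[R]_1.
  by apply/matrixP => i j; rewrite !mxE !ord1.
exact: (@tensmx1 R m 1 y).
Qed.

Lemma coltens_sumr m n (I : Type) (r : seq I) (P : pred I)
    (x : 'cV[R]_m) (y : I -> 'cV[R]_n) :
  x *v (\sum_(i <- r | P i) y i) = \sum_(i <- r | P i) x *v y i.
Proof. exact: (@tensmx_sumr R m 1 n 1). Qed.

Lemma dotv_coltens m n (v v' : 'cV[R]_m) (w w' : 'cV[R]_n) :
  dotv (v *v w) (v' *v w') = dotv v v' * dotv w w'.
Proof. exact: dotv_tens. Qed.

Variable n : nat.
Implicit Types (x y z : 'cV[R]_n).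

Lemma kronpow0 x : kronpow x 0 = const_mx 1.
Proof.
rewrite /kronpow ntensmx0; rewrite -[RHS](@retype_id R 1 1); congr (retype _ _ _).
by apply/matrixP => i j; rewrite !mxE !ord1.
Qed.

Lemma kronpowS x k : kronpow x k.+1 = retype (n ^ k.+1) 1 (x *v kronpow x k).
Proof.
case: k => [|k].
  by rewrite kronpow0 coltens1r retype_retype ?muln1.
have H := @retype_tens R n 1 (n ^ k.+1) (1 ^ k.+1) n 1 (n ^ k.+1) 1 x (x ^t k.+1)
  erefl erefl erefl (exp1n _).
rewrite retype_id in H.
transitivity (retype (n ^ k.+2) 1
    (retype (n * n ^ k.+1) (1 * 1) (x *t (x ^t k.+1)))).
  by rewrite retype_retype ?exp1n.
exact: (congr1 (fun M => retype (n ^ k.+2) 1 M) (esym H)).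
Qed.

Lemma kronpow_kronprod x k : kronpow x k = kronprod (fun _ : 'I_k => x).
Proof.
by elim: k => [|k IHk]; [exact: kronpow0 | rewrite kronpowS IHk].
Qed.

Lemma kronpow1 x : kronpow x 1 = retype (n ^ 1) 1 x.
Proof. by rewrite kronpowS kronpow0 coltens1r retype_retype ?muln1. Qed.

Lemma kronpowD x a b :
  kronpow x (a + b) = retype (n ^ (a + b)) 1 (kronpow x a *v kronpow x b).
Proof.
elim: a => [|a IHa].
  by rewrite kronpow0 coltens1l retype_retype ?mul1n// retype_id.
have eD : (n ^ a * n ^ b = n ^ (a + b))%N by rewrite expnD.
have eS : (n * n ^ a = n ^ a.+1)%N by rewrite expnS.
rewrite addSn !kronpowS IHa (coltens_retyper _ _ eD) retype_retype ?eD//.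
rewrite (coltens_retypel _ _ eS) retype_retype ?eS//.
by rewrite coltensA retype_retype ?mulnA.
Qed.

(** The constant family y with z in place i. *)
Definition upd k (y z : 'cV[R]_n) (i : 'I_k) : 'I_k -> 'cV[R]_n :=
  fun j => if j == i then z else y.

Lemma kronprod_upd k y z (i : 'I_k) :
  kronprod (upd y z i) =
  retype (n ^ k) 1 (kronpow y i *v (z *v kronpow y (k.-1 - i))).
Proof.
elim: k i => [[]//|k IHk] i /=; rewrite /upd.
have [-> | [j ->]] : i = ord0 \/ exists j, i = lift ord0 j.
  by case: (unliftP ord0 i) => [j ->|->]; [right; exists j|left].
  rewrite eqxx -kronpow_kronprod kronpow0 subn0 coltens1l.
  by rewrite retype_retype ?mul1n.
rewrite -[ord0 == _]/false.
rewrite (_ : (fun i0 => _) = upd y z j); last first.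
  by apply/funext => i0; rewrite /upd (inj_eq (@lift_inj _ ord0)).
have e : (n ^ j * (n * n ^ (k.-1 - j)) = n ^ k)%N.
  by rewrite -expnS -expnD; congr (_ ^ _)%N; have := ltn_ord j; lia.
rewrite IHk; change (retype (n ^ k.+1) 1 (y *v retype (n ^ k) 1
  (kronpow y j *v (z *v kronpow y (k.-1 - j)))) =
 retype (n ^ k.+1) 1 (kronpow y j.+1 *v (z *v kronpow y (k.+1.-1 - j.+1)))).
have -> : (k.+1.-1 - j.+1 = k.-1 - j)%N by lia.
have eS : (n * n ^ j = n ^ j.+1)%N by rewrite expnS.
rewrite (coltens_retyper _ _ e) retype_retype ?e//.
rewrite kronpowS (coltens_retypel _ _ eS) retype_retype ?eS//.
by rewrite coltensA retype_retype ?mulnA.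
Qed.

Lemma retype_kronpow a b x : a = b -> retype (n ^ b) 1 (kronpow x a) = kronpow x b.
Proof. by move=> ->; rewrite retype_id. Qed.

Lemma kronpow3 x a p b : 
  kronpow x (a + (p + b)) = retype (n ^ (a + (p + b))) 1
    (kronpow x a *v (kronpow x p *v kronpow x b)).
Proof.
have e : (n ^ p * n ^ b = n ^ (p + b))%N by rewrite expnD.
by rewrite kronpowD kronpowD (coltens_retyper _ _ e) retype_retype ?e.
Qed.

(** Each summand of the Lyapunov matrix replaces by M x^(p) one block x^(p) of the
    power x^(k-1+p). *)
Lemma lyap_kronpow k p (M : 'M[R]_(n, n ^ p)) x :
  lyap k M *m retype (n ^ k.-1 * n ^ p) 1 (kronpow x (k.-1 + p)) =
  \sum_(i < k) kronprod (upd x (M *m kronpow x p) i).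
Proof.
rewrite /lyap mulmx_suml.
apply: eq_bigr => i _; have ik := ltn_ord i.
have e1 : (n ^ i * n ^ p * n ^ (k.-1 - i) = n ^ k.-1 * n ^ p)%N.
  by rewrite -?expnD; congr (_ ^ _)%N; lia.
have e2 : (n ^ i * n * n ^ (k.-1 - i) = n ^ k)%N.
  by rewrite -[in (_ * n)%N](expn1 n) -!expnD; congr (_ ^ _)%N; lia.
have -> : retype (n ^ k.-1 * n ^ p) 1 (kronpow x (k.-1 + p)) =
   retype (n ^ k.-1 * n ^ p) 1 (kronpow x i *v kronpow x p *v kronpow x (k.-1 - i)).
  have ek : (i + (p + (k.-1 - i)) = k.-1 + p)%N by lia.
  rewrite -(retype_kronpow x ek) kronpow3 retype_retype//; last first.
    by rewrite -?expnD; congr (_ ^ _)%N; lia.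
  rewrite retype_retype//; last by rewrite -?expnD; congr (_ ^ _)%N; lia.
  by rewrite coltensA retype_retype// mulnA.
rewrite retype_mulmx// !tens_coltens !mul1mx kronprod_upd coltensA.
by rewrite retype_retype// mulnA.
Qed.

Lemma dotv_unfold i (v : 'cV[R]_(n ^ i)) (u : 'cV[R]_(n ^ i.-1)) z : (0 < i)%N ->
  dotv (unfold v *m u) z = dotv v (retype (n ^ i) 1 (u *v z)).
Proof.
move=> i0; have e : (n ^ i.-1 * n = n ^ i)%N by rewrite -expnSr prednK.
rewrite dotvC /unfold -dotv_vec unvecK.
by rewrite dotv_retype//.
Qed.

End ColumnKronecker.

(** * The linear flow on tensor powers *)

Section SquareLyapunov.
Variable (R : comNzRingType) (n : nat).
Implicit Types (M : 'M[R]_n).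

(** The matrix of the derivation induced by M on the k-th tensor power; for k > 0
    it is lyap k M with its column dimension n ^ k.-1 * n read as n ^ k. *)
Definition sqlyap k M : 'M[R]_(n ^ k) := retype (n ^ k) (n ^ k) (lyap k M).

(** The derivation obeys the Leibniz rule on the product of the first factor with
    the other ones. *)
Lemma sqlyapS k M :
  sqlyap k.+1 M =
  retype (n ^ k.+1) (n ^ k.+1) (M *t (1%:M : 'M[R]_(n ^ k)) + (1%:M : 'M[R]_n) *t sqlyap k M).
Proof.
rewrite /sqlyap /lyap !retype_sum big_ord_recl retypeD; congr (_ + _).
  rewrite retype_retype ?[RHS]retype_id; last 2 first.
  - by rewrite -mulnA mul1n [RHS]expnS subn0.
  - by rewrite -mulnA mul1n subn0 mulnC.
  apply: same_retype; apply: same_tens; first exact: same_tens1l.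
  by apply: same_scalar1; rewrite subn0.
rewrite tensmx_sumr retype_sum; apply: eq_bigr => i _; have ik := ltn_ord i.
have e3 : (n ^ i * n * n ^ (k.-1 - i) = n ^ k)%N.
  by rewrite -[X in (_ * X * _)%N](expn1 n) -?expnD; congr (_ ^ _)%N; lia.
have e4 : (n ^ k.-1 * n = n ^ k)%N by rewrite -expnSr; congr (_ ^ _)%N; lia.
have e5 : (k.+1.-1 - lift ord0 i = k.-1 - i)%N by rewrite /= /bump; lia.
have e6 : (n ^ lift ord0 i * n * n ^ (k.+1.-1 - lift ord0 i) = n ^ k.+1)%N.
  by rewrite e5 /= /bump/= add1n !expnS -e3 !mulnA.
rewrite retype_retype ?e6//; last by rewrite expnSr.
apply: same_retype; rewrite e5.
set I1 := (1%:M : 'M[R]_(n ^ lift ord0 i)); set I2 := (1%:M : 'M[R]_(n ^ (k.-1 - i))).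
set I0 := (1%:M : 'M[R]_n); set Ii := (1%:M : 'M[R]_(n ^ i)).
have h1 : same I1 (I0 *t Ii) by rewrite /I0 /Ii tensmx11; apply: same_scalar1; rewrite expnS.
have h2 := same_tens (same_tens h1 (same_refl M)) (same_refl I2).
have h3 := same_tens (same_sym (same_tensA I0 Ii M)) (same_refl I2).
have h4 := same_sym (same_tensA I0 (Ii *t M) I2).
have h5 : same (Ii *t M *t I2) (retype (n ^ k) (n ^ k) (retype (n ^ k) (n ^ k.-1 * n) (Ii *t M *t I2))).
  by rewrite retype_retype ?e3 ?e4//; split; rewrite ?e3.
exact: same_trans h2 (same_trans h3 (same_trans h4 (same_tens (same_refl I0) h5))).
Qed.

End SquareLyapunov.
Section TensorFlow.
Variables (R : realType) (n : nat).
Implicit Types (M : 'M[R]_n) (x y z : 'cV[R]_n).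

Lemma colcastE m1 m2 (e : m1 = m2) (w : 'cV[R]_m1) j :
  retype m2 1 w j 0 = w (cast_ord (esym e) j) 0.
Proof. by rewrite (retypeE _ e erefl) cast_ord_id. Qed.

Lemma coltensEu p q (v : 'cV[R]_p) (w : 'cV[R]_q) k :
  (v *v w) k 0 = v (mxtens_unindex k).1 0 * w (mxtens_unindex k).2 0.
Proof. by rewrite mxE !ord1. Qed.

Lemma sqlyap_coltens k M (x : 'cV[R]_n) (w : 'cV[R]_(n ^ k)) :
  sqlyap k.+1 M *m retype (n ^ k.+1) 1 (x *v w) =
  retype (n ^ k.+1) 1 ((M *m x) *v w + x *v (sqlyap k M *m w)).
Proof.
rewrite sqlyapS retype_mulmx ?expnS// mulmxDl; congr (retype _ _ (_ + _)).
  by rewrite tens_coltens mul1mx.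
by rewrite tens_coltens mul1mx.
Qed.

Lemma kronprodS k (a : 'I_k.+1 -> 'cV[R]_n) :
  kronprod a = retype (n ^ k.+1) 1 (a ord0 *v kronprod (fun i => a (lift ord0 i))).
Proof. by []. Qed.

Lemma lti_solution_kronprod k M (x : 'I_k -> R -> 'cV[R]_n) :
  (forall i, lti_solution M (x i)) ->
  lti_solution (sqlyap k M) (fun t => kronprod (fun i => x i t)).
Proof.
elim: k x => [|k IHk] x xS.
  split=> [i|t i t0].
    rewrite (_ : (fun _ => _) = (fun=> 1)); last by apply/funext => t; rewrite mxE.
    by move=> t; exact: cvg_cst.
  rewrite (_ : (fun _ => _) = cst 1); last by apply/funext => s; rewrite mxE.
  by rewrite /sqlyap /lyap big_ord0 retype0 mul0mx mxE; exact: is_derive_cst.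
have [yC yD] := IHk (fun i => x (lift ord0 i)) (fun i => xS _).
have [xC xD] := xS ord0.
set y := fun t => kronprod (fun i => x (lift ord0 i) t).
have e : (n * n ^ k = n ^ k.+1)%N by rewrite expnS.
split=> [i|t i t0].
  set i' := cast_ord (esym e) i.
  rewrite (_ : (fun _ => _) = (fun t => x ord0 t (mxtens_unindex i').1 0 *
      y t (mxtens_unindex i').2 0)); last first.
    apply/funext => t; rewrite kronprodS (colcastE e) -/i'.
    by rewrite coltensEu.
  by apply: within_mul; [exact: xC|exact: yC].
set i' := cast_ord (esym e) i.
rewrite (_ : (fun s => _) = (fun s => x ord0 s (mxtens_unindex i').1 0 *
      y s (mxtens_unindex i').2 0)); last first.
  apply/funext => s; rewrite kronprodS (colcastE e) -/i'.
  by rewrite coltensEu.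
apply: (is_derive_eq (is_deriveM (xD t _ t0) (yD t _ t0))).
rewrite kronprodS sqlyap_coltens (colcastE e) -/i' [RHS]mxE.
rewrite !coltensEu /GRing.scale/= addrC.
by congr (_ + _); rewrite mulrC.
Qed.

Lemma kronprod_cvg k (x : 'I_k -> R -> 'cV[R]_n) (l : 'I_k -> 'cV[R]_n) :
  (forall i j, x i t j 0 @[t --> +oo] --> l i j 0) ->
  forall j, kronprod (fun i => x i t) j 0 @[t --> +oo] --> kronprod l j 0.
Proof.
elim: k x l => [|k IHk] x l xl j.
  rewrite (_ : (fun _ => _) = cst 1); last by apply/funext => s; rewrite mxE.
  by rewrite mxE; exact: cvg_cst.
have e : (n * n ^ k = n ^ k.+1)%N by rewrite expnS.
set i' := cast_ord (esym e) j.
rewrite (_ : (fun s => _) = (fun s => x ord0 s (mxtens_unindex i').1 0 *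
      kronprod (fun i => x (lift ord0 i) s) (mxtens_unindex i').2 0)); last first.
  apply/funext => s; rewrite kronprodS (colcastE e) -/i'.
  by rewrite coltensEu.
rewrite kronprodS (colcastE e) -/i' coltensEu.
by apply: cvgM; [exact: xl|apply: IHk => i; exact: xl].
Qed.

Lemma kronprod_zero k (l : 'I_k.+1 -> 'cV[R]_n) : l ord0 = 0 -> kronprod l = 0.
Proof.
move=> l0; rewrite kronprodS l0 /coltens.
have -> : (0 : 'cV[R]_n) *t kronprod (fun i => l (lift ord0 i)) = 0 by exact: tens0mx.
exact: retype0.
Qed.

Lemma is_derive0_const (f : R -> R) : {within `[0, +oo[, continuous f} ->
  (forall t : R, 0 < t -> is_derive t (1 : R) f 0) ->
  forall t, 0 <= t -> f t = f 0.
Proof.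
move=> fC fD t t0.
have fC' : {within `[0, t], continuous f}.
  by apply: continuous_subspaceW fC; apply: subset_itvl; rewrite bnd_simp.
have fD' (s : R) : s \in `]0, t[%R -> is_derive s (1 : R) f ((fun=> 0) s).
  by rewrite in_itv/= => /andP[s0 _]; exact: fD.
have [c _] := MVT_segment t0 fD' fC'.
by rewrite mul0r => /eqP; rewrite subr_eq0 => /eqP.
Qed.

(** A form annihilated by the derivation along a product of decaying trajectories
    is constant along them and tends to 0, hence vanishes initially. *)
Lemma sqlyap_conserved k M (x : 'I_k.+1 -> R -> 'cV[R]_n) (w : 'cV[R]_(n ^ k.+1)) :
  hurwitz M -> (forall i, lti_solution M (x i)) ->
  (forall t, 0 < t -> dotv ((sqlyap k.+1 M)^T *m w) (kronprod (fun i => x i t)) = 0) ->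
  dotv w (kronprod (fun i => x i 0)) = 0.
Proof.
move=> Mh xS w0; have zS := lti_solution_kronprod xS.
pose z t := kronprod (fun i => x i t); pose f t := dotv w (z t).
have fC : {within `[0, +oo[, continuous f}.
  by apply: within_mulmx; exact: zS.1.
have fD (t : R) : 0 < t -> is_derive t (1 : R) f 0.
  move=> t0; apply: (is_derive_eq (@is_derive_lin R _ w^T z
    (fun t => sqlyap k.+1 M *m z t) t (fun i => zS.2 t i t0))).
  by have := w0 t t0; rewrite -dotv_mulmx.
have fc := is_derive0_const fC fD.
have f0 : f t @[t --> +oo] --> (0 : R).
  have -> : (0 : R) = (w^T *m (0 : 'cV[R]_(n ^ k.+1))) 0 0 by rewrite mulmx0 mxE.
  apply: (@cvg_mulmx R _ _ w^T z) => j.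
  rewrite -(@kronprod_zero k (fun=> 0) erefl).
  by apply: kronprod_cvg => i j'; rewrite mxE; exact: hurwitz_decay Mh (xS i) j'.
have f1 : f t @[t --> +oo] --> f 0.
  apply/cvgrPdist_le => /= eps eps0; near=> t.
  have t0 : 0 <= t by near: t; apply: nbhs_pinfty_ge; rewrite num_real.
  by rewrite (fc t t0) subrr normr0 ltW.
exact: (cvg_unique _ f1 f0).
Unshelve. all: end_near. Qed.

Lemma is_derive_coord (x z : 'cV[R]_n) i : is_derive x z (fun y => y i 0) (z i 0).
Proof.
have H : derivable (id : 'cV[R]_n -> 'cV[R]_n) x z by [].
have := (derivable_mxP _ _ _).1 H i 0 => D.
apply: DeriveDef => //; have := @derive_mx _ _ _ _ id x z H.
by rewrite derive_id => /matrixP/(_ i 0) ->; rewrite mxE.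
Qed.

(** The derivative at x of the k-th Kronecker power, in the direction z. *)
Definition dkronpow k (x z : 'cV[R]_n) : 'cV[R]_(n ^ k) :=
  \sum_(i < k) kronprod (upd x z i).

Lemma dkronpowS k x z :
  dkronpow k.+1 x z =
  retype (n ^ k.+1) 1 (z *v kronpow x k + x *v dkronpow k x z).
Proof.
rewrite /dkronpow big_ord_recl retypeD coltens_sumr retype_sum; congr (_ + _).
by rewrite kronpow_kronprod.
Qed.

Lemma is_derive_kronpow k x z j :
  is_derive x z (fun y => kronpow y k j 0) (dkronpow k x z j 0).
Proof.
elim: k j => [|k IHk] j.
  rewrite /dkronpow big_ord0 mxE.
  rewrite (_ : (fun _ => _) = cst 1); last by apply/funext => s; rewrite kronpow0 mxE.
  exact: is_derive_cst.
have e : (n * n ^ k = n ^ k.+1)%N by rewrite expnS.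
set i' := cast_ord (esym e) j.
rewrite (_ : (fun y => _) = (fun y => y (mxtens_unindex i').1 0 *
      kronpow y k (mxtens_unindex i').2 0)); last first.
  apply/funext => y; rewrite kronpowS (colcastE e) -/i'.
  by rewrite coltensEu.
apply: (is_derive_eq (is_deriveM (is_derive_coord x z _) (IHk _))).
rewrite dkronpowS (colcastE e) -/i' [RHS]mxE !coltensEu.
by rewrite /GRing.scale/= addrC; congr (_ + _); rewrite mulrC.
Qed.

Lemma is_derive_form k (v : 'cV[R]_(n ^ k)) x z :
  is_derive x z (fun y => dotv v (kronpow y k)) (dotv v (dkronpow k x z)).
Proof.
rewrite (_ : (fun y => _) = \sum_(j < n ^ k) (fun y => v j 0 * kronpow y k j 0)); last first.
  by apply/funext => y; rewrite dotvE fct_sumE.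
rewrite dotvE; apply: is_derive_sum => j.
exact: (is_deriveZ (v j 0) (is_derive_kronpow x z j)).
Qed.

Lemma sqlyap_kronpow k M x : sqlyap k M *m kronpow x k = dkronpow k x (M *m x).
Proof.
elim: k => [|k IHk].
  by rewrite /sqlyap /lyap /dkronpow !big_ord0 retype0 mul0mx.
by rewrite kronpowS sqlyap_coltens IHk dkronpowS.
Qed.

End TensorFlow.

(** * Symmetric tensors *)

Section Digits.
Variable R : comNzRingType.

(** Coordinates in which permuting the factors of a Kronecker product amounts to
    permuting digits. *)
Lemma kronprod_digits n k : exists dg : 'I_(n ^ k) -> {ffun 'I_k -> 'I_n},
  bijective dg /\ forall (a : 'I_k -> 'cV[R]_n) j,
    kronprod a j 0 = \prod_i a i (dg j i) 0.
Proof.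
elim: k => [|k [dg [dg_bij dgE]]].
  exists (fun=> [ffun i : 'I_0 => match i with Ordinal _ h => False_rect _ (notF h) end]).
  split; last by move=> a j; rewrite big_ord0 mxE.
  apply: inj_card_bij; last by rewrite card_ffun !card_ord.
  by move=> [[|i] ei] [[|j] ej] _ //; exact: val_inj.
have e : (n * n ^ k = n ^ k.+1)%N by rewrite expnS.
pose f (j : 'I_(n ^ k.+1)) : {ffun 'I_k.+1 -> 'I_n} :=
  let u := mxtens_unindex (cast_ord (esym e) j) in
  [ffun i => if unlift ord0 i is Some i' then dg u.2 i' else u.1].
have f0 j : f j ord0 = (mxtens_unindex (cast_ord (esym e) j)).1.
  by rewrite ffunE unlift_none.
have fS j i : f j (lift ord0 i) = dg (mxtens_unindex (cast_ord (esym e) j)).2 i.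
  by rewrite ffunE liftK.
exists f; split.
  apply: inj_card_bij; last by rewrite card_ffun !card_ord.
  move=> i j fij; apply: (cast_ord_inj (eq_n := esym e)).
  apply: (can_inj (@mxtens_unindexK n (n ^ k))).
  have H1 := f0 i; have H2 := f0 j; rewrite fij H2 in H1.
  have H3 : (mxtens_unindex (cast_ord (esym e) i)).2 =
            (mxtens_unindex (cast_ord (esym e) j)).2.
    apply: (bij_inj dg_bij); apply/ffunP => i'; by rewrite -!fS fij.
  by move: H1 H3; case: (mxtens_unindex _) => a b; case: (mxtens_unindex _) => c d /= -> ->.
move=> a j; rewrite big_ord_recl f0 /=.
rewrite (retypeE _ e erefl) cast_ord_id mxE !ord1 dgE; congr (_ * _).
by apply: eq_bigr => i _; rewrite fS.
Qed.

Lemma kronprod_delta n k (j : 'I_(n ^ k)) :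
  exists a : 'I_k -> 'cV[R]_n, kronprod a = delta_mx j 0.
Proof.
have [dg [dg_bij dgE]] := kronprod_digits n k.
exists (fun i => delta_mx (dg j i) 0); apply/matrixP => j' c; rewrite ord1 dgE mxE andbT.
have [->|jj'] := eqVneq j' j; first by rewrite big1// => i _; rewrite mxE !eqxx.
have [i di] : exists i, dg j' i != dg j i.
  apply/existsP; rewrite -negb_forall; apply: contra jj' => /forallP E.
  by apply/eqP/(bij_inj dg_bij)/ffunP => i; exact/eqP.
by rewrite (bigD1 i)//= mxE (negbTE di) mul0r.
Qed.

Lemma dotv_kronprod_eq0 n k (w : 'cV[R]_(n ^ k)) :
  (forall a : 'I_k -> 'cV[R]_n, dotv w (kronprod a) = 0) -> w = 0.
Proof.
move=> w0; apply/matrixP => j c; rewrite ord1 mxE.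
by have [a aE] := kronprod_delta j; rewrite -dotv_delta -aE w0.
Qed.

End Digits.

Section Symmetric.
Variables (R : fieldType) (n : nat).

(** Averages, over the permutations of the digits, the vectors obtained from w. *)
Lemma symmetrization_exists k (w : 'cV[R]_(n ^ k)) :
  exists v : 'cV[R]_(n ^ k), is_symmetrization w v.
Proof.
have [dg [[und dgK undK] dgE]] := kronprod_digits R n k.
pose act (s : {perm 'I_k}) (j : 'I_(n ^ k)) := und [ffun i => dg j (s i)].
have actK s : cancel (act s) (act (s^-1)%g).
  move=> j; rewrite /act undK; apply: (can_inj dgK); rewrite undK.
  by apply/ffunP => i; rewrite !ffunE permKV.
have actV s : cancel (act (s^-1)%g) (act s).
  by move=> j; have := actK (s^-1)%g j; rewrite invgK.
pose v : 'cV[R]_(n ^ k) := (k`!%:R)^-1 *: \sum_(s : {perm 'I_k}) \col_j w (act s j) 0.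
have H (a : 'I_k -> 'cV[R]_n) (s : {perm 'I_k}) :
    dotv (\col_j w (act s j) 0) (kronprod a) = dotv w (kronprod (a \o s)).
  rewrite !dotvE [RHS](reindex (act s)) /=; last first.
    by exists (act (s^-1)%g) => j _; [exact: actK | exact: actV].
  apply: eq_bigr => j _; rewrite mxE; congr (_ * _); rewrite !dgE.
  rewrite [LHS](reindex_inj (@perm_inj _ s)); apply: eq_bigr => i _ /=.
  by rewrite /act undK ffunE.
have vE (a : 'I_k -> 'cV[R]_n) : v^T *m kronprod a =
    (k`!%:R)^-1 *: \sum_(s : {perm 'I_k}) w^T *m kronprod (a \o s).
  apply/matrixP => i j; rewrite !ord1 -[LHS]/(dotv v (kronprod a)).
  rewrite /v dotvZl dotv_suml mxE summxE; congr (_ * _).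
  by apply: eq_bigr => s _; rewrite H.
exists v; split => // a s; rewrite !vE; congr (_ *: _).
rewrite (reindex_inj (mulIg s)); apply: eq_bigr => t _.
by congr (_ *m kronprod _); apply/funext => i; rewrite /= permM.
Qed.

Lemma symmetrization_form k (w v : 'cV[R]_(n ^ k)) (x : 'cV[R]_n) :
  (k`!%:R : R) != 0 ->
  is_symmetrization w v -> dotv v (kronpow x k) = dotv w (kronpow x k).
Proof.
move=> k0 [_ /(_ (fun=> x))]; rewrite /dotv !kronpow_kronprod => ->.
rewrite (eq_bigr (fun=> w^T *m kronprod (fun _ : 'I_k => x)))//.
by rewrite sumr_const card_Sn -scaler_nat scalerA mulVf// scale1r.
Qed.

Lemma symmetric_upd k (v : 'cV[R]_(n ^ k)) (y z : 'cV[R]_n) (i j : 'I_k) :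
  tensor_symmetric v ->
  dotv v (kronprod (upd y z i)) = dotv v (kronprod (upd y z j)).
Proof.
move=> /(_ (upd y z i) (tperm i j)); rewrite /dotv => ->; congr ((_ *m kronprod _) 0 0).
apply/funext => l; rewrite /upd /=; case: tpermP => [->|->|].
- by rewrite eq_sym.
- by rewrite !eqxx.
- by move=> /eqP/negbTE -> /eqP/negbTE ->.
Qed.

(** By symmetry every summand of the derivative equals the one where z is the last
    factor, and this is the index that unfold singles out. *)
Lemma symmetric_dkronpow k (v : 'cV[R]_(n ^ k)) (y z : 'cV[R]_n) :
  (0 < k)%N -> tensor_symmetric v ->
  \sum_(i < k) dotv v (kronprod (upd y z i)) =
  k%:R * dotv (unfold v *m kronpow y k.-1) z.
Proof.
case: k v => // k v _ vsym.
rewrite (eq_bigr (fun=> dotv v (kronprod (upd y z ord_max)))); last first.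
  by move=> i _; exact: symmetric_upd.
rewrite sumr_const card_ord dotv_unfold//.
rewrite kronprod_upd subnn kronpow0 coltens1r.
rewrite (coltens_retyper _ _ (esym (muln1 n))).
by rewrite retype_retype ?muln1// -[LHS]mulr_natl.
Qed.

End Symmetric.

(** * Solvability of the linear systems *)

Section Solvability.
Variables (R : realType) (n : nat).

(** A row vector annihilating this square matrix is a form conserved along products
    of trajectories, hence zero. Taking the trajectories as a hypothesis avoids the
    matrix exponential. *)
Lemma sqlyap_solvable k (M : 'M[R]_n) (r : 'cV[R]_(n ^ k.+1)) :
  hurwitz M -> (forall x0, exists x, lti_solution M x /\ x 0 = x0) ->
  exists w, (sqlyap k.+1 M)^T *m w = r.
Proof.
move=> Mh flow; suff U : (sqlyap k.+1 M)^T \in unitmx.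
  by exists (invmx (sqlyap k.+1 M)^T *m r); rewrite mulKVmx.
rewrite unitmx_tr -row_free_unit -kermx_eq0; apply/negPn/negP => kn0.
move: kn0; rewrite -nz_row_eq0; set u := nz_row _ => /negP; apply.
have u0 : u *m sqlyap k.+1 M = 0 by apply/sub_kermxP; exact: nz_row_sub.
suff w0 : u^T = 0 by rewrite -[u]trmxK w0 trmx0.
apply: dotv_kronprod_eq0 => a.
have /choice [x xP] : forall i, exists x, lti_solution M x /\ x 0 = a i.
  by move=> i; exact: flow.
rewrite (_ : a = fun i => x i 0); last by apply/funext => i; rewrite (xP i).2.
apply: (sqlyap_conserved Mh) => [i|t _]; first exact: (xP i).1.
by rewrite -trmx_mul u0 trmx0 dotv0l.
Qed.

Lemma lqr_flow m (A : 'M[R]_n) (B : 'M[R]_(n, m)) Q Rw V2 :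
  lqr_stabilizing A B Q Rw V2 ->
  forall x0, exists x, lti_solution (closed_loop A B Rw V2) x /\ x 0 = x0.
Proof.
move=> [_ _ Vopt] x0; have [x [xadm _]] := Vopt x0; exists x.
by have := admissible_feedback xadm; rewrite !mulmxA.
Qed.

Variables (m l : nat) (lam : int).
Variables (A : 'M[R]_n) (F : forall p, 'M[R]_(n, n ^ p)).
Variables (B : 'M[R]_(n, m)) (G : forall p, 'M[R]_(n, n ^ p * m)).
Variables (Q : 'M[R]_n) (Rw : 'M[R]_m) (q : forall p, 'cV[R]_(n ^ p)).

Lemma coef_system_sqlyap V2 v k (vt : 'cV[R]_(n ^ k.+1)) :
  coef_system l lam A F B G Rw q V2 v vt <->
  (sqlyap k.+1 (closed_loop A B Rw V2))^T *m vt = coef_rhs l lam F B G Rw q v k.+1.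
Proof.
rewrite /coef_system /sqlyap.
have e : (n ^ k.+1.-1 * n = n ^ k.+1)%N by rewrite expnSr.
rewrite (retype_tr _ erefl e) -[vt in X in _ <-> X](retype_id vt).
by rewrite retype_mulmx.
Qed.

(** Only the degrees from 2 to k - 1 occur, which is why the systems can be solved
    one after the other. *)
Lemma coef_rhs_ext v v' k : (forall i, (2 <= i < k)%N -> v i = v' i) ->
  coef_rhs l lam F B G Rw q v k = coef_rhs l lam F B G Rw q v' k.
Proof.
move=> vv'; rewrite /coef_rhs.
have -> : \sum_(2 <= i < k.+1) \sum_(2 <= p < k.+1 | (i + p == k.+1)%N)
       retype (n ^ k) 1 ((lyap i (Fext l F p))^T *m v i) =
   \sum_(2 <= i < k.+1) \sum_(2 <= p < k.+1 | (i + p == k.+1)%N)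
       retype (n ^ k) 1 ((lyap i (Fext l F p))^T *m v' i).
  apply: eq_big_nat => i /andP[i2 ik]; rewrite big_nat_cond [RHS]big_nat_cond.
  apply: eq_bigr => p /andP[/andP[p2 pk] /eqP ip].
  by rewrite vv'//; apply/andP; split; lia.
apply: (congr2 (fun a b => a + b)).
  apply: (congr1 (fun b => _ + 4^-1 *: b)).
  apply: eq_big_nat => i /andP[i2 ik]; rewrite big_nat_cond [RHS]big_nat_cond.
  apply: eq_bigr => p /andP[/andP[p2 pk] /eqP ip].
  by rewrite !vv'//; apply/andP; split; lia.
apply: (congr1 (fun b => 4^-1 *: b)).
apply: eq_big_nat => o /andP[hk _].
apply: eq_big_nat => p _.
apply: eq_bigr => r _.
apply: eq_big_nat => i /andP[i2 ik].
apply: congr_big_nat; [by []|by []|by []|move=> j].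
move=> /andP[/eqP ijo /andP[j2 jk]].
have vi : v i = v' i by apply: vv'; apply/andP; split; lia.
have vj : v j = v' j by apply: vv'; apply/andP; split; lia.
rewrite /Gblock vi vj; reflexivity.
Qed.

Lemma coefs_exist d V2 : lqr_stabilizing A B Q Rw V2 ->
  exists v, coefs_given_by l lam A F B G Q Rw q d V2 v.
Proof.
move=> Vlqr; have [Vric Vh _] := Vlqr; have flow := lqr_flow Vlqr.
elim: d => [|d [v [_ v2 vk]]].
  exists (fun i => retype (n ^ i) 1 (vec V2)); split => //; first exact: retype_id.
  by move=> k /andP[k3 k0]; have := leq_trans k3 k0.
have [d2|d2] := leqP d 1.
  exists v; split => // k /andP[k3 kd].
  by exfalso; move: (leq_trans k3 kd); rewrite ltnS leqNgt ltnS d2.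
have [vt vtE] := sqlyap_solvable (coef_rhs l lam F B G Rw q v d.+1) Vh flow.
have [w wP] := symmetrization_exists vt.
pose v' i := if i == d.+1 then retype (n ^ i) 1 w else v i.
have v'E i : i != d.+1 -> v' i = v i by rewrite /v' => /negbTE ->.
have v'd : v' d.+1 = w by rewrite /v' eqxx retype_id.
clearbody v'.
have ext k : (k <= d.+1)%N -> coef_rhs l lam F B G Rw q v' k = coef_rhs l lam F B G Rw q v k.
  move=> kd; apply: coef_rhs_ext => i /andP[_ ik]; apply: v'E.
  by rewrite ltn_eqF// (leq_trans ik).
exists v'; split => //; first by rewrite v'E//; lia.
move=> k /andP[k3]; rewrite leq_eqVlt => /predU1P[->|kd].
  exists vt; rewrite v'd; split; last exact: wP.
  by apply/coef_system_sqlyap; rewrite (ext d.+1 (leqnn _)); exact: vtE.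
have [|vtk [sysk symk]] := vk k; first by rewrite k3.
have vk' : v' k = v k by apply: v'E; rewrite ltn_eqF.
exists vtk; rewrite vk'; split; last exact: symk.
by rewrite /coef_system (ext k (ltnW kd)); exact: sysk.
Qed.

End Solvability.

(** * The right-hand side as a polynomial *)

Section KroneckerIdentities.
Variable R : comNzRingType.

Lemma same_coltens m1 n1 m2 n2 (x : 'cV[R]_m1) (y : 'cV[R]_n1) (x' : 'cV[R]_m2)
    (y' : 'cV[R]_n2) : same x x' -> same y y' -> same (x *v y) (x' *v y').
Proof. by move=> sx sy; exact: (@same_tens R m1 1 n1 1 m2 1 n2 1 _ _ _ _ sx sy). Qed.

Lemma same_coltensA m n p (x : 'cV[R]_m) (y : 'cV[R]_n) (z : 'cV[R]_p) :
  same (x *v (y *v z)) (x *v y *v z).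
Proof. exact: (@same_tensA R m 1 n 1 p 1 x y z). Qed.

Lemma vec_scalar1 m :
  vec (1%:M : 'M[R]_m) = \sum_c (delta_mx c 0 : 'cV[R]_m) *v (delta_mx c 0 : 'cV[R]_m).
Proof.
apply/matrixP => s j; rewrite ord1 summxE; case: (mxtens_indexP s) => a b.
under eq_bigr do rewrite coltensE !mxE !andbT.
rewrite mxE !mxE mxtens_indexK /= (bigD1 a)//= eqxx mul1r big1 ?addr0; last first.
  by move=> c ca; rewrite [a == c]eq_sym (negbTE ca) mul0r.
by [].
Qed.

Lemma shuffle_coltens p q (u : 'cV[R]_q) (w : 'cV[R]_p) :
  shuffle R q p *m (u *v w) = w *v u.
Proof.
pose M : 'M[R]_(p, q) := \matrix_(i, j) (w i 0 * u j 0).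
have -> : u *v w = vec M by apply/matrixP => s j; rewrite !mxE !ord1 mulrC.
by rewrite -shuffleP; apply/matrixP => s j; rewrite !mxE !ord1 mulrC.
Qed.

Lemma mulmx_const1 p (y : 'cV[R]_p) : y *m (const_mx 1 : 'cV[R]_1) = y.
Proof.
by apply/matrixP => i j; rewrite mxE big_ord1 [X in _ * X]mxE mulr1 [j]ord1.
Qed.

(** The matrix is I (x) vec[I] with its number of columns N * 1 read as N; it
    appends the diagonal tensor. *)
Lemma tens_vec1_mulmx N m D (e : (N * (m * m) = D)%N) (y : 'cV[R]_N) :
  retype D N ((1%:M : 'M[R]_N) *t vec (1%:M : 'M[R]_m)) *m y =
  \sum_c retype D 1 (y *v ((delta_mx c 0 : 'cV[R]_m) *v (delta_mx c 0 : 'cV[R]_m))).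
Proof.
have {1}-> : y = retype N 1 (y *v (const_mx 1 : 'cV[R]_1)).
  by rewrite coltens1r retype_retype ?muln1// retype_id.
rewrite retype_mulmx ?muln1// tens_coltens mul1mx -retype_sum; congr (retype _ _ _).
rewrite -coltens_sumr -vec_scalar1; congr (_ *v _).
exact: mulmx_const1.
Qed.

Lemma coltens_scalar m (s : 'cV[R]_1) (y : 'cV[R]_m) (N : nat) :
  (m = N)%N -> retype N 1 (s *v y) = s 0 0 *: retype N 1 y.
Proof.
move=> e; have {1}-> : s = s 0 0 *: (const_mx 1 : 'cV[R]_1).
  by apply/matrixP => i j; rewrite !mxE !ord1 mulr1.
have -> : (s 0 0 *: (const_mx 1 : 'cV[R]_1)) *v y = s 0 0 *: ((const_mx 1 : 'cV[R]_1) *v y).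
  by apply/matrixP => i j; rewrite !mxE mulrA.
by rewrite coltens1l retypeZ ?mul1n// retype_retype ?mul1n.
Qed.

Lemma dotv_delta_l n (v : 'cV[R]_n) i : dotv (delta_mx i 0) v = v i 0.
Proof. by rewrite dotvC dotv_delta. Qed.

End KroneckerIdentities.

Section RightHandSideForm.
Variables (R : realType) (n m l : nat) (lam : int).
Variables (A : 'M[R]_n) (F : forall p, 'M[R]_(n, n ^ p)).
Variables (B : 'M[R]_(n, m)) (G : forall p, 'M[R]_(n, n ^ p * m)).
Variables (Rw : 'M[R]_m) (q : forall p, 'cV[R]_(n ^ p)).
Variable v : forall i, 'cV[R]_(n ^ i).

(** The part of degree p of the input matrix g. *)
Definition gpart p (x : 'cV[R]_n) : 'M[R]_(n, m) :=
  Gext l B G p *m retype (n ^ p * m) m (kronpow x p *t (1%:M : 'M[R]_m)).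

(** V_i x^(i-1): for a symmetric v_i, the gradient of v_i^T x^(i) divided by i. *)
Definition covec i (x : 'cV[R]_n) : 'cV[R]_n := unfold (v i) *m kronpow x i.-1.

Lemma gpart_entry p x (w : 'cV[R]_n) d :
  ((gpart p x)^T *m w) d 0 =
  dotv (kronpow x p *v delta_mx d 0) ((Gext l B G p)^T *m w).
Proof.
rewrite -dotv_delta_l /gpart trmx_mul -mulmxA dotv_mulmx trmxK; congr (dotv _ _).
have {1}-> : (delta_mx d 0 : 'cV[R]_m) = retype m 1 ((const_mx 1 : 'cV[R]_1) *v (delta_mx d 0 : 'cV[R]_m)).
  by rewrite coltens1l retype_retype ?mul1n// retype_id.
rewrite retype_mulmx ?mul1n// tens_coltens mul1mx retype_id; congr (_ *v _).
exact: mulmx_const1.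
Qed.

(** Read from the right: the factor I (x) vec[I] appends the sum of the e_c (x) e_c
    to x^(k-p), the shuffle moves the first e_c next to x^(r), and the left factor
    contracts the result with x^(p) and the sum of the e_d (x) e_d. What is left is
    the bilinear form of Rw^-1. *)
Lemma Gblock_form k p r i j x : (0 < i)%N -> (0 < j)%N -> (i + j + (p + r) = k.+2)%N ->
  dotv (retype (n ^ k) 1 (vec (Gblock l B G Rw v k p r i j))) (kronpow x k) =
  dotv ((gpart p x)^T *m covec i x) (invmx Rw *m ((gpart r x)^T *m covec j x)).
Proof.
move=> i0 j0 ijk.
have e1 : (n ^ (k - p) * n ^ p = n ^ k)%N by rewrite -expnD; congr (_ ^ _)%N; lia.
have -> : kronpow x k = retype (n ^ k) 1 (kronpow x (k - p) *v kronpow x p).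
  have ek : (k - p + p = k)%N by lia.
  by rewrite -(retype_kronpow x ek) kronpowD retype_retype// expnD.
rewrite dotv_retype2// dotv_vec.
set xa := kronpow x j.-1; set xb := kronpow x i.-1; set xc := kronpow x r.
pose ed (c : 'I_m) : 'cV[R]_m := delta_mx c 0.
have e2 : (n ^ (k - p) * (m * m) = n ^ j.-1 * (n ^ i.-1 * (n ^ r * m)) * m)%N.
  rewrite !mulnA -!expnD; congr (_ ^ _ * _ * _)%N; lia.
have eY : (j.-1 + (i.-1 + r) = k - p)%N by lia.
have YE : same (xa *v (xb *v xc)) (kronpow x (k - p)).
  rewrite -(retype_kronpow x eY) kronpow3 retype_retype; last 2 first.
  - by rewrite !expnD.
  - by [].
  by split => //; rewrite -eY !expnD.
have YcE c : retype (n ^ j.-1 * (n ^ i.-1 * (n ^ r * m)) * m) 1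
      (kronpow x (k - p) *v (ed c *v ed c)) = xa *v (xb *v (xc *v ed c)) *v ed c.
  have h := same_trans (same_coltens (same_sym YE) (same_refl (ed c *v ed c)))
    (same_coltensA _ (ed c) (ed c)).
  have h1 := same_coltens (same_sym (same_coltensA xa (xb *v xc) (ed c))) (same_refl (ed c)).
  have h2 := same_coltens (same_coltens (same_refl xa)
    (same_sym (same_coltensA xb xc (ed c)))) (same_refl (ed c)).
  by have [_ _ ->] := same_trans h (same_trans h1 h2).
rewrite /Gblock -!mulmxA tens_vec1_mulmx// !mulmx_sumr dotv_sumr.
under eq_bigr => c _ do rewrite -/(ed c) YcE tens_coltens tens_coltens !mul1mx shuffle_coltens.
set al := (gpart p x)^T *m covec i x; set be := (gpart r x)^T *m covec j x.
rewrite dotvE.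
transitivity (\sum_c \sum_d al d 0 * invmx Rw d c * be c 0); last first.
  rewrite exchange_big; apply: eq_bigr => d _ /=.
  by rewrite [X in _ = _ * X]mxE mulr_sumr; apply: eq_bigr => c _; rewrite mulrA.
apply: eq_bigr => c _.
set mid := retype _ _ (_ *t _).
have midE : mid *m (xa *v (xc *v ed c *v xb) *v ed c) =
    be c 0 *: (((Gext l B G p)^T *m covec i x) *v (invmx Rw *m ed c)).
  have h1 : same (xa *v (xc *v ed c *v xb) *v ed c) ((xa *v (xc *v ed c)) *v (xb *v ed c)).
    apply: same_trans (same_sym (same_coltensA _ _ _)).
    exact: same_coltens (same_coltensA _ _ _) (same_refl _).
  have [d1 _ <-] := same_sym h1.
  rewrite /mid retype_mulmx ?mul1n// !tens_coltens coltens_scalar// retype_id; congr (_ *: _).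
    by rewrite -/(dotv _ _) dotv_vec gpart_entry -mulmxA.
  by rewrite mulmxA.
rewrite {}midE dotv_mulmx (retype_tr _ (muln1 _) (mulnA _ _ _)) trmx_tens trmx1 trmxK.
rewrite tens_vec1_mulmx ?mulnA// dotv_suml; apply: eq_bigr => d _.
have -> : retype (n ^ p * m * m) 1 (kronpow x p *v (delta_mx d 0 *v delta_mx d 0)) =
    (kronpow x p *v ed d) *v ed d.
  by have [_ _ ->] := same_coltensA (kronpow x p) (ed d) (ed d).
rewrite dotvZr dotv_coltens -gpart_entry -/al dotv_delta_l -colE.
by rewrite mulrC [col c _ d 0]mxE.
Qed.

Lemma gpart0 x : gpart 0 x = B.
Proof.
rewrite /gpart /Gext eqxx kronpow0.
have -> : retype (n ^ 0 * m) m ((const_mx 1 : 'cV[R]_(n ^ 0)) *t (1%:M : 'M[R]_m)) =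
    retype (n ^ 0 * m) m (1%:M : 'M[R]_m).
  have -> : (const_mx 1 : 'cV[R]_(n ^ 0)) = (1%:M : 'M[R]_1).
    by apply/matrixP => i j; rewrite !mxE !ord1.
  exact: same_retype (same_tens1l _).
rewrite retype_mulmx//; last by rewrite expn0 mul1n.
by rewrite mulmx1 retype_id.
Qed.

Lemma gpart_gt p x : (l < p)%N -> gpart p x = 0.
Proof.
by move=> lp; rewrite /gpart /Gext leqNgt lp; case: p lp => // p _; rewrite mul0mx.
Qed.

Lemma lyap_form i p k x : (0 < i)%N -> (i + p = k.+1)%N ->
  dotv (retype (n ^ k) 1 ((lyap i (Fext l F p))^T *m v i)) (kronpow x k) =
  dotv (v i) (dkronpow i x (Fext l F p *m kronpow x p)).
Proof.
move=> i0 ip; have ek : (i.-1 + p = k)%N by lia.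
have e : (n ^ i.-1 * n ^ p = n ^ k)%N by rewrite -expnD ek.
rewrite (dotv_retype _ _ e) -(retype_kronpow x ek).
rewrite (retype_retype _ _ _ (congr1 (expn n) ek) erefl).
by rewrite -dotv_mulmx lyap_kronpow.
Qed.

Lemma quadratic_form i j k x : (0 < i)%N -> (0 < j)%N -> (i + j = k.+2)%N ->
  dotv (retype (n ^ k) 1
    (vec ((unfold (v i))^T *m B *m invmx Rw *m B^T *m unfold (v j)))) (kronpow x k) =
  dotv (B^T *m covec i x) (invmx Rw *m (B^T *m covec j x)).
Proof.
move=> i0 j0 ij; have ek : (j.-1 + i.-1 = k)%N by lia.
have e : (n ^ j.-1 * n ^ i.-1 = n ^ k)%N by rewrite -expnD ek.
rewrite -(retype_kronpow x ek) kronpowD.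
rewrite (retype_retype _ _ _ (esym (expnD n _ _)) erefl).
rewrite dotv_retype2// dotv_vec /covec -!mulmxA dotv_mulmx trmxK dotv_mulmx.
by rewrite !mulmxA.
Qed.

Definition quad p r i j (x : 'cV[R]_n) : R :=
  dotv ((gpart p x)^T *m covec i x) (invmx Rw *m ((gpart r x)^T *m covec j x)).

Lemma coef_rhs_form k x :
  dotv (coef_rhs l lam F B G Rw q v k) (kronpow x k) =
  - (\sum_(2 <= i < k.+1) \sum_(2 <= p < k.+1 | (i + p == k.+1)%N)
       dotv (v i) (dkronpow i x (Fext l F p *m kronpow x p)))
  - dotv (qext lam q k) (kronpow x k)
  + 4^-1 * (\sum_(3 <= i < k.+1) \sum_(3 <= j < k.+1 | (i + j == k.+2)%N)
       (i * j)%N%:R * quad 0 0 i j x)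
  + 4^-1 * (\sum_(1 <= o < (2 * l).+1)
       \sum_(0 <= p < o.+1) \sum_(0 <= r < o.+1 | (p + r == o)%N)
       \sum_(2 <= i < k.+1) \sum_(2 <= j < k.+1 | (i + j + o == k.+2)%N)
         (i * j)%N%:R * quad p r i j x).
Proof.
rewrite /coef_rhs; set S1 := \sum_(2 <= i < _) _; set S2 := \sum_(3 <= i < _) _.
set S3 := \sum_(1 <= o < _) _.
rewrite !dotvDl !dotvNl !dotvZl.
have -> : dotv S1 (kronpow x k) = \sum_(2 <= i < k.+1)
    \sum_(2 <= p < k.+1 | (i + p == k.+1)%N)
       dotv (v i) (dkronpow i x (Fext l F p *m kronpow x p)).
  rewrite /S1 dotv_suml; apply: eq_big_nat => i /andP[i2 ik].
  rewrite dotv_suml; apply: eq_bigr => p /eqP ip.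
  by rewrite lyap_form//; lia.
have -> : dotv S2 (kronpow x k) =
    \sum_(3 <= i < k.+1) \sum_(3 <= j < k.+1 | (i + j == k.+2)%N)
       (i * j)%N%:R * quad 0 0 i j x.
  rewrite /S2 dotv_suml; apply: eq_big_nat => i /andP[i2 ik].
  rewrite dotv_suml; apply: congr_big_nat; [by []|by []|by []|move=> j].
  move=> /andP[/eqP ij /andP[j2 jk]].
  by rewrite dotvZl quadratic_form ?/quad ?gpart0//; lia.
have -> // : dotv S3 (kronpow x k) = \sum_(1 <= o < (2 * l).+1)
       \sum_(0 <= p < o.+1) \sum_(0 <= r < o.+1 | (p + r == o)%N)
       \sum_(2 <= i < k.+1) \sum_(2 <= j < k.+1 | (i + j + o == k.+2)%N)
         (i * j)%N%:R * quad p r i j x.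
rewrite /S3 dotv_suml; apply: eq_big_nat => o _.
rewrite dotv_suml; apply: eq_big_nat => p _.
rewrite dotv_suml; apply: eq_bigr => r /eqP pr.
rewrite dotv_suml; apply: eq_big_nat => i /andP[i2 ik].
rewrite dotv_suml; apply: congr_big_nat; [by []|by []|by []|move=> j].
move=> /andP[/eqP ij /andP[j2 jk]].
rewrite dotvZl Gblock_form; [by []|lia|lia|by rewrite pr].
Qed.

End RightHandSideForm.

(** * Rearrangement of sums over four indices *)

Lemma sum_nat_ord (V : nmodType) a b M (P : pred nat) (f : nat -> V) : (b <= M)%N ->
  \sum_(a <= i < b | P i) f i =
  \sum_(i < M) if [&& (a <= i)%N, (i < b)%N & P i] then f i else 0.
Proof.
move=> bM; rewrite (big_nat_widen a b M)// (big_nat_widenl a 0)// big_mkord.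
rewrite big_mkcond /=; apply: eq_bigr => i _.
by case: (P i); case: (i < b)%N; case: (a <= i)%N.
Qed.

Lemma sum_ord_delta (V : nmodType) M a (b : bool) (f : nat -> V) : ((a < M)%N \/ b = false) ->
  \sum_(i < M) (if (nat_of_ord i == a) && b then f i else 0) = if b then f a else 0.
Proof.
case: b => [[aM|//]|_]; last by rewrite big1// => i _; rewrite andbF.
rewrite (bigD1 (Ordinal aM))//= eqxx big1 ?addr0// => i.
by rewrite -val_eqE /= => /negbTE ->.
Qed.

Section FourfoldSums.
Variable R : realType.

Definition sum4 M (f : nat -> nat -> nat -> nat -> R) : R :=
  \sum_(p < M) \sum_(r < M) \sum_(i < M) \sum_(j < M) f p r i j.

Lemma sum_if (I : Type) (s : seq I) (b : bool) (f : I -> R) :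
  (if b then \sum_(i <- s) f i else 0) = \sum_(i <- s) if b then f i else 0.
Proof. by case: b => //; rewrite big1. Qed.

Lemma sum4_eq M f g : (forall p r i j, (p < M)%N -> (r < M)%N -> (i < M)%N ->
    (j < M)%N -> f p r i j = g p r i j) -> sum4 M f = sum4 M g.
Proof.
move=> fg; apply: eq_bigr => p _; apply: eq_bigr => r _.
by apply: eq_bigr => i _; apply: eq_bigr => j _; apply: fg.
Qed.

Lemma sum4D M f g :
  sum4 M (fun p r i j => f p r i j + g p r i j) = sum4 M f + sum4 M g.
Proof.
rewrite /sum4 -big_split; apply: eq_bigr => p _; rewrite -big_split.
apply: eq_bigr => r _; rewrite -big_split; apply: eq_bigr => i _.
by rewrite -big_split.
Qed.

Lemma sum4Z M a f : sum4 M (fun p r i j => a * f p r i j) = a * sum4 M f.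
Proof.
rewrite /sum4 mulr_sumr; apply: eq_bigr => p _; rewrite mulr_sumr.
apply: eq_bigr => r _; rewrite mulr_sumr; apply: eq_bigr => i _.
by rewrite mulr_sumr.
Qed.

Lemma sum4_delta M p0 r0 i0 j0 (f : nat -> nat -> nat -> nat -> R) :
  (p0 < M)%N -> (r0 < M)%N -> (i0 < M)%N -> (j0 < M)%N ->
  sum4 M (fun p r i j => if [&& p == p0, r == r0, i == i0 & j == j0]
                         then f p r i j else 0) = f p0 r0 i0 j0.
Proof.
move=> pM rM iM jM; rewrite /sum4.
have E (a : nat) (g : nat -> R) : (a < M)%N ->
    \sum_(i < M) (if nat_of_ord i == a then g i else 0) = g a.
  move=> aM; rewrite -[RHS](@sum_ord_delta R M a true g (or_introl aM)).
  by apply: eq_bigr => i _; rewrite andbT.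
have Eif (a : nat) (b : bool) (g : nat -> R) : (a < M)%N ->
    \sum_(i < M) (if b && (nat_of_ord i == a) then g i else 0) = if b then g a else 0.
  by move=> aM; rewrite -(E a g)// sum_if; apply: eq_bigr => i _; case: b.
transitivity (\sum_(p < M) if nat_of_ord p == p0 then f p r0 i0 j0 else 0); last first.
  exact: E (fun p => f p r0 i0 j0) pM.
apply: eq_bigr => p _.
rewrite -(Eif r0 _ (fun r => f p r i0 j0))//; apply: eq_bigr => r _.
rewrite -(Eif i0 _ (fun i => f p r i j0))//; apply: eq_bigr => i _.
rewrite -(Eif j0 _ (fun j => f p r i j))//; apply: eq_bigr => j _.
by rewrite !andbA.
Qed.

(** The two sums are the parts p = r = 0 and p + r > 0 of a single one: given
    i + j = k + 2, the bounds i, j >= 3 and i, j < k agree, and if p + r > 0 then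
    i, j >= 2 imply i, j < k. *)
Lemma coef_rhs_sum4 (T : nat -> nat -> nat -> nat -> R) l k M :
  (forall p r i j, (l < p)%N || (l < r)%N -> T p r i j = 0) ->
  (k.+2 <= M)%N -> ((2 * l).+1 <= M)%N ->
  \sum_(3 <= i < k.+1) \sum_(3 <= j < k.+1 | (i + j == k.+2)%N) T 0 0 i j
  + \sum_(1 <= o < (2 * l).+1) \sum_(0 <= p < o.+1)
      \sum_(0 <= r < o.+1 | (p + r == o)%N)
       \sum_(2 <= i < k.+1) \sum_(2 <= j < k.+1 | (i + j + o == k.+2)%N) T p r i j
  = sum4 M (fun p r i j => if [&& (2 <= i < k)%N, (2 <= j < k)%N &
      (p + r + (i + j) == k.+2)%N] then T p r i j else 0).
Proof.
move=> T0 kM lM.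
pose g p r := \sum_(i < M) \sum_(j < M) if [&& (2 <= i < k)%N, (2 <= j < k)%N &
      (p + r + (i + j) == k.+2)%N] then T p r i j else 0.
have g0 p r : (l < p)%N || (l < r)%N -> g p r = 0.
  move=> h; rewrite /g big1// => i _; rewrite big1// => j _.
  by rewrite T0//; case: ifP.
have -> : \sum_(3 <= i < k.+1) \sum_(3 <= j < k.+1 | (i + j == k.+2)%N) T 0 0 i j = g 0 0.
  rewrite (@sum_nat_ord _ _ _ M); last by lia.
  apply: eq_bigr => i _; rewrite (@sum_nat_ord _ _ _ M); last by lia.
  rewrite sum_if; apply: eq_bigr => j _.
  do ?[case: ifP => ?] => //; exfalso; lia.
have -> : \sum_(1 <= o < (2 * l).+1) \sum_(0 <= p < o.+1)
      \sum_(0 <= r < o.+1 | (p + r == o)%N)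
       \sum_(2 <= i < k.+1) \sum_(2 <= j < k.+1 | (i + j + o == k.+2)%N) T p r i j =
   \sum_(p < M) \sum_(r < M) if (0 < p + r)%N then g p r else 0.
  transitivity (\sum_(o < M) \sum_(p < M) \sum_(r < M)
      if (nat_of_ord o == p + r)%N && (0 < p + r < (2 * l).+1)%N then g p r else 0).
    rewrite (@sum_nat_ord _ _ _ M); last by lia.
    apply: eq_bigr => o _.
    have [ho|ho] := boolP (1 <= o < (2 * l).+1)%N; last first.
      rewrite andbT; rewrite (negbTE ho) big1// => p _; rewrite big1// => r _.
      do ?[case: ifP => ?] => //; exfalso; lia.
    rewrite andbT ho (@sum_nat_ord _ _ _ M);  last by lia.
    apply: eq_bigr => p _; rewrite (@sum_nat_ord _ _ _ M); last by lia.
    rewrite sum_if; apply: eq_bigr => r _.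
    have [opr|opr] := eqVneq (nat_of_ord o) (p + r)%N; last first.
      do ?[case: ifP => ?] => //; exfalso; lia.
    rewrite ifT; last by lia.
    rewrite ifT; last by lia.
    rewrite ifT; last by lia.
    rewrite (@sum_nat_ord _ _ _ M); last by lia.
    apply: eq_bigr => i _; rewrite (@sum_nat_ord _ _ _ M); last by lia.
    rewrite sum_if; apply: eq_bigr => j _.
    do ?[case: ifP => ?] => //; exfalso; lia.
  rewrite exchange_big; apply: eq_bigr => p _; rewrite exchange_big.
  apply: eq_bigr => r _.
  rewrite (@sum_ord_delta R M (p + r) (0 < p + r < (2 * l).+1)%N (fun=> g p r)); last first.
    by case: (ltnP (p + r) M) => h; [left|right; lia].
  have [h|h] := boolP ((l < p)%N || (l < r)%N).
    by rewrite g0//; case: ifP; case: ifP.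
  do ?[case: ifP => ?] => //; exfalso; lia.
rewrite /sum4 -/g.
have M0 : (0 < M)%N by lia.
have -> : g 0 0 = \sum_(p < M) \sum_(r < M) if (nat_of_ord p == 0%N) && (nat_of_ord r == 0%N)
     then g p r else 0.
  rewrite (bigD1 (Ordinal M0))//= (bigD1 (Ordinal M0))//=.
  rewrite !big1 ?addr0//.
    by move=> p; rewrite -val_eqE /= => /negbTE h; rewrite big1// => r _; rewrite h.
  by move=> r; rewrite -val_eqE /= => /negbTE h; rewrite h.
rewrite -big_split; apply: eq_bigr => p _; rewrite -big_split; apply: eq_bigr => r _ /=.
rewrite -/(g p r); case: (p : nat) => [|p'] /=; last by rewrite add0r.
by case: (r : nat) => [|r'] /=; rewrite ?add0r ?addr0.
Qed.

End FourfoldSums.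

(** * Homogeneous polynomial functions *)

Section HomogeneousForms.
Variables (R : realType) (n : nat).
Implicit Types (x y : 'cV[R]_n) (p : 'cV[R]_n -> R).

(** Homogeneous polynomial functions of degree k, split along the coordinates; b
    bounds the sum of the absolute values of the coefficients. The recursion replaces
    multi-indices by inductions on k. *)
Fixpoint hform (k : nat) (b : R) (p : 'cV[R]_n -> R) : Prop :=
  match k with
  | 0 => exists2 c : R, `|c| <= b & p = (fun=> c)
  | k'.+1 => exists (b_ : 'I_n -> R) (p_ : 'I_n -> 'cV[R]_n -> R),
      [/\ forall i, hform k' (b_ i) (p_ i), \sum_i b_ i <= b &
          p = (fun x => \sum_i x i 0 * p_ i x)]
  end.

Definition bounded_by (r : R) x := forall i, `|x i 0| <= r.

Lemma hform_ge0 k b p : hform k b p -> 0 <= b.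
Proof.
elim: k b p => [|k IHk] b p /=; first by move=> [c cb _]; apply: le_trans cb.
move=> [b_ [p_ [pH bb _]]]; apply: le_trans bb; apply: sumr_ge0 => i _.
exact: IHk (pH i).
Qed.

Lemma hform_le k b b' p : b <= b' -> hform k b p -> hform k b' p.
Proof.
case: k => [|k] bb' /=; first by move=> [c cb ->]; exists c => //; exact: le_trans bb'.
by move=> [b_ [p_ [pH bb pE]]]; exists b_, p_; split => //; exact: le_trans bb'.
Qed.

Lemma hformD k b b' p p' : hform k b p -> hform k b' p' ->
  hform k (b + b') (fun x => p x + p' x).
Proof.
elim: k b b' p p' => [|k IHk] b b' p p' /=.
  move=> [c cb ->] [c' cb' ->]; exists (c + c') => //.
  by rewrite (le_trans (ler_normD _ _))// lerD.
move=> [b1 [p1 [pH1 bb1 ->]]] [b2 [p2 [pH2 bb2 ->]]].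
exists (fun i => b1 i + b2 i), (fun i x => p1 i x + p2 i x); split => //.
- by move=> i; exact: IHk.
- by rewrite big_split lerD.
- apply/funext => x; rewrite -big_split; apply: eq_bigr => i _.
  by rewrite mulrDr.
Qed.

Lemma hform_norm k b p r x : 0 <= r -> hform k b p -> bounded_by r x ->
  `|p x| <= b * r ^+ k.
Proof.
move=> r0 + xr; elim: k b p => [|k IHk] b p /=.
  by move=> [c cb ->]; rewrite expr0 mulr1.
move=> [b_ [p_ [pH bb ->]]]; apply: (le_trans (ler_norm_sum _ _ _)).
apply: (@le_trans _ _ (\sum_i b_ i * r ^+ k.+1)).
  apply: ler_sum => i _; rewrite normrM exprS mulrCA.
  by apply: ler_pM => //; exact: IHk.
by rewrite -mulr_suml ler_wpM2r// exprn_ge0.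
Qed.

Lemma hform_scale k b p s x : hform k b p -> p (s *: x) = s ^+ k * p x.
Proof.
elim: k b p => [|k IHk] b p /=; first by move=> [c _ ->]; rewrite expr0 mul1r.
move=> [b_ [p_ [pH _ ->]]]; rewrite mulr_sumr; apply: eq_bigr => i _.
by rewrite mxE (IHk _ _ (pH i)) exprS; ring.
Qed.

Lemma is_derive_lincomb i x (p_ : 'I_n -> 'cV[R]_n -> R) (d : 'I_n -> R) :
  (forall j, is_derive x (delta_mx i 0 : 'cV[R]_n) (p_ j) (d j)) ->
  is_derive x (delta_mx i 0 : 'cV[R]_n) (fun x => \sum_j x j 0 * p_ j x)
    (p_ i x + \sum_j x j 0 * d j).
Proof.
move=> pD; pose e : 'cV[R]_n := delta_mx i 0.
have coordE j : e j 0 = (j == i)%:R by rewrite mxE andbT.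
have -> : (fun x => \sum_i x i 0 * p_ i x) = \sum_(i < n) (fun x => x i 0 * p_ i x).
  by apply/funext => y; rewrite fct_sumE.
have -> : p_ i x + \sum_j x j 0 * d j =
    \sum_(j < n) (x j 0 *: d j + p_ j x *: (e j 0 : R)).
  rewrite big_split/= addrC; congr (_ + _); rewrite (bigD1 i)//= big1 ?addr0.
    by rewrite coordE eqxx /GRing.scale/= mulr1.
  by move=> j ji; rewrite coordE (negbTE ji) scaler0.
apply: is_derive_sum => j.
exact: (is_deriveM (is_derive_coord x e j) (pD j)).
Qed.

Lemma hform_derive k b p i : hform k.+1 b p ->
  exists2 p', hform k (k.+1%:R * b) p' &
    forall x, is_derive x (delta_mx i 0 : 'cV[R]_n) p (p' x).
Proof.
elim: k b p => [|k IHk] b p.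
  move=> [b_ [p_ [pH bb ->]]]; have [c cb pE] := pH i.
  exists (p_ i).
    exists c => //; rewrite mul1r (le_trans cb)// (le_trans _ bb)//.
    rewrite (bigD1 i)//= lerDl sumr_ge0// => j _.
    exact: (@hform_ge0 0 _ _ (pH j)).
  move=> x; have -> : p_ i x = p_ i x + \sum_j x j 0 * 0.
    by rewrite big1 ?addr0// => j _; rewrite mulr0.
  by apply: is_derive_lincomb => j; have [c' _ ->] := pH j; exact: is_derive_cst.
move=> [b_ [p_ [pH bb ->]]].
have /choice[p' p'P] : forall j, exists p', hform k (k.+1%:R * b_ j) p' /\
    forall x, is_derive x (delta_mx i 0 : 'cV[R]_n) (p_ j) (p' x).
  by move=> j; have [p' ? ?] := IHk _ _ (pH j); exists p'.
exists (fun x => p_ i x + \sum_j x j 0 * p' j x); last first.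
  by move=> x; apply: is_derive_lincomb => j; exact: (p'P j).2.
apply: (@hform_le _ (b_ i + k.+1%:R * \sum_j b_ j)).
  rewrite -[X in _ <= X * _]natr1 mulrDl mul1r addrC lerD ?ler_wpM2l//.
  apply: le_trans bb; rewrite (bigD1 i)//= lerDl sumr_ge0// => j _.
  exact: (@hform_ge0 k.+1 _ _ (pH j)).
apply: hformD => //; exists (fun j => k.+1%:R * b_ j), p'; split => //.
  by move=> j; exact: (p'P j).1.
by rewrite mulr_sumr.
Qed.

Lemma hform_partial k b p i : hform k.+1 b p -> hform k (k.+1%:R * b) (partial i p).
Proof.
move=> /(hform_derive i)[p' p'H p'D]; suff -> : partial i p = p' by [].
by apply/funext => x; have := p'D x => H; rewrite /partial derive_val.
Qed.

Lemma is_derive_hform k b p i x : hform k.+1 b p ->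
  is_derive x (delta_mx i 0 : 'cV[R]_n) p (partial i p x).
Proof.
move=> /(hform_derive i)[p' p'H p'D]; have := p'D x => H.
by rewrite /partial derive_val.
Qed.

Lemma partial_lincomb i x (p_ : 'I_n -> 'cV[R]_n -> R) (d : 'I_n -> R) :
  (forall j, is_derive x (delta_mx i 0 : 'cV[R]_n) (p_ j) (d j)) ->
  partial i (fun x => \sum_j x j 0 * p_ j x) x = p_ i x + \sum_j x j 0 * d j.
Proof. by move=> /is_derive_lincomb D; rewrite /partial derive_val. Qed.

Lemma hform_euler k b p y : hform k.+1 b p ->
  \sum_i y i 0 * partial i p y = k.+1%:R * p y.
Proof.
elim: k b p => [|k IHk] b p [b_ [p_ [pH bb ->]]].
  rewrite mul1r; apply: eq_bigr => i _; congr (_ * _).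
  have D j : is_derive y (delta_mx i 0 : 'cV[R]_n) (p_ j) 0.
    by have [c' _ ->] := pH j; exact: is_derive_cst.
  by rewrite (partial_lincomb D) big1 ?addr0// => j _; rewrite mulr0.
under eq_bigr => i _ do rewrite (partial_lincomb (fun j => is_derive_hform i y (pH j)))
  mulrDr mulr_sumr.
rewrite big_split -[k.+2%:R]natr1 mulrDl mul1r addrC; congr (_ + _).
rewrite exchange_big mulr_sumr; apply: eq_bigr => j _ /=.
rewrite mulrCA -(IHk _ _ (pH j)) mulr_sumr; apply: eq_bigr => i _.
by rewrite mulrCA.
Qed.

End HomogeneousForms.

(** * Termwise differentiation of power series *)

Section TermwiseDerivative.
Variables (R : realType) (n : nat).
Implicit Types (x y v : 'cV[R]_n) (f p : 'cV[R]_n -> R).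

Lemma is_derive_line f v x (df : 'cV[R]_n -> R) :
  (forall y, is_derive y v f (df y)) ->
  forall t : R, is_derive t (1 : R) (fun t => f (t *: v + x)) (df (t *: v + x)).
Proof.
move=> fD t; have := fD (t *: v + x) => -[fd fv].
have E : (fun h : R => h^-1 *: (((fun t => f (t *: v + x)) \o shift t) (h *: (1 : R))
            - f (t *: v + x))) =
         (fun h => h^-1 *: ((f \o shift (t *: v + x)) (h *: v) - f (t *: v + x))).
  apply/funext => h; congr (_ *: (f _ - _)) => /=.
  by rewrite /shift/= scalerDl /GRing.scale/= mulr1 addrA.
by split; rewrite /derivable /derive E.
Qed.

Lemma is_derive_of_quadratic f v x (L C delta : R) : 0 < delta ->
  (forall h, `|h| <= delta -> `|f (h *: v + x) - f x - h * L| <= h ^+ 2 * C) ->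
  is_derive x v f L.
Proof.
move=> d0 fh.
suff H : (fun h : R => h^-1 *: ((f \o shift x) (h *: v) - f x)) h @[h --> 0^'] --> L.
  split; first by apply/cvg_ex; exists L.
  exact: cvg_lim H.
apply/cvgrPdist_le => /= eps eps0.
have C1 : 0 < `|C| + 1 by rewrite ltr_wpDl.
have d1 : 0 < Num.min delta (eps / (`|C| + 1)) by rewrite lt_min d0 divr_gt0.
near=> h.
have h0 : h != 0 by near: h; exact: nbhs_dnbhs_neq.
have hd : `|h| <= Num.min delta (eps / (`|C| + 1)).
  by near: h; apply: dnbhs0_le.
move: hd; rewrite le_min ler_pdivlMr// => /andP[hd he].
have := fh h hd; rewrite /shift/= => H.
have -> : L - h^-1 *: (f (h *: v + x) - f x) = - (h^-1 * (f (h *: v + x) - f x - h * L)).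
  by rewrite /GRing.scale/=; field.
rewrite normrN normrM normfV ler_pdivrMl ?normr_gt0//; apply: (le_trans H).
rewrite -[h ^+ 2]real_normK ?num_real// expr2 -mulrA ler_wpM2l//.
apply: le_trans he; rewrite ler_wpM2l//.
by rewrite (le_trans (ler_norm _))// lerDl.
Unshelve. all: end_near. Qed.

Lemma mvt_bound (g dg : R -> R) (h C : R) :
  (forall t : R, is_derive t (1 : R) g (dg t)) ->
  (forall s, (0 <= s <= h) || (h <= s <= 0) -> `|dg s| <= C) ->
  `|g h - g 0| <= C * `|h|.
Proof.
move=> gD gC.
have cont a b : {within `[a, b], continuous g}.
  apply: continuous_subspaceT => t; have := gD t => gt.
  exact/differentiable_continuous/derivable1_diffP.
have [h0|h0] := leP 0 h.
  have [c] := MVT_segment h0 (fun t _ => gD t) (cont 0 h).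
  rewrite in_itv/= => cI ->; rewrite subr0 normrM ler_wpM2r//.
  by apply: gC; rewrite cI.
have [c] := MVT_segment (ltW h0) (fun t _ => gD t) (cont h 0).
rewrite in_itv/= => cI; rewrite distrC => ->; rewrite sub0r normrM normrN ler_wpM2r//.
by apply: gC; rewrite cI orbT.
Qed.

Lemma bounded_line r x i (h s : R) : bounded_by r x ->
  bounded_by r (h *: delta_mx i 0 + x) -> (0 <= s <= h) || (h <= s <= 0) ->
  bounded_by r (s *: delta_mx i 0 + x).
Proof.
move=> xr hr sh j; have := xr j; have := hr j; rewrite !mxE andbT.
by case: (j == i); rewrite ?mulr1 ?mulr0 ?add0r// !ler_norml; case/orP: sh; lra.
Qed.

(** The mean value theorem applied twice; the predecessors are harmless because the
    factor k * k.-1 vanishes in degrees 0 and 1. *)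
Lemma hform_remainder k b p i r x h : 0 <= r -> hform k b p ->
  bounded_by r x -> bounded_by r (h *: delta_mx i 0 + x) ->
  `|p (h *: delta_mx i 0 + x) - p x - h * partial i p x| <=
  h ^+ 2 * ((k * k.-1)%:R * b * r ^+ (k.-2)).
Proof.
move=> r0 pH xr hr.
pose e : 'cV[R]_n := delta_mx i 0.
case: k pH => [|k] pH.
  rewrite mul0r mul0r mulr0; case: pH => c _ ->.
  by rewrite /partial derive_cst mulr0 subrr subr0 normr0.
pose g t := p (t *: e + x) - t * partial i p x.
pose dg t := partial i p (t *: e + x) - partial i p x.
have gD (t : R) : is_derive t (1 : R) g (dg t).
  have L := is_derive_line x (fun y => is_derive_hform i y pH) t.
  have := is_deriveB L (is_deriveZ (partial i p x) (is_derive_id t (1 : R))).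
  rewrite /GRing.scale/= mulr1 => D.
  rewrite /g (_ : (fun t => _) = (fun t => p (t *: delta_mx i 0 + x)) -
     partial i p x \*: id)//.
  by apply/funext => s; rewrite mulrC.
have g0 : g 0 = p x by rewrite /g scale0r add0r mul0r subr0.
have -> : p (h *: e + x) - p x - h * partial i p x = g h - g 0 by rewrite g0 /g addrAC.
apply: (@le_trans _ _ ((k.+1 * k)%:R * b * r ^+ k.-1 * `|h| * `|h|)); last first.
  by rewrite -mulrA -expr2 real_normK ?num_real// mulrC.
apply: (mvt_bound gD) => s sh.
have sr := bounded_line xr hr sh.
have sh' : `|s| <= `|h|.
  case/orP: sh => /andP[s1 s2]; first by rewrite !ger0_norm// (le_trans s1).
  by rewrite !ler0_norm ?lerN2// (le_trans s1).
rewrite /dg; have p'H := hform_partial i pH.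
case: k pH p'H => [|k] pH p'H.
  case: p'H => c _ ->; rewrite subrr normr0.
  by rewrite muln0 !mul0r.
have L := is_derive_line x (fun y => is_derive_hform i y p'H).
have := @mvt_bound _ _ s (((k.+2 * k.+1)%:R * b * r ^+ k)) L; rewrite scale0r add0r => M.
apply: (le_trans (M _)) => [u us|]; last first.
  rewrite ler_wpM2l// ?mulr_ge0 ?exprn_ge0//; exact: (@hform_ge0 _ _ k.+2 _ _ pH).
have ur := bounded_line xr sr us.
apply: le_trans (hform_norm r0 (hform_partial i p'H) ur) _.
by rewrite natrM mulrA [_.+1%:R * _]mulrC.
Qed.

(** A smaller radius pays for the factor k + 1 brought by differentiation. *)
Lemma weight_le (r s : R) k : 0 <= s -> s <= r ->
  k.+1%:R * s ^+ k * (r - s) <= r ^+ k.+1.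
Proof.
move=> s0 sr; have r0 := le_trans s0 sr.
elim: k => [|k IHk]; first by rewrite expr0 !mul1r expr1 gerBl.
have sk : 0 <= s ^+ k by rewrite exprn_ge0.
have Hk : s ^+ k.+1 <= r ^+ k.+1 by rewrite ler_pXn2r// nnegrE.
have rs : 0 <= r - s by rewrite subr_ge0.
rewrite -[k.+2%:R]natr1 mulrDl mul1r mulrDl.
have -> : k.+1%:R * s ^+ k.+1 * (r - s) = s * (k.+1%:R * s ^+ k * (r - s)).
  by rewrite exprS; ring.
have -> : r ^+ k.+2 = s * r ^+ k.+1 + r ^+ k.+1 * (r - s) by rewrite exprS; ring.
by apply: lerD; [exact: ler_wpM2l|exact: ler_wpM2r].
Qed.

Definition summable_at (b : nat -> R) (r : R) :=
  exists M, forall N, \sum_(k < N) b k * r ^+ k <= M.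

Lemma summable_shift (b : nat -> R) (r s : R) : (forall k, 0 <= b k) ->
  0 <= s -> s < r -> summable_at b r ->
  summable_at (fun k => k.+1%:R * b k.+1) s.
Proof.
move=> b0 s0 sr [M bM]; have rs : 0 < r - s by rewrite subr_gt0.
exists (M / (r - s)) => N; rewrite ler_pdivlMr// mulr_suml.
apply: le_trans (bM N.+1); rewrite big_ord_recl.
apply: ler_wpDl; first by rewrite mulr1 b0.
apply: ler_sum => k _ /=; rewrite /bump/= add1n.
have := weight_le k s0 (ltW sr) => H.
have -> : k.+1%:R * b k.+1 * s ^+ k * (r - s) = b k.+1 * (k.+1%:R * s ^+ k * (r - s)) by ring.
exact: ler_wpM2l.
Qed.

Definition power_series f (p : nat -> 'cV[R]_n -> R) (r : R) :=
  [/\ 0 < r,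
      (exists b, (forall k, hform k (b k) (p k)) /\ summable_at b r) &
      forall x, (forall i, `|x i 0| < r) -> series (fun k => p k x) @ \oo --> f x].

Lemma cvg_le_bound (u : nat -> R) (l C : R) :
  u @ \oo --> l -> (forall N, `|u N| <= C) -> `|l| <= C.
Proof.
move=> /cvg_norm ul uC.
apply: (@closed_cvg _ _ \oo _ (fun N => `|u N|) [set y | y <= C] _ _ _ ul).
  exact: closed_le.
by near=> N; exact: uC.
Unshelve. all: end_near. Qed.

(** On a slightly larger polydisc the second-order remainders of the terms add up
    to O(h^2), so the difference quotients of the sum converge to the sum of the
    derivatives. *)
Lemma power_series_partial f (p : nat -> 'cV[R]_n -> R) r s i : power_series f p r -> 0 < s -> s < r ->
  power_series (partial i f) (fun k => partial i (p k.+1)) s.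
Proof.
move=> [r0 [b [pH bs]] pf] s0 sr.
(* s < t < u < r: the radius u is for the first derivatives and t for the second *)
pose u := (s + r) / 2; pose t := (s + u) / 2.
have su : s < u by rewrite /u; lra.
have ur : u < r by rewrite /u; lra.
have st : s < t by rewrite /t; lra.
have tu : t < u by rewrite /t; lra.
have b0 k : 0 <= b k by exact: hform_ge0 (pH k).
pose b1 k := k.+1%:R * b k.+1; pose b2 k := k.+1%:R * b1 k.+1.
have b10 k : 0 <= b1 k by rewrite mulr_ge0.
have b1s : summable_at b1 u by apply: summable_shift bs => //; lra.
have b1s' : summable_at b1 s by apply: summable_shift bs => //; lra.
have [M2 b2s] : summable_at b2 t by apply: summable_shift b1s => //; lra.
have p1H k : hform k (b1 k) (partial i (p k.+1)) by exact: hform_partial.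
have D x : (forall j, `|x j 0| < s) ->
    exists2 L, series (fun k => partial i (p k.+1) x) @ \oo --> L &
      is_derive x (delta_mx i 0 : 'cV[R]_n) f L.
  move=> xs; have xsb : bounded_by s x by move=> j; exact: ltW.
  have /cvg_ex[L SL] : cvgn (series (fun k => partial i (p k.+1) x)).
    apply: normed_cvg.
    apply: (@series_le_cvg _ _ (fun k => b1 k * s ^+ k)) => [k|k|k|].
    - exact: normr_ge0.
    - by rewrite mulr_ge0// exprn_ge0// ltW.
    - by apply: hform_norm => //; exact: ltW.
    apply: nondecreasing_is_cvgn.
      apply/nondecreasing_seqP => N; rewrite /series/= big_nat_recr//= lerDl.
      by rewrite mulr_ge0// exprn_ge0// ltW.
    have [M1 b1M] := b1s'; exists M1 => _ [N _ <-].
    by rewrite /series/= big_mkord; exact: b1M.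
  exists L => //; apply: (@is_derive_of_quadratic _ _ _ _ M2 (t - s)).
    by rewrite subr_gt0.
  move=> h ht; pose z := h *: delta_mx i 0 + x.
  have zt : bounded_by t z.
    move=> j; rewrite !mxE andbT; apply: (le_trans (ler_normD _ _)).
    have := xs j; have := ht; rewrite normrM.
    by case: (j == i); rewrite ?normr1 ?normr0 ?mulr1 ?mulr0 ?add0r; lra.
  have xt : bounded_by t x by move=> j; have := xs j; lra.
  have fz : series (fun k => p k z) @ \oo --> f z.
    by apply: pf => j; have := zt j; lra.
  have fx : series (fun k => p k x) @ \oo --> f x.
    by apply: pf => j; have := xs j; lra.
  pose S N := series (fun k => p k z) N.+2 - series (fun k => p k x) N.+2
     - h * series (fun k => partial i (p k.+1) x) N.+1.
  apply: (@cvg_le_bound S).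
    apply: cvgB; [apply: cvgB|].
    - by have := fz; rewrite -(cvg_shiftn 2) /=; under eq_fun do rewrite addn2.
    - by have := fx; rewrite -(cvg_shiftn 2) /=; under eq_fun do rewrite addn2.
    - apply: cvgMl_tmp.
      by have := SL; rewrite -(cvg_shiftn 1) /=; under eq_fun do rewrite addn1.
  move=> N; have -> : S N = \sum_(k < N.+2) (p k z - p k x - h * partial i (p k) x).
    rewrite /S /series/= !big_mkord !sumrB; congr (_ - _).
    rewrite mulr_sumr [RHS]big_ord_recl.
    have [c _ ->] := pH 0; rewrite /partial derive_cst mulr0 add0r.
    by [].
  apply: (le_trans (ler_norm_sum _ _ _)).
  apply: (@le_trans _ _ (\sum_(k < N.+2) h ^+ 2 * ((k * k.-1)%:R * b k * t ^+ k.-2))).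
    by apply: ler_sum => k _; apply: hform_remainder => //; lra.
  rewrite -mulr_sumr ler_wpM2l ?sqr_ge0//; apply: le_trans (b2s N).
  rewrite 2!big_ord_recl /= !(muln0, mul0n, mul0r, add0r).
  rewrite le_eqVlt; apply/orP; left; apply/eqP; apply: eq_bigr => k _.
  by rewrite /bump/= !add1n /= /b2 /b1 natrM; ring.
split => //; first by exists b1.
by move=> x xs; have [L SL LD] := D x xs; rewrite /partial derive_val.
Qed.

End TermwiseDerivative.

(** * Taylor coefficients of an analytic function *)

Section TaylorCoefficients.
Variables (R : realType) (n : nat).
Implicit Types (x y : 'cV[R]_n) (f : 'cV[R]_n -> R).

Lemma tensor_hform k (v : 'cV[R]_(n ^ k)) :
  hform k (\sum_j `|v j 0|) (fun x => dotv v (kronpow x k)).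
Proof.
elim: k v => [|k IHk] v.
  exists (v 0 0); first by rewrite big_ord1.
  by apply/funext => x; rewrite dotvE big_ord1 kronpow0 mxE mulr1.
have e : (n * n ^ k = n ^ k.+1)%N by rewrite expnS.
pose w i : 'cV[R]_(n ^ k) := \col_j v (cast_ord e (mxtens_index (i, j))) 0.
have reidx (F : 'I_(n ^ k.+1) -> R) :
    \sum_j F j = \sum_i \sum_j F (cast_ord e (mxtens_index (i, j))).
  rewrite pair_big /= (reindex (fun u : 'I_n * 'I_(n ^ k) => cast_ord e (mxtens_index u))) /=.
    by apply: eq_bigr => -[].
  exists (fun j => mxtens_unindex (cast_ord (esym e) j)) => j _.
    by rewrite cast_ordK mxtens_indexK.
  by rewrite mxtens_unindexK cast_ordKV.
exists (fun i => \sum_j `|w i j 0|), (fun i x => dotv (w i) (kronpow x k)); split.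
- by move=> i; exact: IHk.
- rewrite reidx le_eqVlt; apply/orP; left; apply/eqP.
  by apply: eq_bigr => i _; apply: eq_bigr => j _; rewrite mxE.
- apply/funext => x; rewrite dotvE reidx; apply: eq_bigr => i _.
  rewrite dotvE mulr_sumr; apply: eq_bigr => j _.
  by rewrite kronpowS (colcastE e) cast_ordK coltensE mxE mulrCA.
Qed.

Lemma norm_lt_coord x (r : R) : 0 < r -> (forall i, `|x i 0| < r) -> `|x| < r.
Proof.
move=> r0 xr; change (mx_norm x < r); have [->|x0] := eqVneq (mx_norm x) 0 => //.
by have [i ->] := mx_norm_neq0 x0; rewrite ord1.
Qed.

Lemma analytic_power_series f : analytic_at f 0 ->
  exists (c : forall k, 'cV[R]_(n ^ k)) r,
    power_series f (fun k x => dotv (c k) (kronpow x k)) r.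
Proof.
move=> [c [r [r0 cs fE]]]; exists c, r; split => //.
  exists (fun k => \sum_j `|c k j 0|); split; first by move=> k; exact: tensor_hform.
  exists (limn (series (fun k => (\sum_j `|c k j 0|) * r ^+ k))) => N.
  have nd : nondecreasing_seq (series (fun k => (\sum_j `|c k j 0|) * r ^+ k)).
    apply/nondecreasing_seqP => k; rewrite /series/= big_nat_recr//= lerDl.
    by rewrite mulr_ge0 ?exprn_ge0 ?sumr_ge0// ltW.
  have := nondecreasing_cvgn_le nd cs N.
  by rewrite [X in X <= _]/series/= big_mkord.
move=> x xr; have := fE x; rewrite subr0; apply.
exact: norm_lt_coord.
Qed.

(** For s Y < r the term of degree k >= N is at most (s Y / r)^N b_k r^k. *)
Lemma power_series_ray f p r : power_series f p r ->
  forall y N, exists C delta, 0 < delta /\ forall s : R, 0 < s -> s < delta ->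
    `|f (s *: y) - \sum_(k < N) s ^+ k * p k y| <= C * s ^+ N.
Proof.
move=> [r0 [b [pH [M bM]]] pf] y N.
pose Y := \sum_i `|y i 0| + 1.
have Y0 : 0 < Y by rewrite ltr_wpDl// sumr_ge0.
have yY i : `|y i 0| < Y.
  by rewrite ltr_pwDr// (bigD1 i)//= lerDl sumr_ge0.
have b0 k : 0 <= b k by exact: hform_ge0 (pH k).
exists ((Y / r) ^+ N * M), (r / Y); split; first by rewrite divr_gt0.
move=> s s0 sr; have sY : s * Y < r by rewrite -ltr_pdivlMr.
have fs : series (fun k => p k (s *: y)) @ \oo --> f (s *: y).
  apply: pf => i; rewrite mxE normrM gtr0_norm//; apply: le_lt_trans sY.
  by rewrite ler_wpM2l// ltW.
apply: (@cvg_le_bound _ (fun K => series (fun k => p k (s *: y)) (K + N)%N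
   - \sum_(k < N) s ^+ k * p k y)).
  apply: cvgB; last exact: cvg_cst.
  by have := fs; rewrite -(cvg_shiftn N).
move=> K; rewrite /series/= (@big_cat_nat _ _ _ N)//= ?leq_addl// big_mkord.
rewrite (eq_bigr (fun k : 'I_N => s ^+ k * p k y)); last first.
  by move=> k _; exact: hform_scale (pH k).
rewrite addrAC subrr add0r; apply: (le_trans (ler_norm_sum _ _ _)).
apply: (@le_trans _ _ (\sum_(N <= k < K + N) (s * Y / r) ^+ N * (b k * r ^+ k))).
  rewrite big_nat_cond [X in _ <= X]big_nat_cond.
  apply: ler_sum => k /andP[/andP[Nk _] _].
  have h : `|p k (s *: y)| <= b k * (s * Y) ^+ k.
    apply: (hform_norm _ (pH k)); first by rewrite mulr_ge0 ?ltW.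
    move=> i; rewrite mxE normrM gtr0_norm// ler_wpM2l// ltW//.
  apply: (le_trans h); rewrite mulrCA ler_wpM2l//.
  have q0 : 0 <= s * Y / r by rewrite divr_ge0 ?mulr_ge0// ltW.
  have q1 : s * Y / r <= 1 by rewrite ler_pdivrMr// mul1r ltW.
  have -> : (s * Y) ^+ k = (s * Y / r) ^+ k * r ^+ k.
    by rewrite -exprMn divfK// gt_eqF.
  apply: ler_wpM2r; first by rewrite exprn_ge0// ltW.
  by apply: ler_wiXn2l.
rewrite -mulr_sumr.
have -> : (Y / r) ^+ N * M * s ^+ N = (s * Y / r) ^+ N * M.
  by rewrite -mulrA [s * Y / r]mulrC -[s * Y]/(s * Y) !exprMn; ring.
apply: ler_wpM2l; first by rewrite exprn_ge0// divr_ge0 ?mulr_ge0// ltW.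
apply: le_trans (bM (K + N)%N); rewrite -(big_mkord xpredT (fun k => b k * r ^+ k)).
rewrite [X in _ <= X](@big_cat_nat _ _ _ N)//= ?leq_addl// lerDr sumr_ge0// => k _.
by rewrite mulr_ge0 ?exprn_ge0// ltW.
Qed.

Lemma power_series_value0 f p r : power_series f p r -> forall y, f 0 = p 0 y.
Proof.
move=> [r0 [b [pH _]] pf] y.
have : series (fun k => p k 0) @ \oo --> f 0 by apply: pf => i; rewrite mxE normr0.
rewrite -(cvg_shiftn 1) /=.
have E N : series (fun k => p k 0) (N + 1)%N = p 0 0.
  rewrite /series/= big_mkord addn1 big_ord_recl big1 ?addr0// => k _.
  by rewrite -(scale0r 0) (hform_scale 0 0 (pH _)) expr0n mul0r.
under eq_fun do rewrite E.
have -> : p 0 0 = p 0 y by have [c _ ->] := pH 0.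
move=> H; apply: (@cvg_unique _ _ ((fun=> p 0 y) @ \oo)) => //.
exact: cvg_cst.
Qed.

Lemma sum_tuple_rcons k (F : seq 'I_n -> R) :
  \sum_(s : k.+1.-tuple 'I_n) F s = \sum_(i < n) \sum_(s : k.-tuple 'I_n) F (rcons s i).
Proof.
rewrite exchange_big pair_big /=.
rewrite (reindex (fun u : k.-tuple 'I_n * 'I_n => [tuple of rcons u.1 u.2])) //=.
apply: onW_bij; apply: inj_card_bij.
  move=> [s i] [t j] /= /(congr1 val) /= /rcons_inj[st ij].
  by rewrite ij (val_inj st).
by rewrite card_prod !card_tuple card_ord expnSr.
Qed.

(** Euler's identity for the last differentiation gives the Taylor form of degree k
    from the one of degree k-1 of each partial derivative. *)
Lemma taylor_coefficient f p r k y : power_series f p r ->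
  (k`!%:R)^-1 * \sum_(s : k.-tuple 'I_n) foldr (@partial R n) f s 0 * \prod_(i <- s) y i 0
  = p k y.
Proof.
elim: k f p r => [|k IHk] f p r fp.
  rewrite fact0 invr1 mul1r (big_pred1 [tuple]); last first.
    by move=> s; apply/esym/eqP; exact: tuple0.
  by rewrite big_nil mulr1; exact: power_series_value0 fp y.
have [r0 [b [pH _]] _] := fp.
have r2 : 0 < r / 2 < r by lra.
case/andP: r2 => r2 r2r.
rewrite (sum_tuple_rcons k (fun s => foldr (@partial R n) f s 0 * \prod_(i <- s) y i 0)).
have k0 : (k.+1%:R : R) != 0 by rewrite pnatr_eq0.
apply: (mulfI k0); rewrite -(hform_euler y (pH k.+1)).
rewrite factS natrM invfM mulrA mulrA divff// mul1r mulr_sumr.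
apply: eq_bigr => i _.
rewrite -(IHk _ _ _ (power_series_partial i fp r2 r2r)) mulrCA; congr (_ * _).
rewrite mulr_sumr; apply: eq_bigr => s _.
by rewrite foldr_rcons big_rcons /= [X in _ * X = _]mulrC mulrCA.
Qed.

End TaylorCoefficients.

(** * Asymptotic equality at the origin *)

Section AsymptoticEquality.
Variables (R : realType) (M : nat).

(** F = G + O(s^M) as s tends to 0 from the right, with G bounded there; the
    boundedness makes the relation compatible with products. *)
Definition approx (F G : R -> R) := exists C B delta, 0 < delta /\
  forall s : R, 0 < s -> s < delta -> `|F s - G s| <= C * s ^+ M /\ `|G s| <= B.

Lemma approx_refl G B : (forall s : R, 0 < s -> s < 1 -> `|G s| <= B) -> approx G G.
Proof.
move=> GB; exists 0, B, 1; split => // s s0 s1; split; last exact: GB.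
by rewrite subrr normr0 mul0r.
Qed.

Lemma approx_cst c : approx (fun=> c) (fun=> c).
Proof. exact: (@approx_refl _ `|c|). Qed.

Lemma approx_pow k : approx (fun s => s ^+ k) (fun s => s ^+ k).
Proof.
apply: (@approx_refl _ 1) => s s0 s1; rewrite normrX gtr0_norm//.
by rewrite exprn_ile1// ltW.
Qed.

Lemma approxD F G F' G' : approx F G -> approx F' G' ->
  approx (fun s => F s + F' s) (fun s => G s + G' s).
Proof.
move=> [C [B [d [d0 FG]]]] [C' [B' [d' [d'0 FG']]]].
exists (C + C'), (B + B'), (Num.min d d'); split; first by rewrite lt_min d0.
move=> s s0; rewrite lt_min => /andP[sd sd'].
have [h1 h2] := FG s s0 sd; have [h3 h4] := FG' s s0 sd'; split.
  rewrite (_ : _ - _ = F s - G s + (F' s - G' s)); last by ring.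
  by rewrite mulrDl (le_trans (ler_normD _ _))// lerD.
by rewrite (le_trans (ler_normD _ _))// lerD.
Qed.

Lemma approxM F G F' G' : approx F G -> approx F' G' ->
  approx (fun s => F s * F' s) (fun s => G s * G' s).
Proof.
move=> [C [B [d [d0 FG]]]] [C' [B' [d' [d'0 FG']]]].
exists (`|C| * (`|C'| + `|B'|) + `|B| * `|C'|), (B * B'), (Num.min 1 (Num.min d d')).
split; first by rewrite !lt_min ltr01 d0.
move=> s s0; rewrite !lt_min => /andP[s1 /andP[sd sd']].
have [h1 h2] := FG s s0 sd; have [h3 h4] := FG' s s0 sd'; split; last first.
  by rewrite normrM ler_pM.
have sM0 : 0 <= s ^+ M by rewrite exprn_ge0// ltW.
have sM1 : s ^+ M <= 1 by rewrite exprn_ile1// ltW.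
have h1' : `|F s - G s| <= `|C| * s ^+ M.
  by rewrite (le_trans h1)// ler_wpM2r// ler_norm.
have h3' : `|F' s - G' s| <= `|C'| * s ^+ M.
  by rewrite (le_trans h3)// ler_wpM2r// ler_norm.
have h5 : `|F' s| <= `|C'| + `|B'|.
  rewrite -[F' s](subrK (G' s)) (le_trans (ler_normD _ _))// lerD//.
    by rewrite (le_trans h3')// -[X in _ <= X]mulr1 ler_wpM2l.
  by rewrite (le_trans h4)// ler_norm.
have -> : F s * F' s - G s * G' s = (F s - G s) * F' s + G s * (F' s - G' s) by ring.
rewrite (le_trans (ler_normD _ _))// !normrM mulrDl lerD//.
  by rewrite mulrAC ler_pM.
by rewrite -mulrA ler_pM// (le_trans h2)// ler_norm.
Qed.

Lemma approx_sum (I : Type) (r : seq I) (P : pred I) (F G : I -> R -> R) :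
  (forall i, P i -> approx (F i) (G i)) ->
  approx (fun s => \sum_(i <- r | P i) F i s) (fun s => \sum_(i <- r | P i) G i s).
Proof.
move=> FG; elim: r => [|i r IHr].
  by under eq_fun do rewrite big_nil; under [X in approx _ X]eq_fun do rewrite big_nil;
    exact: approx_cst.
under eq_fun do rewrite big_cons; under [X in approx _ X]eq_fun do rewrite big_cons.
by case Pi: (P i) => //; apply: approxD => //; exact: FG.
Qed.

Lemma poly_bounded (P : {poly R}) : exists B, forall s : R, 0 < s -> s < 1 ->
  `|P.[s]| <= B.
Proof.
exists (\sum_(i < size P) `|P`_i|) => s s0 s1; rewrite horner_coef.
apply: (le_trans (ler_norm_sum _ _ _)); apply: ler_sum => i _.
rewrite normrM normrX (gtr0_norm s0) -[X in _ <= X]mulr1 ler_wpM2l//.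
by rewrite exprn_ile1// ltW.
Qed.

(** If the coefficients below k vanish, then P is X^k Q with Q(s) = O(s). *)
Lemma approx0_coef (P : {poly R}) : approx (fun=> 0) (fun s => P.[s]) ->
  forall k, (k < M)%N -> P`_k = 0.
Proof.
move=> [C [B0 [d [d0 PC]]]]; elim/ltn_ind => k IHk kM.
pose Q := drop_poly k P.
have PE : P = Q * 'X^k.
  rewrite -[LHS](poly_take_drop k P) (_ : take_poly k P = 0) ?add0r//.
  apply/polyP => i; rewrite coef_take_poly coef0; case: ifP => // ik.
  by apply: IHk => //; exact: ltn_trans kM.
have -> : P`_k = Q`_0 by rewrite coef_drop_poly add0n.
pose Q' := drop_poly 1 Q.
have QE : Q = Q' * 'X + (Q`_0)%:P.
  rewrite -[LHS](poly_take_drop 1 Q) expr1 addrC; congr (_ + _).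
  by apply/polyP => i; rewrite coef_take_poly coefC; case: i.
have [B QB] := poly_bounded Q'.
have Qs s : 0 < s -> s < Num.min 1 d -> `|Q`_0| <= (`|C| + `|B|) * s.
  move=> s0; rewrite lt_min => /andP[s1 sd].
  have [h _] := PC s s0 sd; rewrite sub0r normrN in h.
  have sk : 0 < s ^+ k by rewrite exprn_gt0.
  have h1 : `|Q.[s]| <= `|C| * s.
    rewrite -(ler_pM2r sk) -{1}[s ^+ k]gtr0_norm// -normrM.
    have -> : Q.[s] * s ^+ k = P.[s] by rewrite PE hornerM hornerXn.
    apply: (le_trans h); rewrite -mulrA -exprS.
    have sMk : s ^+ M <= s ^+ k.+1 by apply: ler_wiXn2l => //; exact: ltW.
    have sM0 : 0 <= s ^+ M by rewrite exprn_ge0// ltW.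
    apply: (@le_trans _ _ (`|C| * s ^+ M)); first by rewrite ler_wpM2r// ler_norm.
    exact: ler_wpM2l.
  have -> : Q`_0 = Q.[s] - Q'.[s] * s.
    by rewrite {2}QE hornerD hornerMX hornerC addrC addKr.
  rewrite (le_trans (ler_normB _ _))// mulrDl lerD// normrM (gtr0_norm s0).
  by apply: ler_wpM2r; [exact: ltW|exact: le_trans (QB s s0 s1) (ler_norm _)].
apply/eqP; rewrite -normr_eq0 eq_le normr_ge0 andbT leNgt; apply/negP => Q0.
pose K := `|C| + `|B| + 1.
have K0 : 0 < K by rewrite ltr_wpDl// addr_ge0.
pose s := Num.min (Num.min 1 d) (`|Q`_0| / K) / 2.
have m0 : 0 < Num.min (Num.min 1 d) (`|Q`_0| / K) by rewrite !lt_min ltr01 d0 divr_gt0.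
have s0 : 0 < s by rewrite divr_gt0.
have sm : s < Num.min (Num.min 1 d) (`|Q`_0| / K) by rewrite /s; lra.
move: sm; rewrite lt_min => /andP[sm sK].
have := Qs s s0 sm; rewrite ltr_pdivlMr// in sK; rewrite leNgt => /negP; apply.
apply: le_lt_trans sK; rewrite mulrC; apply: ler_wpM2l; first exact: ltW.
by rewrite lerDl.
Qed.

End AsymptoticEquality.

(** * Homogeneous parts of the dynamics and of the penalty *)

Section Homogeneity.
Variables (R : realType) (n m l : nat) (lam : int).
Variables (A : 'M[R]_n) (F : forall p, 'M[R]_(n, n ^ p)).
Variables (B : 'M[R]_(n, m)) (G : forall p, 'M[R]_(n, n ^ p * m)).
Variables (Q : 'M[R]_n) (Rw : 'M[R]_m) (q : forall p, 'cV[R]_(n ^ p)).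
Implicit Types (x y : 'cV[R]_n).

Lemma coltensZ a b N1 N2 (u : 'cV[R]_N1) (w : 'cV[R]_N2) :
  coltens (a *: u) (b *: w) = (a * b) *: coltens u w.
Proof. by apply/matrixP => i j; rewrite !mxE mulrACA. Qed.

Lemma kronpow_scale s k x : kronpow (s *: x) k = s ^+ k *: kronpow x k.
Proof.
elim: k => [|k IHk]; first by rewrite expr0 scale1r !kronpow0.
have e : (n * n ^ k = n ^ k.+1)%N by rewrite expnS.
by rewrite !kronpowS IHk coltensZ -exprS retypeZ.
Qed.

Definition fpart p x : 'cV[R]_n :=
  match p with 0 => 0 | 1 => A *m x | _ => Fext l F p *m kronpow x p end.

Definition penpart p x : R :=
  match p with
  | 0 | 1 => 0 | 2 => qform Q x | _ => dotv (qext lam q p) (kronpow x p)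
  end.

Lemma fdyn_scale M s x : (l.+1 <= M)%N -> (1 < M)%N ->
  fdyn l A F (s *: x) = \sum_(p < M) s ^+ p *: fpart p x.
Proof.
move=> lM M1; rewrite /fdyn (@sum_nat_ord _ _ _ M)// -scalemxAr.
have -> : s *: (A *m x) = \sum_(p < M) if (p == 1%N :> nat) && true then s ^+ p *: (A *m x) else 0.
  by rewrite (@sum_ord_delta _ M 1%N true (fun p => s ^+ p *: (A *m x)))//; left.
rewrite -big_split; apply: eq_bigr => p _ /=.
case: (p : nat) => [|[|k]] /=; rewrite ?scaler0 ?addr0 ?add0r//.
rewrite andbT /Fext ltnS; case: ifP => _; last by rewrite mul0mx scaler0.
by rewrite kronpow_scale -scalemxAr.
Qed.

Lemma gdyn_scale M s x : (l.+1 <= M)%N ->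
  gdyn l B G (s *: x) = \sum_(p < M) s ^+ p *: gpart l B G p x.
Proof.
move=> lM; rewrite /gdyn (@sum_nat_ord _ _ _ M)//.
have {1}-> : B = \sum_(p < M) if (p == 0%N :> nat) && true then B else 0.
  by rewrite (@sum_ord_delta _ M 0%N true (fun=> B))//; left; lia.
rewrite -big_split; apply: eq_bigr => p _ /=.
have gE k : gpart l B G k.+1 x = if (k < l)%N then
    G k.+1 *m retype (n ^ k.+1 * m) m (kronpow x k.+1 *t (1%:M : 'M[R]_m)) else 0.
  by rewrite /gpart /Gext /=; case: ifP => // _; rewrite mul0mx.
case: (p : nat) => [|k] /=; first by rewrite addr0 expr0 scale1r gpart0.
rewrite gE ltnS andbT; case: ifP => _; last by rewrite scaler0 addr0.
rewrite add0r kronpow_scale scalemxAr; congr (_ *m _).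
have -> : (s ^+ k.+1 *: kronpow x k.+1) *t (1%:M : 'M[R]_m) =
    s ^+ k.+1 *: (kronpow x k.+1 *t (1%:M : 'M[R]_m)).
  by apply/matrixP => i j; rewrite !mxE mulrA.
by rewrite (retypeZ _ _ erefl (mul1n m)).
Qed.

Lemma state_penalty_scale M s x : (`|lam|%N < M)%N -> (2 < M)%N ->
  state_penalty lam Q q (s *: x) = \sum_(p < M) s ^+ p * penpart p x.
Proof.
move=> lM M2; rewrite /state_penalty (@sum_nat_ord _ _ _ M)//.
have -> : qform Q (s *: x) =
    \sum_(p < M) if (p == 2%N :> nat) && true then s ^+ p * qform Q x else 0.
  rewrite (@sum_ord_delta _ M 2%N true (fun p => s ^+ p * qform Q x))//; last by left.
  have xT : (s *: x)^T = s *: x^T by rewrite linearZ.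
  by rewrite /qform xT -!scalemxAl -scalemxAr scalerA [LHS]mxE expr2.
rewrite -big_split; apply: eq_bigr => p _ /=.
case: (p : nat) => [|[|[|k]]] /=; rewrite ?mulr0 ?addr0 ?add0r//.
rewrite /qext; case: ifP => h.
  rewrite ifT; last by move/andP: h => [_ ->].
  by rewrite kronpow_scale -scalemxAr mxE.
rewrite ifF ?dotv0l ?mulr0//; apply/negP => k3; move: h; rewrite k3 andbT ltnS.
have -> // : (k.+3 <= `|lam|)%N.
by move: k3; case: lam => // a; rewrite lez_nat absz_nat.
Qed.

End Homogeneity.

(** * Coefficients of the Hamilton-Jacobi-Bellman equation *)

Section HJBCoefficients.
Variables (R : realType) (n m l : nat) (lam : int).
Variables (A : 'M[R]_n) (F : forall p, 'M[R]_(n, n ^ p)).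
Variables (B : 'M[R]_(n, m)) (G : forall p, 'M[R]_(n, n ^ p * m)).
Variables (Q : 'M[R]_n) (Rw : 'M[R]_m) (q : forall p, 'cV[R]_(n ^ p)).
Variables (V : 'cV[R]_n -> R) (p : nat -> 'cV[R]_n -> R) (r : R).
Hypothesis Vp : power_series V p r.
Implicit Types (x y : 'cV[R]_n).

Definition approxv M N (u w : R -> 'cV[R]_N) :=
  forall i, approx M (fun s => u s i 0) (fun s => w s i 0).

Lemma approxv_mulmx M N1 N2 (K : R -> 'M[R]_(N1, N2)) (u w : R -> 'cV[R]_N2) :
  (forall i j, approx M (fun s => K s i j) (fun s => K s i j)) ->
  approxv M u w -> approxv M (fun s => K s *m u s) (fun s => K s *m w s).
Proof.
move=> KK uw i; under eq_fun do rewrite mxE; under [X in approx _ _ X]eq_fun do rewrite mxE.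
by apply: approx_sum => j _; apply: approxM => //; exact: uw.
Qed.

Lemma approx_dotv M N (u w u' w' : R -> 'cV[R]_N) :
  approxv M u w -> approxv M u' w' ->
  approx M (fun s => dotv (u s) (u' s)) (fun s => dotv (w s) (w' s)).
Proof.
move=> uw uw'; under eq_fun do rewrite dotvE; under [X in approx _ _ X]eq_fun do rewrite dotvE.
by apply: approx_sum => j _; apply: approxM; [exact: uw|exact: uw'].
Qed.

Lemma approx_powsum M N (a : nat -> R) :
  approx M (fun s => \sum_(k < N) s ^+ k * a k) (fun s => \sum_(k < N) s ^+ k * a k).
Proof.
apply: approx_sum => k _; apply: approxM; [exact: approx_pow|exact: approx_cst].
Qed.

Definition gradpart i y : 'cV[R]_n := grad (p i) y.

Let gradsum M y (s : R) : 'cV[R]_n := \sum_(i < M) s ^+ i *: gradpart i y.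

(** The factor s lets the gradient of the part of degree i enter with s^i. *)
Lemma approx_grad M y :
  approxv M.+1 (fun s => s *: grad V (s *: y)) (gradsum M.+1 y).
Proof.
move=> c; have [r0 [b [pH _]] _] := Vp.
have [r2 r2r] : 0 < r / 2 /\ r / 2 < r by split; lra.
have [C [d [d0 H]]] := power_series_ray (power_series_partial c Vp r2 r2r) y M.
have E s : gradsum M.+1 y s c 0 = s * \sum_(k < M) s ^+ k * partial c (p k.+1) y.
  rewrite /gradsum summxE big_ord_recl !mxE.
  have [c0 _ ->] := pH 0; rewrite /partial derive_cst mulr0 add0r mulr_sumr.
  by apply: eq_bigr => k _; rewrite !mxE /bump/= ?add1n exprS mulrA.
have bdd := approx_powsum M.+1 M (fun k => partial c (p k.+1) y).
have bdd2 := approxM (approx_pow R M.+1 1) bdd.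
have [C2 [B2 [d2 [d20 H2]]]] := bdd2.
exists C, B2, (Num.min d d2); split; first by rewrite lt_min d0.
move=> s s0; rewrite lt_min => /andP[sd sd2]; rewrite E; split; last first.
  by have [_] := H2 s s0 sd2; rewrite expr1.
rewrite !mxE -mulrBr normrM gtr0_norm// exprS mulrCA.
by apply: ler_wpM2l; [exact: ltW|exact: H].
Qed.

Definition hjbquad p1 p2 i j y : R :=
  dotv ((gpart l B G p1 y)^T *m gradpart i y)
    (invmx Rw *m ((gpart l B G p2 y)^T *m gradpart j y)).

Lemma hjb_expand M y s : (l.+1 <= M)%N -> (1 < M)%N ->
  s * dotv (gradsum M y s) (fdyn l A F (s *: y)) =
  \sum_(i < M) \sum_(j < M) s ^+ (i + j).+1 * dotv (gradpart i y) (fpart l A F j y).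
Proof.
move=> lM M1; rewrite (fdyn_scale A F s y lM M1) /gradsum dotv_suml mulr_sumr.
apply: eq_bigr => i _; rewrite dotv_sumr mulr_sumr; apply: eq_bigr => j _.
by rewrite dotvZl dotvZr exprS exprD; ring.
Qed.

Lemma hjb_expand_quad M y s : (l.+1 <= M)%N ->
  dotv ((gdyn l B G (s *: y))^T *m gradsum M y s)
       (invmx Rw *m ((gdyn l B G (s *: y))^T *m gradsum M y s)) =
  sum4 M (fun p1 p2 i j => s ^+ (p1 + p2 + (i + j)) * hjbquad p1 p2 i j y).
Proof.
move=> lM.
have E : (gdyn l B G (s *: y))^T *m gradsum M y s =
    \sum_(p1 < M) \sum_(i < M) s ^+ (p1 + i) *: ((gpart l B G p1 y)^T *m gradpart i y).
  have -> : (gdyn l B G (s *: y))^T = \sum_(p1 < M) s ^+ p1 *: (gpart l B G p1 y)^T.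
    rewrite (gdyn_scale B G s y lM); apply/matrixP => a b; rewrite !(mxE, summxE).
    by apply: eq_bigr => p1 _; rewrite !mxE.
  rewrite mulmx_suml; apply: eq_bigr => p1 _.
  rewrite /gradsum mulmx_sumr; apply: eq_bigr => i _.
  by rewrite -scalemxAl -scalemxAr scalerA exprD.
set Z := invmx Rw *m _; rewrite E dotv_suml; apply: eq_bigr => p1 _.
rewrite dotv_suml.
transitivity (\sum_(i < M) \sum_(p2 < M) \sum_(j < M)
    s ^+ (p1 + p2 + (i + j)) * hjbquad p1 p2 i j y); last by rewrite exchange_big.
apply: eq_bigr => i _; rewrite /Z E mulmx_sumr dotv_sumr; apply: eq_bigr => p2 _.
rewrite mulmx_sumr dotv_sumr; apply: eq_bigr => j _.
by rewrite -scalemxAr dotvZl dotvZr /hjbquad !exprD; ring.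
Qed.

(** On the ray s y both sides of the equation, multiplied by s^2, agree up to
    O(s^M) with a polynomial in s, whose coefficients below M therefore vanish; this
    is the coefficient of s^(k+2). *)
Lemma hjb_coef M k y : (\forall x \near (0 : 'cV[R]_n), hjb_at l lam A F B G Q Rw q V x) ->
  (l.+1 <= M)%N -> (`|lam|%N < M)%N -> (k.+2 < M)%N ->
  \sum_(i < M) \sum_(j < M)
      (if (i + j == k.+1)%N then dotv (gradpart i y) (fpart l A F j y) else 0)
  - 2^-1 * sum4 M (fun p1 p2 i j =>
      if (p1 + p2 + (i + j) == k.+2)%N then hjbquad p1 p2 i j y else 0)
  + 2^-1 * penpart lam Q q k y = 0.
Proof.
move=> hjb lM lamM kM; have M1 : (1 < M)%N by lia.
have M2 : (2 < M)%N by lia.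
pose P : {poly R} :=
  \sum_(i < M) \sum_(j < M) dotv (gradpart i y) (fpart l A F j y) *: 'X^((i + j).+1)
  - 2^-1 *: (\sum_(p1 < M) \sum_(p2 < M) \sum_(i < M) \sum_(j < M)
       hjbquad p1 p2 i j y *: 'X^(p1 + p2 + (i + j)))
  + 2^-1 *: (\sum_(j < M) penpart lam Q q j y *: 'X^(j.+2)).
have PE s : P.[s] = s * dotv (gradsum M y s) (fdyn l A F (s *: y))
    - 2^-1 * dotv ((gdyn l B G (s *: y))^T *m gradsum M y s)
       (invmx Rw *m ((gdyn l B G (s *: y))^T *m gradsum M y s))
    + 2^-1 * (s ^+ 2 * state_penalty lam Q q (s *: y)).
  rewrite hjb_expand// hjb_expand_quad// (state_penalty_scale Q q s y lamM M2).
  rewrite /P hornerD hornerD hornerN !hornerZ !horner_sum; congr (_ - _ * _ + _ * _).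
  - apply: eq_bigr => i _; rewrite horner_sum; apply: eq_bigr => j _.
    by rewrite hornerZ hornerXn mulrC.
  - apply: eq_bigr => p1 _; rewrite horner_sum; apply: eq_bigr => p2 _.
    rewrite horner_sum; apply: eq_bigr => i _; rewrite horner_sum; apply: eq_bigr => j _.
    by rewrite hornerZ hornerXn mulrC.
  - rewrite mulr_sumr; apply: eq_bigr => j _.
    by rewrite hornerZ hornerXn -[j.+2]add2n exprD; ring.
have Pcoef : P`_(k.+2) = \sum_(i < M) \sum_(j < M)
      (if (i + j == k.+1)%N then dotv (gradpart i y) (fpart l A F j y) else 0)
  - 2^-1 * sum4 M (fun p1 p2 i j =>
      if (p1 + p2 + (i + j) == k.+2)%N then hjbquad p1 p2 i j y else 0)
  + 2^-1 * penpart lam Q q k y.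
  have ifE (a b : nat) (c : R) : c * (a == b)%:R = if b == a then c else 0.
    by rewrite eq_sym; case: eqP => _; rewrite ?mulr1 ?mulr0.
  rewrite /P coefD coefB !coefZ !coef_sum; congr (_ - _ * _ + _ * _).
  - apply: eq_bigr => i _; rewrite coef_sum; apply: eq_bigr => j _.
    by rewrite coefZ coefXn ifE eqSS.
  - apply: eq_bigr => p1 _; rewrite coef_sum; apply: eq_bigr => p2 _.
    rewrite coef_sum; apply: eq_bigr => i _; rewrite coef_sum; apply: eq_bigr => j _.
    by rewrite coefZ coefXn ifE.
  - transitivity (\sum_(j < M) if (j == k :> nat) && true then penpart lam Q q j y else 0).
      by apply: eq_bigr => j _; rewrite coefZ coefXn ifE !eqSS andbT.
    rewrite (@sum_ord_delta _ M k true (fun j => penpart lam Q q j y))//; left; lia.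
rewrite -Pcoef; apply: (@approx0_coef R M); last exact: kM.
pose E (u : R -> 'cV[R]_n) s := s * dotv (u s) (fdyn l A F (s *: y))
    - 2^-1 * dotv ((gdyn l B G (s *: y))^T *m u s)
       (invmx Rw *m ((gdyn l B G (s *: y))^T *m u s))
    + 2^-1 * (s ^+ 2 * state_penalty lam Q q (s *: y)).
have appE : approx M (E (fun s => s *: grad V (s *: y))) (fun s => P.[s]).
  have -> : (fun s => P.[s]) = E (gradsum M y) by apply/funext => s; exact: PE.
  have gu : approxv M (fun s => s *: grad V (s *: y)) (gradsum M y).
    by case: (M) M1 => // M' _; exact: approx_grad.
  have fu : approxv M (fun s => fdyn l A F (s *: y)) (fun s => fdyn l A F (s *: y)).
    move=> c; rewrite (_ : (fun s => _) = (fun s => \sum_(j < M) s ^+ j * fpart l A F j y c 0)).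
      exact: (approx_powsum M M (fun j => fpart l A F j y c 0)).
    apply/funext => s; rewrite (fdyn_scale A F s y lM M1) summxE.
    by apply: eq_bigr => j _; rewrite mxE.
  have Gu c e : approx M (fun s => (gdyn l B G (s *: y))^T c e)
      (fun s => (gdyn l B G (s *: y))^T c e).
    rewrite (_ : (fun s => _) = (fun s => \sum_(j < M) s ^+ j * gpart l B G j y e c)).
      exact: (approx_powsum M M (fun j => gpart l B G j y e c)).
    apply/funext => s; rewrite (gdyn_scale B G s y lM) mxE summxE.
    by apply: eq_bigr => j _; rewrite mxE.
  have gGu := approxv_mulmx Gu gu.
  have Ru c e : approx M (fun=> invmx Rw c e) (fun=> invmx Rw c e) by exact: approx_cst.
  have RGu := approxv_mulmx (K := fun=> invmx Rw) Ru gGu.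
  have q1 := approxM (approx_pow R M 1) (approx_dotv gu fu).
  have q2 := approxM (approx_cst M (- 2^-1)) (approx_dotv gGu RGu).
  have pu : approx M (fun s => state_penalty lam Q q (s *: y))
      (fun s => state_penalty lam Q q (s *: y)).
    rewrite (_ : (fun s => _) = (fun s => \sum_(j < M) s ^+ j * penpart lam Q q j y)).
      exact: (approx_powsum M M (fun j => penpart lam Q q j y)).
    by apply/funext => s; rewrite (state_penalty_scale Q q s y lamM M2).
  have q3 := approxM (approx_cst M 2^-1) (approxM (approx_pow R M 2) pu).
  have := approxD (approxD q1 q2) q3; rewrite /E.
  under eq_fun do rewrite expr1 mulNr; under [X in approx _ _ X]eq_fun do rewrite expr1 mulNr.
  exact.
have [C [Bd [d [d0 H]]]] := appE.
have [d' d'0 hjb'] : exists2 d' : R, 0 < d' & forall s : R, 0 < s -> s < d' ->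
    hjb_at l lam A F B G Q Rw q V (s *: y).
  move: hjb => /nbhs_ballP[e /= e0 he].
  exists (e / (`|y| + 1)); first by rewrite divr_gt0// ltr_wpDl.
  move=> s s0 sd; apply: he; rewrite -ball_normE /= sub0r normrN normrZ gtr0_norm//.
  have y1 : 0 < `|y| + 1 by rewrite ltr_wpDl.
  rewrite ltr_pdivlMr// in sd; apply: le_lt_trans sd.
  by apply: ler_wpM2l; [exact: ltW|rewrite lerDl].
exists C, Bd, (Num.min d d'); split; first by rewrite lt_min d0.
move=> s s0; rewrite lt_min => /andP[sd sd']; have [h1 h2] := H s s0 sd; split => //.
suff E0 : E (fun s => s *: grad V (s *: y)) s = 0 by rewrite -{1}E0.
have := hjb' s s0 sd'; rewrite /hjb_at => /esym hj.
rewrite /E -scalemxAr -scalemxAr !dotvZl dotvZr.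
set gV := grad V (s *: y) in hj *; set gs := gdyn l B G (s *: y) in hj *.
set fs := fdyn l A F (s *: y) in hj *.
have d1 : dotv gV fs = (gV^T *m fs) 0 0 by [].
have d2 : dotv (gs^T *m gV) (invmx Rw *m (gs^T *m gV)) =
    (gV^T *m gs *m invmx Rw *m gs^T *m gV) 0 0.
  by rewrite /dotv trmx_mul trmxK !mulmxA.
rewrite d1 d2; rewrite -[RHS](mulr0 (s ^+ 2)) -hj; ring.
Qed.

End HJBCoefficients.

(** * The recursion for the coefficients of the value function *)

Section Gradients.
Variables (R : realType) (n : nat).
Implicit Types (x y z : 'cV[R]_n).

Lemma dkronpow_lin k y z :
  dkronpow k y z = \sum_a z a 0 *: dkronpow k y (delta_mx a 0).
Proof.
elim: k => [|k IHk].
  by rewrite /dkronpow big_ord0 big1// => a _; rewrite ?big_ord0 scaler0.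
have e : (n * n ^ k = n ^ k.+1)%N by rewrite expnS.
rewrite dkronpowS; under eq_bigr do rewrite dkronpowS -retypeZ//.
rewrite -retype_sum; congr (retype _ _ _).
apply/matrixP => i j; rewrite ord1 summxE; case: (mxtens_indexP i) => a b.
have addE (u w : 'cV[R]_(n * n ^ k)) t : (u + w) t 0 = u t 0 + w t 0 by rewrite mxE.
have scaleE N (s : R) (u : 'cV[R]_N) t : (s *: u) t 0 = s * u t 0 by rewrite mxE.
rewrite addE !coltensE IHk summxE.
under eq_bigr do rewrite scaleE; under [RHS]eq_bigr do rewrite scaleE addE !coltensE mulrDr.
rewrite big_split /=; congr (_ + _).
  rewrite (bigD1 a)//= !mxE !eqxx mul1r big1 ?addr0// => c ca.
  by rewrite mxE eq_sym (negbTE ca) mul0r mulr0.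
by rewrite mulr_sumr; apply: eq_bigr => c _; ring.
Qed.

Lemma grad_form k (u : 'cV[R]_(n ^ k)) (f : 'cV[R]_n -> R) y z :
  f = (fun x => dotv u (kronpow x k)) ->
  dotv (grad f y) z = dotv u (dkronpow k y z).
Proof.
move=> ->; rewrite dkronpow_lin dotv_sumr dotvE; apply: eq_bigr => a _.
rewrite dotvZr mulrC mxE; congr (_ * _).
by have D := is_derive_form u y (delta_mx a 0); rewrite /partial derive_val.
Qed.

Lemma eq_dotv (u w : 'cV[R]_n) : (forall z, dotv u z = dotv w z) -> u = w.
Proof. by move=> uw; apply/matrixP => i j; rewrite ord1 -!dotv_delta uw. Qed.

Lemma grad_symmetric_form k (u : 'cV[R]_(n ^ k)) (f : 'cV[R]_n -> R) y :
  (0 < k)%N -> tensor_symmetric u -> f = (fun x => 2^-1 * dotv u (kronpow x k)) ->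
  grad f y = (2^-1 * k%:R) *: (unfold u *m kronpow y k.-1).
Proof.
move=> k0 usym fE; apply: eq_dotv => z.
rewrite (@grad_form k (2^-1 *: u)); last first.
  by rewrite fE; apply/funext => x; rewrite dotvZl.
by rewrite !dotvZl /dkronpow dotv_sumr symmetric_dkronpow// mulrA.
Qed.

Lemma kronpow2 x : kronpow x 2 = x *v x.
Proof.
rewrite kronpowS kronpow1 (coltens_retyper _ _ (esym (expn1 n))).
by rewrite retype_retype ?expn1//; exact: retype_id.
Qed.

Lemma dkronpow2 y z : dkronpow 2 y z = z *v y + y *v z.
Proof.
have e : (n = n ^ 1)%N by rewrite expn1.
have d1 : dkronpow 1 y z = retype (n ^ 1) 1 z.
  rewrite dkronpowS /dkronpow big_ord0 kronpow0 coltens1r.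
  have -> : y *v (0 : 'cV[R]_(n ^ 0)) = 0.
    by apply/matrixP => i j; rewrite !mxE mulr0.
  by rewrite addr0 retype_retype ?muln1.
rewrite dkronpowS d1 kronpow1 !(coltens_retyper _ _ e).
by rewrite -retypeD retype_retype//; exact: retype_id.
Qed.

Lemma qform_eq0 (N : 'M[R]_n) : symmetric_mx N -> (forall y, qform N y = 0) -> N = 0.
Proof.
move=> Nsym N0; have Npsd : psd N by move=> y; rewrite N0.
apply/matrixP => i j; have /matrixP/(_ i 0) : N *m delta_mx j 0 = 0 :> 'cV[R]_n.
  by apply: psd_qform_eq0 => //; rewrite N0.
by rewrite -colE !mxE.
Qed.

End Gradients.

Section ValueFunction.
Variables (R : realType) (n m l d : nat) (lam : int).
Variables (A : 'M[R]_n) (F : forall p, 'M[R]_(n, n ^ p)).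
Variables (B : 'M[R]_(n, m)) (G : forall p, 'M[R]_(n, n ^ p * m)).
Variables (Q : 'M[R]_n) (Rw : 'M[R]_m) (q : forall p, 'cV[R]_(n ^ p)).
Variables (V : 'cV[R]_n -> R) (c : forall k, 'cV[R]_(n ^ k)) (r : R).
Local Notation p := (fun k x => dotv (c k) (kronpow x k)).
Hypotheses (Q_sym : symmetric_mx Q) (Rw_sym : symmetric_mx Rw).
Hypothesis Vp : power_series V p r.
Hypothesis V_hjb : \forall x \near (0 : 'cV[R]_n), hjb_at l lam A F B G Q Rw q V x.
Implicit Types (x y z : 'cV[R]_n).

Lemma taylor_power_series x : taylor d V x = \sum_(k < d.+1) p k x.
Proof. by apply: eq_bigr => k _; rewrite (taylor_coefficient _ _ Vp). Qed.

(** Along the ray s y, the value is s^2 times the quadratic part up to O(s^3). *)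
Lemma power_series_quadratic_ge0 : (forall x, p 0 x = 0) -> (forall x, p 1 x = 0) ->
  (\forall x \near (0 : 'cV[R]_n), 0 <= V x) -> forall y, 0 <= p 2 y.
Proof.
move=> p0 p1 V0 y; have [C [e [e0 H]]] := power_series_ray Vp y 3.
move: V0 => /nbhs_ballP[e' /= e'0 V0].
rewrite leNgt; apply/negP => p2.
have y1 : 0 < `|y| + 1 by rewrite ltr_wpDl.
have C1 : 0 < `|C| + 1 by rewrite ltr_wpDl.
pose K := Num.min (Num.min e (e' / (`|y| + 1))) (- p 2 y / (`|C| + 1)).
have K0 : 0 < K by rewrite !lt_min e0 !divr_gt0// oppr_gt0.
have s0 : 0 < K / 2 by rewrite divr_gt0.
have sK : K / 2 < K by lra.
move: (K / 2) s0 sK => s s0; rewrite !lt_min => /andP[/andP[se se'] sC].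
rewrite ltr_pdivlMr// in se'; rewrite ltr_pdivlMr// in sC.
have := H s s0 se; rewrite !big_ord_recl big_ord0 /= /bump/= p0 p1 !mulr0 !add0r addr0.
rewrite ler_norml => /andP[_ h].
have Vs : 0 <= V (s *: y).
  apply: V0; rewrite -ball_normE /= sub0r normrN normrZ gtr0_norm//.
  apply: le_lt_trans se'; apply: ler_wpM2l; [exact: ltW|by rewrite lerDl].
have s2 : 0 < s ^+ 2 by rewrite exprn_gt0.
have h1 : - p 2 y * s ^+ 2 <= C * s * s ^+ 2 by move: h; rewrite exprSr; lra.
rewrite ler_pM2r// in h1.
have : C * s <= s * (`|C| + 1).
  by rewrite mulrC ler_wpM2l ?(ltW s0)// (le_trans (ler_norm _))// lerDl.
move=> h2; have := lt_le_trans sC (le_trans h1 h2); by rewrite ltxx.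
Qed.

(** The symmetric matrix P such that V is x^T P x / 2 to second order. *)
Definition hessian0 : 'M[R]_n := unvec (c 2) + (unvec (c 2))^T.

Lemma hessian0_sym : symmetric_mx hessian0.
Proof. by rewrite /symmetric_mx /hessian0 linearD/= trmxK addrC. Qed.

Lemma quadratic_part x : p 2 x = 2^-1 * qform hessian0 x.
Proof.
rewrite /= kronpow2 -{1}[c 2]unvecK dotv_vec /hessian0 qformD.
have -> : qform (unvec (c 2))^T x = qform (unvec (c 2)) x.
  rewrite /qform; have -> : x^T *m (unvec (c 2))^T *m x = (x^T *m unvec (c 2) *m x)^T.
    by rewrite !trmx_mul trmxK mulmxA.
  by rewrite mxE.
rewrite /dotv mulmxA -/(qform _ x); lra.
Qed.

Lemma gradpart2 y : gradpart p 2 y = hessian0 *m y.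
Proof.
apply: eq_dotv => z; rewrite /gradpart (grad_form _ _ erefl) dkronpow2 dotvDr.
rewrite -{1 2}[c 2]unvecK !dotv_vec /hessian0 mulmxDl dotvDl addrC.
by rewrite [dotv y _]dotv_mulmx dotvC addrC; congr (_ + _); rewrite dotvC.
Qed.

Hypotheses (p0 : forall x, p 0 x = 0) (p1 : forall x, p 1 x = 0).

Lemma gradpart_lt2 i y : (i < 2)%N -> gradpart p i y = 0.
Proof.
have H k : (forall x, p k x = 0) -> gradpart p k y = 0.
  move=> pk; apply/matrixP => a b; rewrite !mxE (_ : p k = fun=> 0).
    by rewrite /partial derive_cst.
  exact/funext.
by case: i => [|[|i]]// _; exact: H.
Qed.

Let hq := hjbquad l B G Rw p.

Lemma hjbquad_lt2 p1' p2' i j y : (i < 2)%N || (j < 2)%N -> hq p1' p2' i j y = 0.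
Proof.
rewrite /hq /hjbquad => /orP[h|h]; rewrite (gradpart_lt2 _ h) !mulmx0.
  exact: dotv0l.
exact: dotv0r.
Qed.

Lemma hjbquad0 i j y : hq 0 0 i j y =
  dotv (gradpart p i y) (B *m invmx Rw *m B^T *m gradpart p j y).
Proof.
by rewrite /hq /hjbquad !gpart0 -!mulmxA [RHS]dotv_mulmx.
Qed.

(** In degree 2 the equation involves no gradient other than hessian0 *m y. *)
Lemma hessian0_riccati :
  0 = A^T *m hessian0 + hessian0 *m A
      - hessian0 *m B *m invmx Rw *m B^T *m hessian0 + Q.
Proof.
set P := hessian0; set S := B *m invmx Rw *m B^T.
have PT : P^T = P by exact: hessian0_sym.
have ST : S^T = S by exact: gain_sym.
have -> : P *m B *m invmx Rw *m B^T *m P = P *m S *m P by rewrite /S !mulmxA.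
apply/esym/qform_eq0.
  have QT : Q^T = Q by [].
  have tD (X Y : 'M[R]_n) : (X + Y)^T = X^T + Y^T by rewrite linearD.
  have tN (X : 'M[R]_n) : (- X)^T = - X^T by rewrite linearN.
  have t1 : (A^T *m P)^T = P *m A by rewrite trmx_mul trmxK PT.
  have t2 : (P *m A)^T = A^T *m P by rewrite trmx_mul PT.
  have t3 : (P *m S *m P)^T = P *m S *m P by rewrite trmx_mul [(P *m S)^T]trmx_mul PT ST mulmxA.
  by rewrite /symmetric_mx !tD tN t1 t2 t3 QT [P *m A + _]addrC.
move=> y; pose M := (l + `|lam| + 5)%N.
have h := @hjb_coef R n m l lam A F B G Q Rw q V p r Vp M 2 y V_hjb
  ltac:(rewrite /M; lia) ltac:(rewrite /M; lia) ltac:(rewrite /M; lia).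
have S1 : \sum_(i < M) \sum_(j < M)
      (if (i + j == 3)%N then dotv (gradpart p i y) (fpart l A F j y) else 0)
    = dotv (P *m y) (A *m y).
  transitivity (\sum_(i < M) if (i == 2%N :> nat) && true then dotv (P *m y) (A *m y) else 0).
    apply: eq_bigr => i _.
    transitivity (\sum_(j < M) if (j == 1%N :> nat) && (i == 2%N :> nat) then
        dotv (P *m y) (A *m y) else 0).
      apply: eq_bigr => j _.
      case: (nat_of_ord j) => [|[|j']].
      - by rewrite /= dotv0r; case: ifP.
      - rewrite addn1 eqSS /=; case: eqP => // ->.
        by rewrite -gradpart2.
      - rewrite /=; case: ifP => // /eqP ij; rewrite gradpart_lt2 ?dotv0l//; lia.
    rewrite (@sum_ord_delta _ M 1%N (i == 2%N :> nat) (fun=> dotv (P *m y) (A *m y))); last first.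
      by left; rewrite /M; lia.
    by rewrite andbT.
  by rewrite (@sum_ord_delta _ M 2%N true (fun=> dotv (P *m y) (A *m y)))//; left; rewrite /M; lia.
have S2 : sum4 M (fun p1 p2 i j => if (p1 + p2 + (i + j) == 4)%N then hq p1 p2 i j y else 0)
    = hq 0 0 2 2 y.
  rewrite -(@sum4_delta R M 0 0 2 2 (fun p1 p2 i j => hq p1 p2 i j y)); try by rewrite /M; lia.
  apply: sum4_eq => p1' p2' i j _ _ _ _.
  have [ij|ij] := boolP ((i < 2)%N || (j < 2)%N).
    by rewrite hjbquad_lt2//; do 2!case: ifP.
  by do 2!(case: ifP => ?) => //; exfalso; lia.
rewrite S1 S2 hjbquad0 gradpart2 -/P -/S /= in h.
have E1 : dotv (P *m y) (A *m y) = qform (P *m A) y.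
  by rewrite dotvC dotv_mulmx PT dotvC /dotv /qform !mulmxA.
have E2 : qform (A^T *m P) y = qform (P *m A) y.
  rewrite /qform; have -> : y^T *m (A^T *m P) *m y = (y^T *m (P *m A) *m y)^T.
    by rewrite !trmx_mul trmxK PT !mulmxA.
  by rewrite mxE.
have E3 : dotv (P *m y) (S *m (P *m y)) = qform (P *m S *m P) y.
  by rewrite dotvC dotv_mulmx PT dotvC /dotv /qform !mulmxA.
rewrite !qformD qformN E2; rewrite E1 E3 in h; lra.
Qed.

Section InductionStep.
Variables (v : forall i, 'cV[R]_(n ^ i)) (k : nat) (V2 : 'M[R]_n).
Hypotheses (k3 : (3 <= k)%N) (V2E : hessian0 = V2).
Hypothesis p_lower : forall i, (2 <= i < k)%N -> p i = (fun x => 2^-1 * dotv (v i) (kronpow x i)).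
Hypothesis v_sym : forall i, (3 <= i < k)%N -> tensor_symmetric (v i).
Hypothesis v2E : v 2 = vec V2 :> 'cV[R]_(n ^ 2).

Lemma gradpart_covec i y : (2 <= i < k)%N ->
  gradpart p i y = (2^-1 * i%:R) *: covec v i y.
Proof.
move=> /andP[i2 ik]; have [i3|i3] := leqP 3 i.
  by apply: grad_symmetric_form; [lia|apply: v_sym; lia|apply: p_lower; lia].
have -> : i = 2 by lia.
rewrite gradpart2 V2E mulVf ?pnatr_eq0// scale1r; apply: eq_dotv => z.
rewrite /covec dotv_unfold// kronpow1 (coltens_retypel _ _ (esym (expn1 n))).
have -> : retype (n ^ 2) 1 (retype (n ^ 1 * n) 1 (y *v z)) = y *v z.
  by rewrite retype_retype ?expn1//; exact: retype_id.
by rewrite v2E dotv_vec dotvC.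
Qed.

(** The part of degree k of V enters the degree k of the equation through A y and
    through its two products with the gradient V2 y of the quadratic part. Together
    these make its derivative along the closed loop, and all other terms make up the
    right-hand side. *)
Lemma hjb_step y :
  2 * dotv (c k) (dkronpow k y (closed_loop A B Rw V2 *m y)) =
  dotv (coef_rhs l lam F B G Rw q v k) (kronpow y k).
Proof.
(* beyond every degree and index that occurs *)
pose M := (k + 2 * l + `|lam| + 5)%N.
have h := @hjb_coef R n m l lam A F B G Q Rw q V p r Vp M k y V_hjb
  ltac:(rewrite /M; lia) ltac:(rewrite /M; lia) ltac:(rewrite /M; lia).
pose S := B *m invmx Rw *m B^T; pose g := gradpart p k y.
pose T p1 p2 i j := (i * j)%N%:R * quad l B G Rw v p1 p2 i j y.
pose L := \sum_(2 <= i < k.+1) \sum_(2 <= j < k.+1 | (i + j == k.+1)%N)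
       dotv (v i) (dkronpow i y (Fext l F j *m kronpow y j)).
have S1 : 2 * (\sum_(i < M) \sum_(j < M)
      (if (i + j == k.+1)%N then dotv (gradpart p i y) (fpart l A F j y) else 0))
    = 2 * dotv g (A *m y) + L.
  have -> : L = \sum_(i < M) \sum_(j < M) if [&& (2 <= i < k.+1)%N, (2 <= j < k.+1)%N &
      (i + j == k.+1)%N] then dotv (v i) (dkronpow i y (Fext l F j *m kronpow y j)) else 0.
    rewrite /L (@sum_nat_ord _ _ _ M); last by rewrite /M; lia.
    apply: eq_bigr => i _; rewrite (@sum_nat_ord _ _ _ M); last by rewrite /M; lia.
    by rewrite sum_if; apply: eq_bigr => j _; do ?[case: ifP => ?] => //; exfalso; lia.
  have -> : 2 * dotv g (A *m y) = \sum_(i < M) \sum_(j < M)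
      if (j == 1%N :> nat) && (i == k :> nat) then 2 * dotv g (A *m y) else 0.
    rewrite -[LHS](@sum_ord_delta _ M k true (fun=> 2 * dotv g (A *m y))); last first.
      by left; rewrite /M; lia.
    apply: eq_bigr => i _; rewrite (@sum_ord_delta _ M 1%N (i == k :> nat)
      (fun=> 2 * dotv g (A *m y))); first by rewrite andbT.
    by left; rewrite /M; lia.
  rewrite -big_split mulr_sumr; apply: eq_bigr => i _.
  rewrite -big_split mulr_sumr; apply: eq_bigr => j _ /=.
  case: (nat_of_ord j) => [|[|j']].
  - by rewrite /= andbF dotv0r addr0; case: ifP => _; rewrite mulr0.
  - rewrite addn1 eqSS /= andbF addr0; case: eqP => [->|_]; first by [].
    by rewrite mulr0.
  - rewrite [(_ == 1%N)]/= add0r.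
    have [i2|i2] := ltnP i 2.
      by rewrite gradpart_lt2// dotv0l; do ?[case: ifP => ?]; rewrite ?mulr0//; exfalso; lia.
    case: ifP => ij; last by rewrite mulr0 ifF//; lia.
    rewrite ifT; last by lia.
    rewrite /gradpart (@grad_form _ _ _ (2^-1 *: v i)); last first.
      rewrite p_lower; last by lia.
      by apply/funext => x; rewrite dotvZl.
    by rewrite dotvZl mulrA mulfV ?mul1r// pnatr_eq0.
have S2 : sum4 M (fun p1 p2 i j => if (p1 + p2 + (i + j) == k.+2)%N then hq p1 p2 i j y else 0)
    = 2 * dotv g (S *m (V2 *m y)) + 4^-1 * sum4 M (fun p1 p2 i j =>
        if [&& (2 <= i < k)%N, (2 <= j < k)%N & (p1 + p2 + (i + j) == k.+2)%N]
        then T p1 p2 i j else 0).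
  have -> : 2 * dotv g (S *m (V2 *m y)) = hq 0 0 k 2 y + hq 0 0 2 k y.
    rewrite !hjbquad0 -/S -/g gradpart2 V2E.
    rewrite [dotv (V2 *m y) _]dotv_mulmx [S^T]gain_sym// [dotv (S *m _) _]dotvC.
    ring.
  rewrite -(@sum4_delta R M 0 0 k 2 (fun p1 p2 i j => hq p1 p2 i j y)); try by rewrite /M; lia.
  rewrite -(@sum4_delta R M 0 0 2 k (fun p1 p2 i j => hq p1 p2 i j y)); try by rewrite /M; lia.
  rewrite -sum4Z -!sum4D; apply: sum4_eq => p1' p2' i j _ _ _ _.
  have [ij|ij] := boolP ((i < 2)%N || (j < 2)%N).
    rewrite hjbquad_lt2// [X in 4^-1 * X]ifF; last by lia.
    by rewrite mulr0 addr0; do ?[case: ifP => _]; rewrite ?addr0.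
  have [ijk|ijk] := boolP [&& (2 <= i < k)%N, (2 <= j < k)%N & (p1' + p2' + (i + j) == k.+2)%N].
    rewrite ifT; last by lia.
    rewrite ifF; last by lia.
    rewrite ifF; last by lia.
    rewrite !add0r /hq /hjbquad /T /quad !gradpart_covec; try lia.
    rewrite -!scalemxAr dotvZl dotvZr natrM; set D := dotv _ _; by field.
  rewrite mulr0 addr0.
  have [ijs|ijs] := eqVneq (p1' + p2' + (i + j))%N k.+2; last first.
    by rewrite ifF ?add0r ?ifF//; lia.
  have [ik|ik] := eqVneq i k.
    rewrite ifT; last by lia.
    by rewrite ifF ?addr0//; lia.
  rewrite ifF; last by lia.
  by rewrite add0r ifT//; lia.
have pen : penpart lam Q q k y = dotv (qext lam q k) (kronpow y k).
  by case: (k) k3 => [|[|[|k']]].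
have T0 a b i j : (l < a)%N || (l < b)%N -> T a b i j = 0.
  by rewrite /T /quad => /orP[h'|h']; rewrite (gpart_gt B G y h') trmx0 !(mul0mx, mulmx0) ?dotv0l ?dotv0r mulr0.
have rhs := coef_rhs_form l lam F B G Rw q v k y.
have := @coef_rhs_sum4 R T l k M T0 ltac:(rewrite /M; lia) ltac:(rewrite /M; lia).
set X2 := (X in X + _ = _); set X3 := (X in _ + X = _); move=> X23.
have {}rhs : dotv (coef_rhs l lam F B G Rw q v k) (kronpow y k) =
   - L - dotv (qext lam q k) (kronpow y k) + 4^-1 * X2 + 4^-1 * X3 by exact: rhs.
have gE z : dotv (c k) (dkronpow k y z) = dotv g z.
  by rewrite /g /gradpart (grad_form _ _ erefl).
rewrite gE /closed_loop mulmxBl -!mulmxA.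
have -> : B *m (invmx Rw *m (B^T *m (V2 *m y))) = S *m (V2 *m y) by rewrite /S !mulmxA.
have dB : dotv g (A *m y - S *m (V2 *m y)) = dotv g (A *m y) - dotv g (S *m (V2 *m y)).
  by rewrite dotvDr -scaleN1r dotvZr mulN1r.
rewrite dB rhs; move: h S1 S2; rewrite pen -X23 -/hq; clear.
move: (\sum_(i < M) _) (sum4 M _) (dotv g (A *m y)) (dotv g _) (dotv (qext lam q k) _) X2 X3 L.
by move=> a1 a2 a3 a4 a5 a6 a7 a8 h1 h2 h3; lra.
Qed.

End InductionStep.

End ValueFunction.

(** * The Taylor polynomial of the value function *)

Section Conclusion.
Variables (R : realType) (n m l d : nat) (lam : int).
Variables (A : 'M[R]_n) (F : forall p, 'M[R]_(n, n ^ p)).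
Variables (B : 'M[R]_(n, m)) (G : forall p, 'M[R]_(n, n ^ p * m)).
Variables (Q : 'M[R]_n) (Rw : 'M[R]_m) (q : forall p, 'cV[R]_(n ^ p)).
Variables (V : 'cV[R]_n -> R).

Lemma min_cost_ge0 x0 c : penalty_psd_form lam Q q -> posdef Rw ->
  is_min_cost (fdyn l A F) (gdyn l B G) (running lam Q Rw q) x0 c -> 0 <= c.
Proof.
move=> [QQ [_ QQpsd QQE]] Rpos [x [u [_ cE]]].
rewrite -lee_fin -cE; apply: integral_ge0 => t _; rewrite lee_fin.
rewrite mulr_ge0 ?invr_ge0// addr_ge0//; last exact: posdef_psd.
by rewrite QQE; exact: (QQpsd _).2.
Qed.

(** Both polynomials, restricted to the ray s x, are polynomials in s. *)
Lemma half_poly_low (c : forall k, 'cV[R]_(n ^ k)) r w : (2 <= d)%N ->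
  power_series V (fun k x => dotv (c k) (kronpow x k)) r ->
  (forall x, taylor d V x = half_poly d w x) ->
  forall k x, (k < 2)%N -> dotv (c k) (kronpow x k) = 0.
Proof.
move=> d2 Vp Vw k x k2.
pose P : {poly R} := \sum_(i < d.+1) (dotv (c i) (kronpow x i)
   - (if (2 <= i)%N then 2^-1 * dotv (w i) (kronpow x i) else 0)) *: 'X^i.
have P0 s : P.[s] = 0.
  have := Vw (s *: x); rewrite (taylor_power_series d Vp) /half_poly.
  rewrite (@sum_nat_ord _ _ _ d.+1)// mulr_sumr => /eqP; rewrite -subr_eq0 -sumrB => /eqP E.
  rewrite /P horner_sum -[RHS]E; apply: eq_bigr => i _.
  rewrite hornerZ hornerXn andbT ltn_ord andbT !kronpow_scale dotvZr mulrBl mulrC.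
  congr (_ - _); case: ifP => _; last by rewrite mul0r mulr0.
  by rewrite -/(dotv _ _) dotvZr; ring.
have Pk : P`_k = dotv (c k) (kronpow x k).
  rewrite /P coef_sum.
  transitivity (\sum_(i < d.+1) if (i == k :> nat) && true then dotv (c i) (kronpow x i) else 0).
    apply: eq_bigr => i _; rewrite coefZ coefXn eq_sym andbT.
    case: eqP => [->|_]; last by rewrite mulr0.
    by rewrite leqNgt k2 subr0 mulr1.
  rewrite (@sum_ord_delta _ d.+1 k true (fun i => dotv (c i) (kronpow x i)))//; left; lia.
rewrite -Pk; apply: (@approx0_coef R d.+1); last by lia.
rewrite (_ : (fun s => P.[s]) = (fun=> 0)); first exact: approx_cst.
by apply/funext => s; rewrite P0.
Qed.

(** The quadratic part of V is a positive semidefinite solution of the Riccati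
    equation because costs are nonnegative, hence it is the one of V2. In degree k,
    twice the coefficient of V and the solution vt of the linear system have the same
    derivative along the closed loop; their difference is constant along trajectories
    tending to 0, so it vanishes on all of them. *)
Lemma taylor_given_by (V2 : 'M[R]_n) (v : forall i, 'cV[R]_(n ^ i)) :
  (2 <= d)%N -> symmetric_mx Q -> psd Q -> symmetric_mx Rw -> posdef Rw ->
  penalty_psd_form lam Q q ->
  (exists V2 : 'M[R]_n, lqr_stabilizing A B Q Rw V2) ->
  (\forall x0 \near (0 : 'cV[R]_n),
      is_min_cost (fdyn l A F) (gdyn l B G) (running lam Q Rw q) x0 (V x0)) ->
  analytic_at V 0 ->
  (\forall x \near (0 : 'cV[R]_n), hjb_at l lam A F B G Q Rw q V x) ->
  (exists w : forall i, 'cV[R]_(n ^ i),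
      forall x : 'cV[R]_n, taylor d V x = half_poly d w x) ->
  coefs_given_by l lam A F B G Q Rw q d V2 v ->
  forall x : 'cV[R]_n, taylor d V x = half_poly d v x.
Proof.
move=> d2 Qsym Qpsd Rsym Rpos penform [W Wlqr] Vmin Van Vhjb [w Vw] [V2ric v2 vk].
have [c [r Vp]] := analytic_power_series Van.
have low := half_poly_low d2 Vp Vw.
have p0 x : dotv (c 0) (kronpow x 0) = 0 by apply: low.
have p1 x : dotv (c 1) (kronpow x 1) = 0 by apply: low.
have Pric : riccati_psd A B Q Rw (hessian0 c).
  split; first exact: hessian0_sym.
    move=> y; have := power_series_quadratic_ge0 Vp p0 p1 _ y.
    rewrite (quadratic_part c y) pmulr_rge0 ?invr_gt0//; apply.
    by apply: filterS Vmin => x; exact: min_cost_ge0.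
  exact: (hessian0_riccati Qsym Rsym Vp Vhjb p0 p1).
have uniq P : riccati_psd A B Q Rw P -> P = W by exact: riccati_psd_unique.
have PV2 : hessian0 c = V2 by rewrite (uniq _ Pric) (uniq _ V2ric).
have V2W : V2 = W by exact: uniq.
have [_ Wh _] := Wlqr; have flow := lqr_flow Wlqr.
have fact_neq0 k : (k`!%:R : R) != 0 by rewrite pnatr_eq0 -lt0n fact_gt0.
have main k : (2 <= k <= d)%N ->
    (fun x => dotv (c k) (kronpow x k)) = (fun x => 2^-1 * dotv (v k) (kronpow x k)).
  elim/ltn_ind: k => k IHk /andP[k2 kd]; apply/funext => x0.
  have [k3|k3] := leqP 3 k; last first.
    have -> : k = 2 by lia.
    by rewrite (quadratic_part c x0) PV2 v2 kronpow2 dotv_vec /dotv /qform mulmxA.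
  have [vt [sys sym]] : exists vt : 'cV[R]_(n ^ k),
      coef_system l lam A F B G Rw q V2 v vt /\ is_symmetrization vt (v k).
    by apply: vk; rewrite k3.
  have step y : 2 * dotv (c k) (dkronpow k y (closed_loop A B Rw V2 *m y)) =
      dotv (coef_rhs l lam F B G Rw q v k) (kronpow y k).
    apply: (hjb_step Rsym Vp Vhjb p0 p1 k3 PV2) => // i /andP[i2 ik].
      by apply: IHk => //; rewrite i2 (leq_trans (ltnW ik)).
    have [|vti [_ [symi _]]] := vk i; last exact: symi.
    by rewrite i2 (leq_trans (ltnW ik)).
  rewrite (symmetrization_form _ (fact_neq0 k) sym).
  suff e0 : dotv (2 *: c k - vt) (kronpow x0 k) = 0.
    by move: e0; rewrite dotvDl dotvNl dotvZl; lra.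
  have [x [xS x0E]] := flow x0; rewrite -V2W in Wh xS.
  case: k k3 {IHk k2 kd} vt sys sym step => // k _ vt /coef_system_sqlyap sys _ step.
  have := @sqlyap_conserved R n k _ (fun=> x) (2 *: c k.+1 - vt) Wh (fun=> xS).
  rewrite -kronpow_kronprod x0E; apply => t _.
  rewrite -kronpow_kronprod -dotv_mulmx sqlyap_kronpow dotvDl dotvNl dotvZl step.
  by rewrite -sys -dotv_mulmx sqlyap_kronpow subrr.
move=> x; rewrite (taylor_power_series d Vp) /half_poly.
rewrite (@sum_nat_ord _ _ _ d.+1)// mulr_sumr; apply: eq_bigr => k _.
rewrite andbT ltn_ord andbT; case: ifP => k2.
  by have /(congr1 (fun f => f x)) := main k ltac:(by rewrite k2 -ltnS ltn_ord).
by rewrite mulr0 low// ltnNge k2.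
Qed.

End Conclusion.

Theorem theorem3 (R : realType) (n m l d : nat) (lam : int)
    (n_gt0 : (1 <= n)%N) (m_gt0 : (1 <= m)%N) (l_gt0 : (1 <= l)%N)
    (d_ge2 : (2 <= d)%N)
    (A : 'M[R]_n) (F : forall p, 'M[R]_(n, n ^ p))
    (B : 'M[R]_(n, m)) (G : forall p, 'M[R]_(n, n ^ p * m))
    (Q : 'M[R]_n) (Rw : 'M[R]_m) (q : forall p, 'cV[R]_(n ^ p))
    (V : 'cV[R]_n -> R)
    (Q_sym : symmetric_mx Q) (Q_psd : psd Q)
    (Rw_sym : symmetric_mx Rw) (Rw_pos : posdef Rw)
    (penalty_form : penalty_psd_form lam Q q)
    (lqr : exists V2 : 'M[R]_n, lqr_stabilizing A B Q Rw V2)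
    (V_value : \forall x0 \near (0 : 'cV[R]_n),
      is_min_cost (fdyn l A F) (gdyn l B G) (running lam Q Rw q) x0 (V x0))
    (V_analytic : \forall a \near (0 : 'cV[R]_n), analytic_at V a)
    (V_hjb : \forall x \near (0 : 'cV[R]_n), hjb_at l lam A F B G Q Rw q V x)
    (V_form : exists w : forall i, 'cV[R]_(n ^ i),
      forall x : 'cV[R]_n, taylor d V x = half_poly d w x) :
  (exists (V2 : 'M[R]_n) (v : forall i, 'cV[R]_(n ^ i)),
     coefs_given_by l lam A F B G Q Rw q d V2 v) /\
  (forall (V2 : 'M[R]_n) (v : forall i, 'cV[R]_(n ^ i)),
     coefs_given_by l lam A F B G Q Rw q d V2 v ->
     forall x : 'cV[R]_n, taylor d V x = half_poly d v x).
Proof.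
split.
  by have [V2 V2lqr] := lqr; exists V2; exact: coefs_exist.
by move=> V2 v; apply: taylor_given_by => //; exact: nbhs_singleton V_analytic.
Qed.
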